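(* Let $n\geq 1$ and let $V:\mathbb{R}^n\to\mathbb{R}$ be bounded and continuous with $V(x)>0$ for all $x\in\mathbb{R}^n$. Then there exists a constant $C>0$, independent of $t$ and of the initial data, such that the following holds. Let $(u_0,u_1)\in H^1(\mathbb{R}^n)\times L^2(\mathbb{R}^n)$ satisfy \[ I_0^2:=\int_{\mathbb{R}^n}\frac{|u_1(x)|^2}{V(x)}\,dx<+\infty, \] and let $u\in C([0,\infty);H^1(\mathbb{R}^n))\cap C^1([0,\infty);L^2(\mathbb{R}^n))$ be the unique weak solution of \[ u_{tt}-\Delta u+V(x)u=0\quad (t>0,\ x\in\mathbb{R}^n),\qquad u(0,x)=u_0(x),\quad u_t(0,x)=u_1(x)\quad (x\in\mathbb{R}^n). \] Then \[ \|u(t,\cdot)\|\leq C(\|u_0\|+I_0)\qquad\text{for all } t\geq 0. \]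
   Context: All functions are real-valued. $\|\cdot\|$ denotes the norm of $L^2(\mathbb{R}^n)$, and $I_0\ge 0$ is the nonnegative square root of $I_0^2$. A weak solution is a function in the stated class satisfying the equation in the sense of distributions on $(0,\infty)\times\mathbb{R}^n$ and attaining the initial data; it is known that for every $(u_0,u_1)\in H^1(\mathbb{R}^n)\times L^2(\mathbb{R}^n)$ there is a unique one. *)

(* Defs.v *)
From HB Require Import structures.
From mathcomp Require Import all_boot all_order all_algebra.
From mathcomp Require Import all_classical all_reals all_analysis.

Set Implicit Arguments.
Unset Strict Implicit.
Unset Printing Implicit Defensive.

Import Order.TTheory GRing.Theory Num.Theory.
Import numFieldNormedType.Exports.

Local Open Scope classical_set_scope.
Local Open Scope ring_scope.

(* R^n is the type 'rV[R]_n of row vectors. Its library norm is the sup norm,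
   but only the topology and the directional derivatives are used below. *)

Definition measure_rV_display : measure_display -> measure_display.
Proof. exact. Qed.

Section measurable_rV.
Context d (T : measurableType d) (n : nat).

(* The product sigma-algebra, as for n.-tuple T in the library. *)
Let coord : 'I_n -> 'rV[T]_n -> T := fun i x => x ord0 i.

Let rV_set0 : g_sigma_preimage coord set0.
Proof. exact: sigma_algebra0. Qed.

Let rV_setC A : g_sigma_preimage coord A -> g_sigma_preimage coord (~` A).
Proof. exact: sigma_algebraC. Qed.

Let rV_bigcup (F : (set 'rV[T]_n)^nat) :
  (forall i, g_sigma_preimage coord (F i)) ->
  g_sigma_preimage coord (\bigcup_i F i).
Proof. exact: sigma_algebra_bigcup. Qed.

HB.instance Definition _ := @isMeasurable.Build (measure_rV_display d)
  'rV[T]_n (g_sigma_preimage coord) rV_set0 rV_setC rV_bigcup.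

Lemma measurable_coord_rV (i : 'I_n) :
  measurable_fun [set: 'rV[T]_n] (fun x : 'rV[T]_n => x ord0 i).
Proof.
move=> _ Y mY; rewrite setTI; apply: sub_sigma_algebra => /=.
rewrite -bigcup_seq/=; exists i => /=; first by rewrite mem_index_enum.
by exists Y => //; rewrite setTI.
Qed.

End measurable_rV.

Lemma measurable_fun_rV d1 d2 (T1 : measurableType d1) (T2 : measurableType d2)
    (n : nat) (f : T1 -> 'rV[T2]_n) :
  (forall i, measurable_fun [set: T1] (fun x => f x ord0 i)) ->
  measurable_fun [set: T1] f.
Proof.
move=> mf _ Y mY; rewrite setTI.
pose G := [set A : set 'rV[T2]_n | measurable (f @^-1` A)].
have sG : sigma_algebra setT G.
  split => [|A mA|F mF].
  - by rewrite /G/= preimage_set0; exact: measurable0.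
  - by rewrite /G/= setTD -preimage_setC; exact: measurableC.
  - by rewrite /G/= preimage_bigcup; apply: bigcup_measurable => k _; exact: mF.
suff : measurable `<=` G by move=> mG; exact: (mG _ mY).
apply: smallest_sub => //.
rewrite -bigcup_seq => A [i _] [B mB <-].
rewrite /G /= setTI.
by have := mf i measurableT B mB; rewrite setTI.
Qed.

Lemma sigma_finite_prod d1 d2 (T1 : measurableType d1) (T2 : measurableType d2)
    (R : realType) (m1 : {sigma_finite_measure set T1 -> \bar R})
    (m2 : {sigma_finite_measure set T2 -> \bar R}) :
  sigma_finite setT (m1 \x m2)%E.
Proof.
have /sigma_finiteP[F [TF ndF Foo]] := sigma_finiteT m1.
have /sigma_finiteP[G [TG ndG Goo]] := sigma_finiteT m2.
exists (fun n => F n `*` G n).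
  rewrite -setXTT TF TG predeqE => -[x y]; split.
    move=> [/= [n _ Fnx] [k _ Gky]]; exists (maxn n k) => //; split.
    - by move: x Fnx; exact/subsetPset/ndF/leq_maxl.
    - by move: y Gky; exact/subsetPset/ndG/leq_maxr.
  by move=> [n _ []/= ? ?]; split; exists n.
move=> k; have [? ?] := Foo k; have [? ?] := Goo k.
split; first exact: measurableX.
by rewrite product_measure1E// lte_mul_pinfty// ge0_fin_numE.
Qed.

Section lebesgue_measure_rV.
Context (R : realType).

Definition cons_rV (n : nat) (p : measurableTypeR R * 'rV[R]_n) : 'rV[R]_n.+1 :=
  row_mx p.1%:M p.2.

Definition uncons_rV (n : nat) (x : 'rV[R]_n.+1) :
    measurableTypeR R * 'rV[R]_n :=
  (x ord0 ord0, rsubmx (x : 'rV[R]_(1 + n))).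

Lemma cons_rVK n : cancel (@cons_rV n) (@uncons_rV n).
Proof.
move=> [t x]; rewrite /uncons_rV /cons_rV /= row_mxKr; congr pair.
rewrite (_ : ord0 = lshift n (ord0 : 'I_1) :> 'I_n.+1); last exact/val_inj.
by rewrite (@row_mxEl _ 1 1 n) mxE eqxx.
Qed.

Lemma measurable_cons_rV n :
  measurable_fun [set: measurableTypeR R * 'rV[R]_n] (@cons_rV n).
Proof.
apply: measurable_fun_rV => i.
rewrite /cons_rV.
case: (@split_ordP 1 n i) => j ->.
- rewrite (_ : (fun _ => _) = fst); first exact: measurable_fst.
  by apply/funext => x; rewrite (@row_mxEl _ 1 1 n) mxE !ord1 eqxx.
- rewrite (_ : (fun _ => _) = (fun x : 'rV[R]_n => x ord0 j) \o snd).
    by apply: measurableT_comp => //; exact: measurable_coord_rV.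
  by apply/funext => x; rewrite (@row_mxEr _ 1 1 n).
Qed.

Lemma measurable_uncons_rV n :
  measurable_fun [set: 'rV[R]_n.+1] (@uncons_rV n).
Proof.
apply: measurable_fun_pair; first exact: measurable_coord_rV.
apply: measurable_fun_rV => i.
rewrite (_ : (fun _ => _) = fun x : 'rV[R]_n.+1 => x ord0 (rshift 1 i)).
  exact: (@measurable_coord_rV _ _ n.+1).
by apply/funext => x; rewrite mxE.
Qed.

Section step.
Context (n : nat) (mu : {sigma_finite_measure set 'rV[R]_n -> \bar R}).

HB.instance Definition _ := @isMeasurableFun.Build _ _ _ _
  (@cons_rV n) (@measurable_cons_rV n).

Definition lebesgue_rV_step : set 'rV[R]_n.+1 -> \bar R :=
  pushforward (@lebesgue_measure R \x mu)%E (@cons_rV n).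

Let step0 : lebesgue_rV_step set0 = 0%E.
Proof. exact: measure0. Qed.

Let step_ge0 A : (0 <= lebesgue_rV_step A)%E.
Proof. exact: measure_ge0. Qed.

Let step_sigma_additive : semi_sigma_additive lebesgue_rV_step.
Proof. exact: measure_semi_sigma_additive. Qed.

HB.instance Definition _ := isMeasure.Build _ _ _ lebesgue_rV_step
  step0 step_ge0 step_sigma_additive.

Let lebesgue_rV_step_sigma_finite : sigma_finite setT lebesgue_rV_step.
Proof.
have [F FT mF] := sigma_finite_prod (@lebesgue_measure R) mu.
have preF k : (@cons_rV n) @^-1` ((@uncons_rV n) @^-1` F k) = F k.
  by apply/seteqP; split => x /=; rewrite cons_rVK.
exists (fun k => (@uncons_rV n) @^-1` F k).
  by rewrite -preimage_bigcup -FT preimage_setT.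
move=> k; have [mFk Fkoo] := mF k; split.
  by rewrite -[X in measurable X]setTI; exact: measurable_uncons_rV.
by rewrite /lebesgue_rV_step /pushforward preF.
Qed.

HB.instance Definition _ := Measure_isSigmaFinite.Build _ _ _
  lebesgue_rV_step lebesgue_rV_step_sigma_finite.

End step.

(* Lebesgue measure on R^n, on the Borel sets: the n-fold product of the
   one-dimensional one. *)
Fixpoint lebesgue_rV (n : nat) : {sigma_finite_measure set 'rV[R]_n -> \bar R} :=
  if n is m.+1 then lebesgue_rV_step (lebesgue_rV m)
  else \d_ (0 : 'rV[R]_0).

End lebesgue_measure_rV.

Arguments lebesgue_rV {R} n.

Section test_functions.
Context (R : realType) (E : normedModType R).

Fixpoint Ck (k : nat) (f : E -> R) : Prop :=
  continuous f /\
  if k is k'.+1 then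
    forall v, (forall x, derivable f x v) /\ Ck k' (fun x => 'D_v f x)
  else True.

Definition smooth (f : E -> R) : Prop := forall k, Ck k f.

Definition support_of (f : E -> R) : set E := closure [set x | f x != 0].

Definition test_function (Omega : set E) (f : E -> R) : Prop :=
  [/\ smooth f, compact (support_of f) & support_of f `<=` Omega].

End test_functions.

Section spaces.
Context (R : realType) (n : nat).
Local Notation E := 'rV[R]_n.
Local Notation mu := (@lebesgue_rV R n).

Definition L2 : set (E -> R) := [set f | f \in Lfun mu 2%:E].

Definition L2norm (f : E -> R) : R := fine 'N[mu]_2%:E[EFin \o f].

Definition basis_vec (i : 'I_n) : E := delta_mx ord0 i.

Definition is_weak_partial (i : 'I_n) (f g : E -> R) : Prop :=
  forall phi : E -> R, test_function setT phi ->
    \int[mu]_x (f x * 'D_(basis_vec i) phi x) = - \int[mu]_x (g x * phi x).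

Definition H1 : set (E -> R) :=
  [set f | L2 f /\ forall i, exists2 g, L2 g & is_weak_partial i f g].

(* A representative of the i-th weak derivative of f, which is unique up to a
   null set; meaningful only for f in H1. *)
Definition weak_partial (i : 'I_n) (f : E -> R) : E -> R :=
  xget (cst 0) [set g | L2 g /\ is_weak_partial i f g].

Definition H1norm (f : E -> R) : R :=
  Num.sqrt (L2norm f ^+ 2 + \sum_(i < n) L2norm (weak_partial i f) ^+ 2).

(* Functions of time with values in L2 or H1 are families u : R -> E -> R of
   representatives; their values at negative times are irrelevant. *)
Definition halfline : set R := [set t | 0 <= t].

Definition C0_halfline (X : set (E -> R)) (N : (E -> R) -> R)
    (u : R -> E -> R) : Prop :=
  forall t, 0 <= t ->
    X (u t) /\
    N (fun x => u s x - u t x) @[s --> within halfline (nbhs t)] --> (0 : R).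

(* du is the time derivative of u for the norm N, one-sided at t = 0. *)
Definition time_derivative (N : (E -> R) -> R) (u du : R -> E -> R) : Prop :=
  forall t, 0 <= t ->
    N (fun x => (s - t)^-1 * (u s x - u t x) - du t x)
      @[s --> within halfline t^'] --> (0 : R).

Definition spacetime : normedModType R := (R * E)%type.

Definition dt (phi : spacetime -> R) : spacetime -> R :=
  fun z => 'D_((1, 0) : spacetime) phi z.

Definition dx (i : 'I_n) (phi : spacetime -> R) : spacetime -> R :=
  fun z => 'D_((0, basis_vec i) : spacetime) phi z.

Definition laplacian (phi : spacetime -> R) : spacetime -> R :=
  fun z => \sum_(i < n) dx i (dx i phi) z.

(* u_tt - Laplacian u + V u = 0 in the sense of distributions on
   (0, +oo) x R^n. A continuous u : [0, +oo) -> L2 acts as the distribution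
   phi |-> int_0^oo (u t, phi (t, .))_(L2) dt; the iterated integral avoids
   choosing the representatives u t jointly measurably. *)
Definition wave_eq_distr (V : E -> R) (u : R -> E -> R) : Prop :=
  forall phi : spacetime -> R,
    test_function [set z : spacetime | 0 < z.1] phi ->
    \int[@lebesgue_measure R]_(t in [set t : R | 0 < t])
      (\int[mu]_x (u t x *
        (dt (dt phi) (t, x) - laplacian phi (t, x) + V x * phi (t, x)))) = 0.

Definition weak_solution (V u0 u1 : E -> R) (u : R -> E -> R) : Prop :=
  exists ut : R -> E -> R,
    [/\ C0_halfline H1 H1norm u,
        C0_halfline L2 L2norm ut /\ time_derivative L2norm u ut,
        {ae mu, forall x, u 0 x = u0 x},
        {ae mu, forall x, ut 0 x = u1 x} &
        wave_eq_distr V u].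

(* I_0^2, possibly +oo. *)
Definition I0sq (V u1 : E -> R) : \bar R :=
  (\int[mu]_x (`|u1 x| ^+ 2 / V x)%:E)%E.

Definition I0 (V u1 : E -> R) : R := Num.sqrt (fine (I0sq V u1)).

End spaces.

(* Main.v *)
(* Let a(f, g) be the sum of the (D_i f, D_i g) plus (V f, g), and v(t) the integral
   of u over [0, t]. Integrating the equation once in time gives
   (u_t(t) - u_1, w) + a(v(t), w) = 0 for w in H^1; with w = u(t) = v'(t) this integrates to
   |u(t)|^2 / 2 + a(v(t), v(t)) / 2 - (u_1, v(t)) = |u_0|^2 / 2.
   Since 2 u_1 v <= u_1^2 / V + V v^2 pointwise, |u(t)|^2 <= |u_0|^2 + I_0^2, so C = 1 works.

   No vector-valued integral is formed: v is replaced by Riemann sums, and both identities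
   hold up to an arbitrarily small error. To pass from test functions to w in H^1, the
   equation is tested with phi = k(. - y), where k is a mollifier, and averaged against
   w(y) dy. Integration by parts moves the derivatives from k to w, which makes the error
   terms uniform in the mollification scale. *)

Require Import Defs.
From HB Require Import structures.
From mathcomp Require Import all_boot all_order all_algebra.
From mathcomp Require Import all_classical all_reals all_analysis measurable_realfun.
From mathcomp Require Import ring lra.
Set Implicit Arguments.
Unset Strict Implicit.
Unset Printing Implicit Defensive.
Import Order.TTheory GRing.Theory Num.Theory.
Import numFieldNormedType.Exports.
Local Open Scope classical_set_scope.
Local Open Scope ring_scope.

(** * Square integrable functions *)

(** The bound on increments of $(u_t, w)$ needs a constant that survives two limits: from integrable
    to general [w], and in the mollification scale. Averaging the tested equation only gives one
    that contains the integral of [|w|] and the derivatives of the kernel. That still makes the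
    mollified velocity differentiable, with the mollified force as derivative, and by the mean value
    theorem the constant becomes the Lipschitz constant of that force. This exchange is made twice:
    its first result depends on [w] through the $L^2$ norm only, its second, after the integration
    by parts, no longer on the kernel.

    Near a time $t$, continuity and differentiability of $u$ come with a radius depending on $t$, so
    the Riemann sums are built by a supremum argument on $[0, T]$, not on a partition fixed in
    advance. They need not converge: the final inequality holds for every $v$ in $H^1$.

    Since $v(0) = 0$, no norm of $\nabla u_0$ enters. The gradient part of $a(v, v)$ is nonnegative
    and dropped, and $|u_0|^2 + I_0^2 \le (|u_0| + I_0)^2$ gives the constant. *)

Section square_integrable.
Context d (T : measurableType d) (R : realType) (mu : {measure set T -> \bar R}).
Implicit Types f g h : T -> R.

(** Membership in the library class [Lfun mu 2] in terms of real-valued integrals, so that scalar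
    products can be computed in [R]. The translation is made by [sqintP] and [Lnorm2E]. *)
Definition sqint f :=
  measurable_fun setT f /\ mu.-integrable setT (EFin \o (fun x => f x ^+ 2)).

Definition ip f g := \int[mu]_x (f x * g x).

Definition nrm f := Num.sqrt (ip f f).

Lemma ipE f g : ip f g = \int[mu]_x (f x * g x). Proof. by []. Qed.

Lemma sqintP f : f \in Lfun mu 2%:E <-> sqint f.
Proof.
split=> [f2|[mf f2]].
  split; last exact: Lfun2_integrable_sqr.
  by move: f2; rewrite inE => /andP[]; rewrite inE.
rewrite inE; apply/andP; split; rewrite inE//=.
rewrite /finite_norm unlock poweR_lty//.
have /integrableP[_] := f2; apply: le_lt_trans.
rewrite ge0_le_integral//=.
- apply/measurable_EFinP.
  exact/(@measurableT_comp _ _ _ _ _ _ (fun x : R => x `^ 2)%R)/measurableT_comp.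
- apply/measurable_EFinP/measurableT_comp => //.
  exact: (measurable_funX 2 mf).
- by move=> x _; rewrite lee_fin normrX powR_mulrn.
Qed.

Lemma Lnorm2E f : sqint f -> fine ('N[mu]_2%:E [EFin \o f])%E = nrm f.
Proof.
move=> [mf f2]; rewrite unlock /nrm /ip /Rintegral.
have -> : (\int[mu]_x (`|(EFin \o f) x| `^ 2))%E = (\int[mu]_x (f x * f x)%:E)%E.
  by apply: eq_integral => x _ /=; rewrite powR_mulrn// real_normK ?num_real.
have fin : (\int[mu]_x (f x * f x)%:E)%E \is a fin_num.
  exact: (integrable_fin_num _ f2).
by rewrite -(fineK fin) poweR_EFin/= powR12_sqrt// fine_ge0// integral_ge0//
  => x _; rewrite lee_fin -expr2 sqr_ge0.
Qed.

Lemma sqint_mul f g : sqint f -> sqint g -> mu.-integrable setT (EFin \o (f \* g)).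
Proof.
by move=> /sqintP f2 /sqintP g2; apply/Lfun1_integrable/Lfun2_mul_Lfun1.
Qed.

Lemma le_sqint f g : measurable_fun setT f -> (forall x, `|f x| <= `|g x|) ->
  sqint g -> sqint f.
Proof.
move=> mf fg [mg g2]; split => //.
apply: le_integrable g2 => //.
  by apply/measurable_EFinP; exact: measurable_funX.
move=> x _ /=; rewrite lee_fin !ger0_norm ?sqr_ge0//.
by rewrite -(real_normK (num_real (f x))) -(real_normK (num_real (g x))) lerXn2r ?nnegrE.
Qed.

Lemma sqintD f g : sqint f -> sqint g -> sqint (fun x => f x + g x).
Proof.
move=> f2 g2; have [mf if2] := f2; have [mg ig2] := g2.
split; first exact: measurable_funD.
have := sqint_mul f2 g2 => ifg.
rewrite (_ : _ \o _ = ((EFin \o (fun x => f x ^+ 2)%R) \+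
  ((fun x => 2%:E * (EFin \o (f \* g)%R) x) \+ (EFin \o (fun x => g x ^+ 2)%R)))%E); last first.
  by apply/funext => x /=; rewrite -EFinM -!EFinD; congr EFin; ring.
by do 2!apply: integrableD => //; exact: integrableZl.
Qed.

Lemma sqintZ (a : R) f : sqint f -> sqint (fun x => a * f x).
Proof.
move=> [mf f2]; split; first exact: measurable_funM.
rewrite (_ : _ \o _ = (fun x => (a ^+ 2)%:E * (EFin \o (fun x => f x ^+ 2)%R) x)%E).
  exact: integrableZl.
by apply/funext => x /=; rewrite -EFinM exprMn.
Qed.

Lemma sqintN f : sqint f -> sqint (fun x => - f x).
Proof.
by move=> /(sqintZ (-1)); under eq_fun do rewrite mulN1r.
Qed.

Lemma sqintB f g : sqint f -> sqint g -> sqint (fun x => f x - g x).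
Proof. by move=> f2 /sqintN; exact: sqintD. Qed.

Lemma sqint0 : sqint (cst 0).
Proof.
split => //; rewrite (_ : _ \o _ = cst 0%E); first exact: integrable0.
by apply/funext => x /=; rewrite expr0n.
Qed.

Lemma sqint_abs f : sqint f -> sqint (fun x => `|f x|).
Proof.
move=> f2; apply: (le_sqint _ _ f2) => [|x]; last by rewrite normr_id.
by apply: measurableT_comp => //; exact: f2.1.
Qed.

Lemma sqintMr f (b : T -> R) M : measurable_fun setT b -> (forall x, `|b x| <= M) ->
  sqint f -> sqint (fun x => b x * f x).
Proof.
move=> mb bM f2; apply: le_sqint (sqintZ M f2).
  exact: (measurable_funM mb f2.1).
move=> x; rewrite !normrM ler_wpM2r//.
by rewrite (le_trans (bM x))// ler_norm.
Qed.

Lemma ipC f g : ip f g = ip g f.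
Proof. by apply: eq_Rintegral => x _; rewrite mulrC. Qed.

Lemma ipDl f g h : sqint f -> sqint g -> sqint h ->
  ip (fun x => f x + g x) h = ip f h + ip g h.
Proof.
move=> f2 g2 h2; rewrite /ip -RintegralD//; try exact: sqint_mul.
by apply: eq_Rintegral => x _; rewrite mulrDl.
Qed.

Lemma ipZl (a : R) f h : sqint f -> sqint h -> ip (fun x => a * f x) h = a * ip f h.
Proof.
move=> f2 h2; rewrite /ip -RintegralZl//; last exact: sqint_mul.
by apply: eq_Rintegral => x _; rewrite mulrA.
Qed.

Lemma ipNl f h : sqint f -> sqint h -> ip (fun x => - f x) h = - ip f h.
Proof.
by move=> f2 h2; rewrite -mulN1r -ipZl//; congr ip; apply/funext => x; rewrite mulN1r.
Qed.

Lemma ipBl f g h : sqint f -> sqint g -> sqint h ->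
  ip (fun x => f x - g x) h = ip f h - ip g h.
Proof. by move=> f2 g2 h2; rewrite ipDl ?ipNl//; exact: sqintN. Qed.

Lemma ipDr f g h : sqint f -> sqint g -> sqint h ->
  ip h (fun x => f x + g x) = ip h f + ip h g.
Proof. by move=> *; rewrite ipC ipDl// ipC (ipC g). Qed.

Lemma ipZr (a : R) f h : sqint f -> sqint h -> ip h (fun x => a * f x) = a * ip h f.
Proof. by move=> *; rewrite ipC ipZl// ipC. Qed.

Lemma ipBr f g h : sqint f -> sqint g -> sqint h ->
  ip h (fun x => f x - g x) = ip h f - ip h g.
Proof. by move=> *; rewrite ipC ipBl// ipC (ipC g). Qed.

Lemma ip_ge0 f : 0 <= ip f f.
Proof. by apply: Rintegral_ge0 => x _; rewrite -expr2 sqr_ge0. Qed.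

Lemma nrm_ge0 f : 0 <= nrm f. Proof. exact: sqrtr_ge0. Qed.

Lemma nrm_sqr f : nrm f ^+ 2 = ip f f.
Proof. by rewrite sqr_sqrtr// ip_ge0. Qed.

Lemma le_ip f g : sqint g -> measurable_fun setT f -> (forall x, `|f x| <= `|g x|) ->
  ip f f <= ip g g.
Proof.
move=> g2 mf fg; apply: le_Rintegral => //; try exact: sqint_mul.
  by have f2 := le_sqint mf fg g2; exact: sqint_mul.
move=> x _; rewrite -!expr2 -(real_normK (num_real (f x))) -(real_normK (num_real (g x))).
by rewrite lerXn2r ?nnegrE.
Qed.

Lemma le_nrm f g : sqint g -> measurable_fun setT f -> (forall x, `|f x| <= `|g x|) ->
  nrm f <= nrm g.
Proof. by move=> g2 mf fg; rewrite ler_wsqrtr// le_ip. Qed.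

End square_integrable.

(* The right-hand side is minimal, equal to [a * c], at [t = c / a]. *)
Lemma homogeneous_bound (R : realType) (a b c : R) : 0 <= a -> 0 <= c ->
  (forall t : R, 0 < t -> b <= (t * a ^+ 2 + t^-1 * c ^+ 2) / 2) -> b <= a * c.
Proof.
move=> a0 c0 H.
(* The minimizer [c / a] is undefined for [a = 0] and not positive for [c = 0], so both numbers are
   first enlarged by [e]. *)
have key e : 0 < e -> b <= (a + e) * (c + e).
  move=> e0; have ae : 0 < a + e by rewrite ltr_wpDl.
  have ce : 0 < c + e by rewrite ltr_wpDl.
  have := H ((c + e) / (a + e)); rewrite divr_gt0// => /(_ isT)/le_trans; apply.
  rewrite invf_div ler_pdivrMr//.
  have : (c + e) / (a + e) * a ^+ 2 <= (c + e) * (a + e).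
    rewrite -mulrA ler_wpM2l ?(ltW ce)// mulrC ler_pdivrMr// -expr2 lerXn2r// ?nnegrE; lra.
  have : (a + e) / (c + e) * c ^+ 2 <= (c + e) * (a + e).
    rewrite (mulrC (c + e)) -mulrA ler_wpM2l ?(ltW ae)// mulrC ler_pdivrMr// -expr2 lerXn2r// ?nnegrE; lra.
  lra.
rewrite leNgt; apply/negP => /[dup] acb; rewrite -subr_gt0 => d0.
(* With [e <= 1], $(a + e)(c + e) \le ac + e(a + c + 1)$, and this [e] makes the excess at most half
   of [b - a * c]. *)
pose e := Num.min 1 ((b - a * c) / (2 * (a + c + 1))).
have s0 : 0 < a + c + 1 by rewrite ltr_wpDl// addr_ge0.
have e0 : 0 < e by rewrite lt_min ltr01 divr_gt0// mulr_gt0.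
have e1 : e <= 1 by rewrite ge_min lexx.
have e2 : e * (2 * (a + c + 1)) <= b - a * c.
  by rewrite -ler_pdivlMr ?mulr_gt0// ge_min lexx orbT.
have := key e e0; nra.
Qed.

Section cauchy_schwarz.
Context d (T : measurableType d) (R : realType) (mu : {measure set T -> \bar R}).
Implicit Types f g h : T -> R.
Local Notation sqint := (sqint mu).
Local Notation ip := (ip mu).
Local Notation nrm := (nrm mu).

(** Expand the nonnegative square of $\sqrt t f - g / \sqrt t$. *)
Lemma ip_amgm f g t : sqint f -> sqint g -> 0 < t ->
  ip f g <= (t * nrm f ^+ 2 + t^-1 * nrm g ^+ 2) / 2.
Proof.
move=> f2 g2 t0; rewrite !nrm_sqr.
have s0 : Num.sqrt t != 0 by rewrite gt_eqF ?sqrtr_gt0.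
pose s := Num.sqrt t.
have s2 : s ^+ 2 = t by rewrite sqr_sqrtr// ltW.
pose h x := s * f x - s^-1 * g x.
have sf2 := sqintZ s f2; have sg2 := sqintZ s^-1 g2.
have := ip_ge0 mu h; rewrite /h ipBl ?ipBr//; last exact: sqintB.
rewrite !ipZl// !ipZr// (ipC mu g f) !mulrA -expr2.
rewrite mulfV// mulVf// -expr2 exprVn s2 !mul1r; lra.
Qed.

Lemma ip_le f g : sqint f -> sqint g -> ip f g <= nrm f * nrm g.
Proof.
by move=> f2 g2; apply: homogeneous_bound; rewrite ?nrm_ge0// => t; exact: ip_amgm.
Qed.

Lemma nrmN f : nrm (fun x => - f x) = nrm f.
Proof.
by rewrite /nrm /ip; congr Num.sqrt; apply: eq_Rintegral => x _; rewrite mulrNN.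
Qed.

Lemma cauchy_schwarz f g : sqint f -> sqint g -> `|ip f g| <= nrm f * nrm g.
Proof.
move=> f2 g2; rewrite ler_norml ip_le// andbT lerNl -ipNl// -(nrmN f).
by rewrite ip_le//; exact: sqintN.
Qed.

Lemma nrmZ a f : sqint f -> nrm (fun x => a * f x) = `|a| * nrm f.
Proof.
move=> f2; rewrite /nrm ipZl// ?ipZr//; last exact: sqintZ.
by rewrite mulrA -expr2 sqrtrM ?sqr_ge0// sqrtr_sqr.
Qed.

Lemma nrmD f g : sqint f -> sqint g -> nrm (fun x => f x + g x) <= nrm f + nrm g.
Proof.
move=> f2 g2; rewrite -ler_sqr ?nnegrE ?addr_ge0 ?nrm_ge0// nrm_sqr.
have fg2 := sqintD f2 g2.
rewrite ipDl// !ipDr// (ipC mu g f) sqrrD !nrm_sqr.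
have := ip_le f2 g2; lra.
Qed.

Lemma nrmB f g : sqint f -> sqint g -> nrm (fun x => f x - g x) <= nrm f + nrm g.
Proof. by move=> f2 g2; rewrite -(nrmN g); apply: nrmD => //; exact: sqintN. Qed.

(** Functions are representatives, and equality of classes is expressed by distance zero. By
    Cauchy-Schwarz a scalar product depends only on the class. *)
Lemma eq_ip f f' g : sqint f -> sqint f' -> sqint g -> nrm (fun x => f x - f' x) = 0 ->
  ip f g = ip f' g.
Proof.
move=> f2 f2' g2 ff'; apply/eqP; rewrite -subr_eq0 -ipBl// -normr_le0.
by rewrite (le_trans (cauchy_schwarz _ _))//; [exact: sqintB|rewrite ff' mul0r].
Qed.

Lemma ae_nrmB f f' : sqint f -> sqint f' -> {ae mu, forall x, f x = f' x} ->
  nrm (fun x => f x - f' x) = 0.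
Proof.
move=> f2 f2' ff'; rewrite /nrm /ip /Rintegral (_ : integral _ _ _ = 0%E) ?sqrtr0//.
have h2 := sqintB f2 f2'.
rewrite (_ : 0%E = \int[mu]_x (cst (0 : \bar R)%E x))%E; last by rewrite integral0.
apply: ae_eq_integral => //.
  by apply/measurable_EFinP; apply: measurable_funM; exact: h2.1.
by apply: filterS ff' => x -> _; rewrite subrr mul0r.
Qed.

(** Dominated convergence for the squared differences, with majorant $g^2$. *)
Lemma nrm_cvg0 (f : nat -> T -> R) (f0 g : T -> R) :
  (forall k, sqint (f k)) -> sqint f0 -> sqint g ->
  (forall k x, `|f k x - f0 x| <= `|g x|) ->
  (forall x, f k x @[k --> \oo] --> f0 x) ->
  nrm (fun x => f k x - f0 x) @[k --> \oo] --> (0 : R).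
Proof.
move=> f2 f02 g2 fg ff0.
have sub2 k := sqintB (f2 k) f02.
have : (\int[mu]_x ((f k x - f0 x) ^+ 2)%:E)%E @[k --> \oo] --> (\int[mu]_x (cst (0 : \bar R) x))%E.
  apply: (@dominated_cvg _ _ _ mu setT measurableT _ _ (fun x => (g x ^+ 2)%:E)) => //.
  - by move=> k; apply/measurable_EFinP; apply: measurable_funX; exact: (sub2 k).1.
  - move=> x _ /=; apply: cvg_EFin; first exact: nearW.
    rewrite /=.
    rewrite (_ : 0 = (f0 x - f0 x) ^+ 2) ?subrr ?expr0n//.
    have h : (fun k => f k x - f0 x) @ \oo --> (0 : R).
      by rewrite -(subrr (f0 x)); apply: cvgB => //; exact: cvg_cst.
    have := cvgM h h; rewrite mulr0; exact.
  - exact: g2.2.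
  - move=> k x _ /=; rewrite lee_fin ger0_norm ?sqr_ge0//.
    by rewrite -(real_normK (num_real (_ - _))) -(real_normK (num_real (g x))) lerXn2r ?nnegrE.
rewrite integral0 => h.
have h2 : (fun k => ip (fun x => f k x - f0 x) (fun x => f k x - f0 x)) @ \oo --> (0 : R).
  exact: fine_cvg h.
have := cvg_comp _ _ h2 (@sqrt_continuous R 0).
by rewrite sqrtr0.
Qed.

End cauchy_schwarz.

(** * Lebesgue measure on row vectors *)

Section rV_measurable.
Context (R : realType) (n : nat).
Local Notation E := 'rV[R]_n.

Lemma measurable_rV_box (x : E) (e : R) :
  measurable [set y : E | forall i, `|x ord0 i - y ord0 i| < e].
Proof.
rewrite (_ : [set _ | _] = \big[setI/setT]_(i < n) [set y : E | `|x ord0 i - y ord0 i| < e]).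
  apply: bigsetI_measurable => i _.
  rewrite (_ : [set _ | _] = (fun y : E => y ord0 i) @^-1` (ball (x ord0 i) e)); last by [].
  rewrite -[X in measurable X]setTI; apply: measurable_coord_rV => //.
  exact: measurable_ball.
apply/seteqP; split=> y /=.
  by move=> xy; rewrite -bigcap_seq => i _ /=.
by rewrite -bigcap_seq => xy i; apply: xy; rewrite /= mem_index_enum.
Qed.

Lemma ball_rVE (x : E) (e : R) y :
  0 < e -> ball x e y <-> forall i, `|x ord0 i - y ord0 i| < e.
Proof.
move=> e0; split=> [[_ xy] i|xy]; first exact: xy.
by split => // i j; rewrite (ord1 i); exact: xy.
Qed.

(** The sigma-algebra of row vectors is generated by the coordinates, so an open set has to be
    written as a countable union of boxes: those with rational centre and radius $1/(k+1)$ that lie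
    inside it. *)
Lemma open_rV_measurable (A : set E) : open A -> measurable A.
Proof.
move=> oA.
pose q2r (q : 'rV[rat]_n) : E := map_mx ratr q.
pose B (p : 'rV[rat]_n * nat) := [set y : E | forall i, `|q2r p.1 ord0 i - y ord0 i| < p.2.+1%:R^-1].
pose C k := if unpickle k is Some p then if `[< B p `<=` A >] then B p else set0 else set0.
rewrite (_ : A = \bigcup_k C k).
  apply: bigcupT_measurable => k; rewrite /C; case: unpickle => // p.
  by case: ifP => // _; exact: measurable_rV_box.
apply/seteqP; split => x; last first.
  move=> [k _]; rewrite /C; case: unpickle => // p.
  by case: ifPn => // /asboolP; exact.
move=> Ax; have /nbhs_ballP[e /= e0 eA] := open_nbhs_nbhs (conj oA Ax).
(* Half the radius of the ball: a box of this size that contains [x] stays within distance [e] of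
   [x]. *)
have [k ke] : exists k : nat, k.+1%:R^-1 < e / 2.
  exists (Num.truncn (2 / e)); rewrite -[e / 2]invrK ltf_pV2 ?posrE ?invr_gt0 ?divr_gt0//.
  by rewrite invf_div truncnS_gt.
have /choice[q qx] : forall i, exists q : rat, `|ratr q - x ord0 i| < k.+1%:R^-1 :> R.
  move=> i; have : x ord0 i < x ord0 i + k.+1%:R^-1 by rewrite ltrDl invr_gt0 ltr0n.
  move=> /rat_in_itvoo[q]; rewrite in_itv/= => /andP[h1 h2]; exists q.
  by rewrite ger0_norm ?subr_ge0 1?ltW// ltrBlDl.
exists (pickle (\row_i q i, k)) => //; rewrite /C pickleK ifT; last first.
  apply/asboolP => y /= By; apply: eA; apply/ball_rVE => // i.
  have := By i; have := qx i; rewrite !mxE/= => h1 h2.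
  rewrite (_ : _ - _ = (ratr (q i) - y ord0 i) - (ratr (q i) - x ord0 i)); last ring.
  by rewrite (le_lt_trans (ler_normB _ _))// (splitr e) ltrD// ?(lt_trans h1) ?(lt_trans h2).
by move=> i /=; rewrite !mxE.
Qed.

Lemma continuous_rV_measurable (f : E -> R) : continuous f -> measurable_fun setT f.
Proof.
move=> cf; apply: (measurability _ (RGenOInfty.measurableE R)) => _ [_ [a ->] <-].
rewrite setTI; apply: open_rV_measurable; apply: open_comp => //.
Qed.

End rV_measurable.

Section product_integral.
Context (R : realType).
Local Notation leb := (@lebesgue_measure R).

(** Tonelli and induction on the dimension, along the recursive definition of [lebesgue_rV]. This
    takes the place of translation and reflection invariance of the measure, since the kernels
    integrated later are products. *)
Lemma integral_prod_rV n (g : 'I_n -> R -> R) (c : 'I_n -> R) :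
  (forall i, measurable_fun setT (g i)) -> (forall i t, 0 <= g i t) ->
  (forall i, \int[leb]_t (g i t)%:E = (c i)%:E)%E ->
  (\int[lebesgue_rV n]_x (\prod_(i < n) g i (x ord0 i))%:E = (\prod_(i < n) c i)%:E)%E.
Proof.
elim: n g c => [|n IH] g c mg g0 gc.
  (* In dimension zero the measure is a Dirac mass, which gives the empty product the integral
     one. *)
  rewrite (eq_integral (cst 1%E)) => [|x _]; last by rewrite big_ord0.
  by rewrite big_ord0 integral_cst//= diracT mul1e.
have mprod m (h : 'I_m -> R -> R) : (forall i, measurable_fun setT (h i)) ->
    measurable_fun [set: 'rV[R]_m] (fun x => \prod_(i < m) h i (x ord0 i)).
  move=> mh; apply: measurable_prod => i _.
  by apply: (measurableT_comp (mh i)); exact: measurable_coord_rV.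
rewrite /= ge0_integral_pushforward//=; last 2 first.
- by apply/measurable_EFinP; exact: mprod.
- by move=> x _; rewrite lee_fin prodr_ge0.
rewrite preimage_setT.
pose F (p : measurableTypeR R * 'rV[R]_n) : R := (g ord0 p.1 * \prod_(i < n) g (lift ord0 i) (p.2 ord0 i)).
transitivity (\int[(leb \x lebesgue_rV n)%E]_p (F p)%:E)%E.
  apply: eq_integral => -[t y] _ /=; rewrite big_ord_recl /F/=; congr (_ * _)%:E.
    by congr (g _ _); have := congr1 fst (@cons_rVK R n (t, y)).
  apply: eq_bigr => i _; congr (g _ _).
  have /(congr1 snd)/= := @cons_rVK R n (t, y).
  move=> /(congr1 (fun z : 'rV[R]_n => z ord0 i)) <-; rewrite !mxE.
  by rewrite (_ : lift ord0 i = rshift 1 i)//; exact/val_inj.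
have mF : measurable_fun setT F.
  rewrite /F; apply: measurable_funM; first by apply: measurableT_comp => //; exact: mg.
  apply: (measurableT_comp (mprod _ (fun i => g (lift ord0 i)) _)) => //.
rewrite fubini_tonelli1//=; last 2 first.
- exact/measurable_EFinP.
- by move=> [t y]; rewrite lee_fin mulr_ge0// prodr_ge0.
rewrite big_ord_recl.
transitivity (\int[leb]_t ((g ord0 t)%:E * (\prod_(i < n) c (lift ord0 i))%:E))%E; last first.
  rewrite ge0_integralZr ?gc -?EFinM//.
  - by apply/measurable_EFinP; exact: mg.
  - by move=> t _; rewrite lee_fin.
  - rewrite lee_fin prodr_ge0// => i _; rewrite -lee_fin -gc integral_ge0// => t _.
    by rewrite lee_fin.
apply: eq_integral => t _; rewrite /fubini_F/= /F/=.
under eq_integral do rewrite EFinM.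
rewrite ge0_integralZl//; last 3 first.
- by apply/measurable_EFinP; exact: (mprod n (fun i => g (lift ord0 i)) (fun i => mg _)).
- by move=> y _; rewrite lee_fin prodr_ge0.
- by rewrite lee_fin.
congr (_ * _)%E.
by apply: (IH (fun i => g (lift ord0 i)) (fun i => c (lift ord0 i))) => i *; [exact: mg|exact: g0|exact: gc].
Qed.

Lemma integral_indic_shift (a b y : R) : a <= b ->
  (\int[leb]_t (\1_(`[a, b]%classic) (t - y))%:E = (b - a)%:E)%E.
Proof.
move=> ab; rewrite (_ : (fun t => _) = EFin \o \1_(`[a + y, b + y]%classic)).
  rewrite integral_indic//= setIT.
  rewrite lebesgue_measure_itv/= lte_fin ltrD2r.
  case: ltP => [_|ba]; first by rewrite -EFinB; congr EFin; ring.
  by rewrite (@le_anti _ _ a b) ?ab// subrr.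
apply/funext => t /=; rewrite !indicE; congr ((_ : bool)%:R%:E).
by apply/idP/idP; rewrite !inE/= !in_itv/= lerBrDr lerBlDr.
Qed.

Lemma integral_indic_shiftN (a b y : R) : a <= b ->
  (\int[leb]_t (\1_(`[a, b]%classic) (y - t))%:E = (b - a)%:E)%E.
Proof.
move=> ab; rewrite -(_ : - a - - b = b - a); last ring.
rewrite -(@integral_indic_shift _ _ y) ?lerN2//; apply: eq_integral => t _.
rewrite !indicE; congr ((_ : bool)%:R%:E).
by apply/idP/idP; rewrite !inE/= !in_itv/=; lra.
Qed.

End product_integral.

(** * Smooth functions *)

Section Ck_theory.
Context (R : realType) (E : normedModType R).
Implicit Types (f g : E -> R) (k : nat).

Lemma Ck_continuous k f : Ck k f -> continuous f.
Proof. by case: k => [|k] []. Qed.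

Lemma Ck_derivable k f x v : Ck k.+1 f -> derivable f x v.
Proof. by move=> [_ /(_ v)[]]. Qed.

Lemma Ck_derive k f v : Ck k.+1 f -> Ck k (fun x => 'D_v f x).
Proof. by move=> [_ /(_ v)[]]. Qed.

Lemma CkS k f : Ck k.+1 f -> Ck k f.
Proof.
elim: k f => [|k IH] f [cf df]; first by split.
split=> // v; have [dfv Cfv] := df v; split => //.
exact: IH.
Qed.

Lemma Ck_eq k f g : f =1 g -> Ck k f -> Ck k g.
Proof. by move=> /funext ->. Qed.

Lemma Ck_cst k (c : R) : Ck k (fun _ : E => c).
Proof.
elim: k c => [|k IH] c; split=> //; try exact: cst_continuous.
move=> v; split; first by move=> x; exact: derivable_cst.
by apply: Ck_eq (IH 0) => x; rewrite derive_cst.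
Qed.

Lemma CkD k f g : Ck k f -> Ck k g -> Ck k (fun x => f x + g x).
Proof.
elim: k f g => [|k IH] f g Cf Cg.
  by split=> // x; apply: cvgD; [exact: (Ck_continuous Cf)|exact: (Ck_continuous Cg)].
split; first by move=> x; apply: cvgD; [exact: (Ck_continuous Cf)|exact: (Ck_continuous Cg)].
move=> v; split; first by move=> x; exact: (derivableD (Ck_derivable Cf) (Ck_derivable Cg)).
apply: (@Ck_eq k (fun x => 'D_v f x + 'D_v g x)).
  by move=> x; exact/esym/(deriveD (Ck_derivable Cf) (Ck_derivable Cg)).
by apply: IH; exact: Ck_derive.
Qed.

Lemma CkM k f g : Ck k f -> Ck k g -> Ck k (fun x => f x * g x).
Proof.
elim: k f g => [|k IH] f g Cf Cg.
  by split=> // x; apply: cvgM; [exact: (Ck_continuous Cf)|exact: (Ck_continuous Cg)].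
split; first by move=> x; apply: cvgM; [exact: (Ck_continuous Cf)|exact: (Ck_continuous Cg)].
move=> v; split; first by move=> x; exact: (derivableM (Ck_derivable Cf) (Ck_derivable Cg)).
apply: (@Ck_eq k (fun x => f x * 'D_v g x + g x * 'D_v f x)).
  by move=> x; exact/esym/(deriveM (Ck_derivable Cf) (Ck_derivable Cg)).
by apply: CkD; apply: IH; solve [exact: CkS|exact: Ck_derive].
Qed.

Lemma CkN k f : Ck k f -> Ck k (fun x => - f x).
Proof.
by move=> Cf; apply: Ck_eq (CkM (Ck_cst k (-1)) Cf) => x; rewrite mulN1r.
Qed.

Lemma CkV k f : (forall x, f x != 0) -> Ck k f -> Ck k (fun x => (f x)^-1).
Proof.
move=> f0; elim: k f f0 => [|k IH] f f0 Cf.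
  by split=> // x; apply: cvgV => //; exact: (Ck_continuous Cf).
split; first by move=> x; apply: cvgV => //; exact: (Ck_continuous Cf).
move=> v; split; first by move=> x; apply: derivableV => //; exact: (Ck_derivable Cf).
apply: (@Ck_eq k (fun x => - ((f x)^-1 * (f x)^-1 * 'D_v f x))).
  move=> x; rewrite deriveV//; last exact: (Ck_derivable Cf).
  by rewrite -exprVn expr2 -mulNr.
apply: CkN; apply: CkM; last exact: Ck_derive.
by apply: CkM; apply: IH => //; exact: CkS.
Qed.

Lemma Ck_prod k (I : Type) (s : seq I) (f : I -> E -> R) :
  (forall i, Ck k (f i)) -> Ck k (fun x => \prod_(i <- s) f i x).
Proof.
move=> Cf; elim: s => [|i s IH].
  by apply: Ck_eq (Ck_cst k 1) => x; rewrite big_nil.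
by apply: Ck_eq (CkM (Cf i) IH) => x; rewrite big_cons.
Qed.

End Ck_theory.

Section affine.
Context (R : realType) (E F : normedModType R) (L l : E -> F).
Hypothesis cL : continuous L.
Hypothesis affL : forall x v (h : R), L (h *: v + x) = h *: l v + L x.

Lemma derive_affine (f : F -> R) x v :
  (derivable f (L x) (l v) -> derivable (fun y => f (L y)) x v) /\
  'D_v (fun y => f (L y)) x = 'D_(l v) f (L x).
Proof.
rewrite /derivable /derive.
have -> : (fun h : R => h^-1 *: (((fun y => f (L y)) \o shift x) (h *: v) - f (L x)))
   = (fun h => h^-1 *: ((f \o shift (L x)) (h *: l v) - f (L x))).
  by apply/funext => h /=; rewrite affL.
by [].
Qed.

Lemma Ck_affine k (f : F -> R) : Ck k f -> Ck k (fun x => f (L x)).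
Proof.
elim: k f => [|k IH] f Cf.
  by split=> // x; apply: (continuous_comp (@cL x)); exact: (Ck_continuous Cf).
split; first by move=> x; apply: (continuous_comp (@cL x)); exact: (Ck_continuous Cf).
move=> v; split.
  by move=> x; apply: (derive_affine _ _ _).1; exact: (Ck_derivable Cf).
apply: (@Ck_eq _ _ k (fun x => 'D_(l v) f (L x))).
  by move=> x; rewrite (derive_affine _ _ _).2.
exact: (IH (fun y => 'D_(l v) f y) (Ck_derive _ Cf)).
Qed.

End affine.

(** * A smooth step function and its derivative, the bump *)

Section bump.
Context (R : realType).
Implicit Types (t : R) (m : nat).

(* The derivative of [flat m] is a combination of [flat m.+1] and [flat m.+2], so the
   family with all [m] is closed under differentiation, including at [0]. *)
Definition flat m t : R := if 0 < t then t^-1 ^+ m * expR (- t^-1) else 0.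

Lemma flat_ge0 m t : 0 <= flat m t.
Proof.
by rewrite /flat; case: ifPn => // t0; rewrite mulr_ge0 ?expR_ge0// exprn_ge0// invr_ge0 ltW.
Qed.

Lemma flat_gt0 m t : 0 < t -> 0 < flat m t.
Proof. by move=> t0; rewrite /flat t0 mulr_gt0 ?expR_gt0// exprn_gt0// invr_gt0. Qed.

Lemma flat_le0 m t : t <= 0 -> flat m t = 0.
Proof. by move=> t0; rewrite /flat ltNge t0. Qed.

(** The exponential series at $1/t$ gives $t^{-(m+1)} \le (m+1)!\, e^{1/t}$. The factor [|t|] that
    is left over yields continuity at zero. *)
Lemma flat_bound m t : `|flat m t| <= (m.+1`!)%:R * `|t|.
Proof.
rewrite ger0_norm ?flat_ge0// /flat; case: ifPn => [t0|_]; last by rewrite mulr_ge0.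
rewrite (gtr0_norm t0) expRN ler_pdivrMr ?expR_gt0//.
have ti0 : 0 <= t^-1 by rewrite invr_ge0 ltW.
have := expR_ge1Dxn m ti0.
have f0 : 0 < (m.+1)`!%:R :> R by rewrite ltr0n fact_gt0.
move=> h; rewrite -mulrA.
have h2 : t^-1 ^+ m.+1 <= (m.+1)`!%:R * expR t^-1.
  rewrite mulrC -ler_pdivrMr//; apply: le_trans h; rewrite lerDr//.
rewrite exprS in h2.
have := ler_wpM2l (ltW t0) h2; rewrite mulVKf ?gt_eqF// => /le_trans; apply.
by rewrite mulrCA.
Qed.

Lemma flat_cvg0 m : flat m t @[t --> (0 : R)] --> (0 : R).
Proof.
apply/cvgrPdist_le => e e0; near=> t.
rewrite sub0r normrN (le_trans (flat_bound m t))//.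
have f0 : 0 < (m.+1)`!%:R :> R by rewrite ltr0n fact_gt0.
rewrite mulrC -ler_pdivlMr//; near: t.
apply/nbhs_ballP; exists (e / (m.+1)`!%:R) => /=; first by rewrite divr_gt0.
by move=> t; rewrite /ball/= sub0r normrN => /ltW.
Unshelve. all: by end_near. Qed.

Definition dflat m t : R := flat m.+2 t - m%:R * flat m.+1 t.

Lemma flatS m t : t^-1 * flat m t = flat m.+1 t.
Proof. by rewrite /flat; case: ifP => _; rewrite ?mulr0// exprS mulrA. Qed.

Lemma is_derive_flat m t : is_derive t 1 (flat m) (dflat m t).
Proof.
have [t0|t0|->] := ltgtP t 0.
- have -> : dflat m t = 0 by rewrite /dflat !flat_le0 ?(ltW t0)// mulr0 subrr.
  apply: (@near_eq_is_derive _ _ _ (cst 0)).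
  near=> s; rewrite flat_le0//; apply: ltW; near: s.
  exact: lt_nbhsl.
- apply: (@near_eq_is_derive _ _ _ (fun s : R => s^-1 ^+ m * expR (- s^-1) : R)).
    near=> s; rewrite /flat ifT//; near: s.
    exact: lt_nbhsr.
  have tn0 : t != 0 by rewrite gt_eqF.
  have dV : is_derive t 1 (fun s : R => s^-1) (- t^-1 ^+ 2).
    apply: DeriveDef; first by apply: derivableV => //; exact: derivable_id.
    by rewrite deriveV// ?derive_id//; rewrite ?exprVn ?scaler1 //; exact: derivable_id.
  have dE : is_derive t 1 (fun s : R => expR (- s^-1)) (expR (- t^-1) * t^-1 ^+ 2).
    have := @is_derive1_comp _ expR (fun s => - s^-1) _ _ _ (is_derive_expR (- t^-1)) (is_deriveN dV).
    by rewrite opprK; exact.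
  have dX := is_deriveX m dV; rewrite exprfctE in dX.
  apply: is_derive_eq (is_deriveM dX dE) _.
  rewrite /dflat /flat t0 /GRing.scale/=.
  clear dX; case: m => [|m]; first by rewrite !mul0r expr0 mulr0 !mul1r; ring.
  by rewrite /= !exprS; ring.
(* At zero the difference quotient of [flat m] is exactly [flat m.+1], on both sides. *)
- have E : (fun h : R => h^-1 *: ((flat m \o shift 0) (h *: 1) - flat m 0)) = flat m.+1.
    apply/funext => h /=; rewrite (flat_le0 m (lexx 0)) subr0 addr0 -flatS.
    by rewrite /GRing.scale/= mulr1.
  have cv : flat m.+1 h @[h --> 0^'] --> (0 : R).
    by apply: cvg_trans (flat_cvg0 m.+1); apply: cvg_app; exact: cvg_within.
  rewrite /dflat !flat_le0// mulr0 subrr; apply: DeriveDef.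
    by rewrite /derivable E; apply/cvg_ex; exists 0.
  by rewrite /derive E; exact: (cvg_lim _ cv).
Unshelve. all: by end_near. Qed.

Lemma derive_dir (f : R -> R) t v d : is_derive t 1 f d ->
  derivable f t v /\ 'D_v f t = v * d.
Proof.
move=> [df <-]; have /derivable1_diffP dif := df; split; first exact: diff_derivable.
by rewrite !deriveE// -[in LHS](mulr1 v) -[v * 1]/(v *: 1) linearZ.
Qed.

Lemma Ck_flat k m : Ck k (flat m).
Proof.
(* The scalar [c] is carried along because differentiation in the direction [v] multiplies by [v]
   and by [m]. *)
suff H : forall k m (c : R), Ck k (fun t => c * flat m t).
  by apply: Ck_eq (H k m 1) => t; rewrite mul1r.
have der c j t : is_derive t 1 (fun t => c * flat j t) (c * dflat j t).
  exact: (is_deriveZ c (is_derive_flat j t)).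
have cont c j : continuous (fun t => c * flat j t).
  by move=> t; apply/differentiable_continuous/derivable1_diffP; have [] := der c j t.
elim=> [|k' IH] j c; first by split.
split=> // v; split; first by move=> t; exact: (derive_dir v (der c j t)).1.
apply: (@Ck_eq _ _ k' (fun t => (v * c) * flat j.+2 t + (- v * c * j%:R) * flat j.+1 t)).
  by move=> t; rewrite (derive_dir v (der c j t)).2 /dflat; ring.
by apply: CkD.
Qed.

Definition flat_sum t := flat 0 t + flat 0 (1 - t).

Lemma flat_sum_gt0 t : 0 < flat_sum t.
Proof.
have [t0|t0] := ltP 0 t; first by rewrite ltr_pwDl ?flat_ge0// flat_gt0.
by rewrite ltr_wpDl ?flat_ge0// flat_gt0// subr_gt0 (le_lt_trans t0).
Qed.

(** The usual smooth transition, equal to 0 for $t \le 0$ and to 1 for $t \ge 1$. *)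
Definition step t := flat 0 t / flat_sum t.

(** The derivative of [step], written out. Its integral is the total rise of [step], which is one,
    so no normalizing constant is needed. *)
Definition bump t :=
  (flat 2 t * flat 0 (1 - t) + flat 0 t * flat 2 (1 - t)) * (flat_sum t)^-1 * (flat_sum t)^-1.

Lemma is_derive_step t : is_derive t 1 step (bump t).
Proof.
have d0 (s : R) : is_derive s 1 (flat 0) (flat 2 s).
  by apply: is_derive_eq (is_derive_flat 0 s) _; rewrite /dflat mul0r subr0.
have d1 : is_derive t 1 (fun s => flat 0 (1 - s)) (- flat 2 (1 - t)).
  have dm : is_derive t 1 (fun s : R => 1 - s) (-1).
    by apply: is_derive_eq (is_deriveB (is_derive_cst (1 : R) t 1) (is_derive_id t 1)) _; rewrite sub0r.
  by have := @is_derive1_comp _ (flat 0) (fun s => 1 - s) _ _ _ (d0 (1 - t)) dm; rewrite mulrN1.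
have dS := is_deriveD (d0 t) d1.
have S0 := lt0r_neq0 (flat_sum_gt0 t).
have dV : is_derive t 1 (fun s => (flat_sum s)^-1)
    (- (flat_sum t) ^- 2 *: (flat 2 t - flat 2 (1 - t))).
  have [dS1 dS2] := dS.
  apply: DeriveDef; first exact: (@derivableV _ _ flat_sum).
  by rewrite (@deriveV _ _ flat_sum)//; congr (_ *: _).
apply: is_derive_eq (is_deriveM (d0 t) dV) _.
move: S0; rewrite /bump /GRing.scale/= /flat_sum => S0; field.
exact: S0.
Qed.

Lemma Ck_onem k f : Ck k f -> Ck k (fun t : R => f (1 - t) : R).
Proof.
apply: (@Ck_affine _ _ _ (fun t : R => 1 - t) -%R).
  by move=> t; apply: cvgB; [exact: cvg_cst|exact: cvg_id].
by move=> t v h; rewrite /GRing.scale/=; ring.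
Qed.

Lemma Ck_flat_sumV k : Ck k (fun t => (flat_sum t)^-1).
Proof.
apply: CkV; first by move=> t; rewrite lt0r_neq0// flat_sum_gt0.
by apply: CkD; [exact: Ck_flat|apply: Ck_onem; exact: Ck_flat].
Qed.

Lemma Ck_step k : Ck k step.
Proof. by apply: CkM; [exact: Ck_flat|exact: Ck_flat_sumV]. Qed.

Lemma Ck_bump k : Ck k bump.
Proof.
apply: CkM; last exact: Ck_flat_sumV.
apply: CkM; last exact: Ck_flat_sumV.
by apply: CkD; apply: CkM; solve [exact: Ck_flat|apply: Ck_onem; exact: Ck_flat].
Qed.

Lemma bump_ge0 t : 0 <= bump t.
Proof.
have := flat_sum_gt0 t; rewrite -invr_gt0 => /ltW S0.
by rewrite /bump !mulr_ge0// addr_ge0// mulr_ge0// flat_ge0.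
Qed.

Lemma bump_out t : t <= 0 \/ 1 <= t -> bump t = 0.
Proof.
by case=> h; rewrite /bump; [rewrite !(flat_le0 _ h)|rewrite !(@flat_le0 _ (1 - t)) ?subr_le0//];
  rewrite ?mul0r ?mulr0 ?addr0 ?mul0r.
Qed.

Lemma step_le0 t : t <= 0 -> step t = 0.
Proof. by move=> t0; rewrite /step flat_le0// mul0r. Qed.

Lemma step_ge1 t : 1 <= t -> step t = 1.
Proof.
move=> t1; rewrite /step /flat_sum (@flat_le0 _ (1 - t)) ?subr_le0// addr0 mulfV//.
by rewrite lt0r_neq0// flat_gt0// (lt_le_trans ltr01).
Qed.

Lemma step_ge0 t : 0 <= step t.
Proof. by rewrite /step mulr_ge0 ?flat_ge0// invr_ge0 ltW// flat_sum_gt0. Qed.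

Lemma step_le1 t : step t <= 1.
Proof. by rewrite /step ler_pdivrMr ?flat_sum_gt0// mul1r lerDl flat_ge0. Qed.

End bump.

(** * Test functions and mollifiers *)

Section supports.
Context (R : realType) (E : normedModType R).
Implicit Types (f : E -> R) (Q : set E).

Lemma support_sub f Q : compact Q -> (forall x, f x != 0 -> Q x) -> support_of f `<=` Q.
Proof.
move=> cQ fQ; have clQ : closed Q by apply: compact_closed => //; exact: norm_hausdorff.
by rewrite /support_of closureE; apply: smallest_sub.
Qed.

Lemma test_functionP f Q (Omega : set E) : smooth f -> compact Q ->
  (forall x, f x != 0 -> Q x) -> Q `<=` Omega -> test_function Omega f.
Proof.
move=> sf cQ fQ QO; have sQ := support_sub cQ fQ; split => //.
  by apply: subclosed_compact sQ => //; exact: closed_closure.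
exact: subset_trans QO.
Qed.

Lemma smooth_derive f v : smooth f -> smooth (fun x => 'D_v f x).
Proof. by move=> sf k; exact: Ck_derive (sf k.+1). Qed.

Lemma smooth_derivable f x v : smooth f -> derivable f x v.
Proof. by move=> sf; exact: Ck_derivable (sf 1). Qed.

Lemma smooth_continuous f : smooth f -> continuous f.
Proof. by move=> sf; exact: Ck_continuous (sf 0). Qed.

(** Outside the closed set [Q] the function vanishes on a whole neighbourhood. *)
Lemma derive_support f Q v : compact Q -> (forall x, f x != 0 -> Q x) ->
  forall x, 'D_v f x != 0 -> Q x.
Proof.
move=> cQ fQ x; apply: contra_neqP => nQ.
have clQ : closed Q by apply: compact_closed => //; exact: norm_hausdorff.
rewrite (@near_eq_derive _ _ _ _ (cst 0)) ?derive_cst//.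
have : nbhs x (~` Q) by apply: open_nbhs_nbhs; split => //; exact: closed_openC.
by apply: filterS => y nQy; apply/eqP; apply: contrapT => /negP/fQ.
Qed.

Lemma bounded_support f Q : continuous f -> compact Q -> (forall x, f x != 0 -> Q x) ->
  exists2 M, 0 <= M & forall x, `|f x| <= M.
Proof.
move=> cf cQ fQ.
have := compact_bounded (continuous_compact (continuous_subspaceT cf) cQ).
move=> /(ex_strict_bound_gt0)[M M0 fM]; exists M; first exact: ltW.
move=> x; have [->|/fQ Qx] := eqVneq (f x) 0; first by rewrite normr0 ltW.
by apply/ltW/fM; exists x.
Qed.

(** Directional derivatives alone are not assumed linear in the direction. Restriction to the line
    through [x] along [v] reduces the claim to one variable. *)
Lemma deriveN_dir f x v : derivable f x v -> 'D_(- v) f x = - 'D_v f x.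
Proof.
move=> df; pose g (s : R) := f (s *: v + x).
have cL : continuous (fun s : R => s *: v + x).
  by move=> s; apply: cvgD; [exact: scalel_continuous|exact: cvg_cst].
have aL (s w h : R) : h *: w + s = h *: w + s -> (h *: w + s) *: v + x = h *: (w *: v) + (s *: v + x).
  by rewrite scalerDl scalerA addrA.
have H w := @derive_affine _ _ _ (fun s : R => s *: v + x) (fun w => w *: v) (fun s w h => aL s w h erefl) f 0 w.
rewrite scale0r add0r in H.
have dg : is_derive (0 : R) 1 g ('D_v f x).
  by apply: DeriveDef; [apply: (H 1).1; rewrite scale1r|rewrite (H 1).2 scale1r].
by rewrite -scaleN1r -(H (-1)).2 (derive_dir (-1) dg).2 mulN1r.
Qed.

End supports.

Section scaled_bump.
Context (R : realType) (K : R).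
Hypothesis K0 : 0 < K.
Local Notation leb := (@lebesgue_measure R).

Definition kstep t := step (K * t).
(** The factor [K] keeps the integral equal to one. The support lies in $[0, 1/K]$, to the right of
    the origin, so a bump moved to [b] only samples values to the right of [b]. *)
Definition kbump t := K * bump (K * t).

Lemma Ck_scale k (f : R -> R) : Ck k f -> Ck k (fun t : R => f (K * t) : R).
Proof.
apply: (@Ck_affine _ _ _ (fun t : R => K * t) ( *%R K)).
  by move=> t; apply: cvgM; [exact: cvg_cst|exact: cvg_id].
by move=> t v h; rewrite /GRing.scale/=; ring.
Qed.

Lemma Ck_shift (k : nat) y (f : R -> R) : Ck k f -> Ck k (fun t : R => f (t - y) : R).
Proof.
apply: (@Ck_affine _ _ _ (fun t : R => t - y) id).
  by move=> t; apply: cvgB; [exact: cvg_id|exact: cvg_cst].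
by move=> t v h; rewrite addrA.
Qed.

Lemma smooth_kstep : smooth kstep.
Proof. by move=> k; apply: Ck_scale; exact: Ck_step. Qed.

Lemma smooth_kbump : smooth kbump.
Proof. by move=> k; apply: CkM; [exact: Ck_cst|apply: Ck_scale; exact: Ck_bump]. Qed.

Lemma kbump_ge0 t : 0 <= kbump t.
Proof. by rewrite mulr_ge0 ?bump_ge0// ltW. Qed.

Lemma kbump_neq0 t : kbump t != 0 -> 0 < t < K^-1.
Proof.
rewrite /kbump => h; apply/andP; split; rewrite ltNge; apply: contra h => h.
  by rewrite bump_out ?mulr0//; left; rewrite pmulr_rle0.
by rewrite bump_out ?mulr0//; right; rewrite mulrC -ler_pdivrMr// div1r.
Qed.

Lemma is_derive_kstep (t y : R) : is_derive t 1 (fun t => kstep (t - y)) (kbump (t - y)).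
Proof.
have dm : is_derive t 1 (fun t : R => K * (t - y)) K.
  apply: is_derive_eq (is_deriveZ K (is_deriveB (is_derive_id t 1) (is_derive_cst y t 1))) _.
  by rewrite subr0 /GRing.scale/= mulr1.
have := @is_derive1_comp _ (@step R) (fun t => K * (t - y)) _ _ _ (is_derive_step _) dm.
by rewrite mulrC; exact.
Qed.

Lemma is_derive_kstepN (t y : R) : is_derive t 1 (fun t => - kstep (y - t)) (kbump (y - t)).
Proof.
have dm : is_derive t 1 (fun t : R => K * (y - t)) (- K).
  apply: is_derive_eq (is_deriveZ K (is_deriveB (is_derive_cst y t 1) (is_derive_id t 1))) _.
  by rewrite sub0r /GRing.scale/= mulrN1.
have := is_deriveN (@is_derive1_comp _ (@step R) (fun t => K * (y - t)) _ _ _ (is_derive_step _) dm).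
by rewrite mulrN opprK mulrC; exact.
Qed.

Lemma kstep_le0 t : t <= 0 -> kstep t = 0.
Proof. by move=> t0; rewrite /kstep step_le0// pmulr_rle0. Qed.

Lemma kstep_ge1 t : K^-1 <= t -> kstep t = 1.
Proof. by move=> t0; rewrite /kstep step_ge1// mulrC -ler_pdivrMr// div1r. Qed.

Lemma FTC_everywhere (F f : R -> R) a b : a < b -> continuous f ->
  (forall t : R, is_derive t 1 F (f t)) ->
  (\int[leb]_(t in `[a, b]) (f t)%:E = (F b - F a)%:E)%E.
Proof.
move=> ab cf dF; rewrite EFinB; apply: continuous_FTC2 => //.
- exact: continuous_subspaceT.
- have cF (t : R) : F @ t --> F t.
    by apply/differentiable_continuous/derivable1_diffP; have [] := dF t.
  split; first by move=> t _; have [] := dF t.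
    by apply: cvg_at_right_filter; exact: cF.
  by apply: cvg_at_left_filter; exact: cF.
- by move=> t _; rewrite derive1E; have [] := dF t.
Qed.

Lemma integral_mkcond_bump (f F : R -> R) (a b : R) : a < b -> continuous f ->
  (forall t : R, is_derive t 1 F (f t)) -> (forall t, f t != 0 -> a < t < b) ->
  (\int[leb]_t (f t)%:E = (F b - F a)%:E)%E.
Proof.
move=> ab cf dF fab; rewrite -FTC_everywhere// [RHS]integral_mkcond.
apply: eq_integral => t _; rewrite patchE; case: ifPn => // /negP.
rewrite in_setE/= in_itv/= => h; congr EFin; apply/eqP/negPn/negP => /fab /andP[h1 h2].
by apply: h; rewrite !ltW.
Qed.

Lemma integral_kbump y : (\int[leb]_t (kbump (t - y))%:E = 1%:E)%E.
Proof.
rewrite (@integral_mkcond_bump (fun t => kbump (t - y)) (fun t => kstep (t - y)) y (y + K^-1) _ _ (fun t => is_derive_kstep t y) _).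
- rewrite (_ : y + K^-1 - y = K^-1); last ring.
  by rewrite kstep_ge1// subrr kstep_le0// subr0.
- by rewrite ltrDl invr_gt0.
- by apply: (@Ck_continuous _ _ 0); apply: Ck_shift; exact: smooth_kbump.
- by move=> t /kbump_neq0; rewrite subr_gt0 ltrBlDl.
Qed.

Lemma integral_kbumpN y : (\int[leb]_t (kbump (y - t))%:E = 1%:E)%E.
Proof.
rewrite (@integral_mkcond_bump (fun t => kbump (y - t)) (fun t => - kstep (y - t)) (y - K^-1) y _ _ (fun t => is_derive_kstepN t y) _).
- rewrite (_ : y - (y - K^-1) = K^-1); last ring.
  by rewrite (@kstep_ge1 K^-1)// subrr kstep_le0// oppr0 add0r opprK.
- by rewrite ltrBlDr ltrDl invr_gt0.
- move=> t; apply: (@continuous_comp _ _ _ (fun t => y - t) kbump).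
    by apply: cvgB; [exact: cvg_cst|exact: cvg_id].
  exact: (smooth_continuous smooth_kbump).
- by move=> t /kbump_neq0; rewrite subr_gt0 ltrBlDr ltrBlDl => /andP[-> ]; rewrite andbT addrC.
Qed.

End scaled_bump.

Section box_kernels.
Context (R : realType) (n : nat).
Local Notation E := 'rV[R]_n.
Local Notation mu := (@lebesgue_rV R n).
Implicit Types (k : E -> R) (x y v : E).

Definition unit_box : set E := [set x | forall i, x ord0 i \in `[0, 1]%R].

(** In product form, so that [integral_prod_rV] gives its translates and reflections the integral
    one. *)
Definition box_indic x : R := \prod_(i < n) \1_(`[0, 1]%classic) (x ord0 i).

(** With the support in a fixed box, such a kernel and all its derivatives are bounded by multiples
    of [box_indic], which is what Schur's test requires. *)
Definition box_kernel k := smooth k /\ forall x, k x != 0 -> unit_box x.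

Lemma unit_box_compact : compact unit_box.
Proof.
by apply: (@rV_compact R n (fun=> `[0, 1]%classic)) => _; exact: segment_compact.
Qed.

Lemma box_indicE x : box_indic x = \1_unit_box x.
Proof.
rewrite indicE; case: (boolP (x \in unit_box)) => [|/negP xQ].
  rewrite in_setE => xQ; rewrite /box_indic big1// => i _.
  by rewrite indicE mem_set//; exact: (xQ i).
apply/eqP; rewrite /box_indic prodf_seq_eq0; apply/hasP.
suff [i xi] : exists i, ~ (x ord0 i \in `[0, 1]%R).
  by exists i; rewrite ?mem_index_enum//= indicE memNset.
by apply/existsNP => xQ'; apply: xQ; rewrite in_setE.
Qed.

Lemma box_indic_ge0 x : 0 <= box_indic x.
Proof. by rewrite box_indicE indicE. Qed.

Lemma box_indic_sqr x : box_indic x * box_indic x = box_indic x.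
Proof. by rewrite box_indicE indicE; case: (_ \in _); rewrite ?mulr1 ?mulr0. Qed.

Lemma continuous_subr y : continuous (fun x : E => x - y).
Proof. by move=> x; exact: (cvgB (@cvg_id _ (nbhs x)) (cvg_cst y)). Qed.

Lemma continuous_subl x : continuous (fun y : E => x - y).
Proof. by move=> y; exact: (cvgB (cvg_cst x) (@cvg_id _ (nbhs y))). Qed.

Let measurable_indic01 : measurable_fun setT (\1_(`[0, 1]%classic) : R -> R).
Proof. exact: measurable_indic. Qed.

Lemma measurable_box_indic : measurable_fun setT box_indic.
Proof.
apply: measurable_prod => i _; apply: (measurableT_comp measurable_indic01).
exact: measurable_coord_rV.
Qed.

Lemma integral_box_indic y : (\int[mu]_x (box_indic (x - y))%:E = 1%:E)%E.
Proof.
have := @integral_prod_rV R n (fun i t => \1_(`[0, 1]%classic) (t - y ord0 i)) (fun=> 1).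
rewrite big1_eq => <-//.
- by apply: eq_integral => x _; congr EFin; apply: eq_bigr => i _; rewrite !mxE.
- move=> i; apply: (measurableT_comp measurable_indic01) => //.
  by apply: measurable_funB.
- by move=> i; rewrite integral_indic_shift// subr0.
Qed.

Lemma integral_box_indicN x : (\int[mu]_y (box_indic (x - y))%:E = 1%:E)%E.
Proof.
have := @integral_prod_rV R n (fun i t => \1_(`[0, 1]%classic) (x ord0 i - t)) (fun=> 1).
rewrite big1_eq => <-//.
- by apply: eq_integral => y _; congr EFin; apply: eq_bigr => i _; rewrite !mxE.
- move=> i; apply: (measurableT_comp measurable_indic01) => //.
  by apply: measurable_funB.
- by move=> i; rewrite integral_indic_shiftN// subr0.
Qed.

Lemma box_kernel_bound k : box_kernel k ->
  exists2 M, 0 <= M & forall x, `|k x| <= M * box_indic x.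
Proof.
move=> [sk kQ].
have [M M0 kM] := bounded_support (smooth_continuous sk) unit_box_compact kQ.
exists M => // x; rewrite box_indicE indicE.
have [->|/kQ Qx] := eqVneq (k x) 0; first by rewrite normr0 mulr_ge0.
by rewrite mem_set// mulr1.
Qed.

Lemma box_kernel_derive k v : box_kernel k -> box_kernel (fun x => 'D_v k x).
Proof.
move=> [sk kQ]; split; first exact: smooth_derive.
exact: derive_support unit_box_compact kQ.
Qed.

Lemma derive_subr k y v x : 'D_v (fun x => k (x - y)) x = 'D_v k (x - y).
Proof.
by rewrite (@derive_affine _ _ _ (fun x => x - y) id _ k x v).2// => *; rewrite addrA.
Qed.

Lemma derive_subl k x v y : smooth k ->
  'D_v (fun y => k (x - y)) y = - 'D_v k (x - y).
Proof.
move=> sk; rewrite (@derive_affine _ _ _ (fun y => x - y) -%R _ k y v).2; last first.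
  by move=> z w h; rewrite opprD scalerN addrCA.
by rewrite deriveN_dir//; exact: smooth_derivable.
Qed.

Lemma smooth_subr k y : smooth k -> smooth (fun x => k (x - y)).
Proof.
move=> sk j; apply: (@Ck_affine _ _ _ (fun x => x - y) id) => //; first exact: continuous_subr.
by move=> *; rewrite addrA.
Qed.

Lemma smooth_subl k x : smooth k -> smooth (fun y => k (x - y)).
Proof.
move=> sk j; apply: (@Ck_affine _ _ _ (fun y => x - y) -%R) => //; first exact: continuous_subl.
by move=> z w h; rewrite opprD scalerN addrCA.
Qed.

Lemma test_subr k y : box_kernel k -> test_function setT (fun x => k (x - y)).
Proof.
move=> [sk kQ]; apply: (@test_functionP _ _ _ ((fun x => x + y) @` unit_box)) => //.
- exact: smooth_subr.
- apply: continuous_compact unit_box_compact; apply: continuous_subspaceT => x.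
  exact: (cvgD (@cvg_id _ (nbhs x)) (cvg_cst y)).
- by move=> x /kQ Qx; exists (x - y) => //; rewrite subrK.
Qed.

Lemma test_subl k x : box_kernel k -> test_function setT (fun y => k (x - y)).
Proof.
move=> [sk kQ]; apply: (@test_functionP _ _ _ ((fun y => x - y) @` unit_box)) => //.
- exact: smooth_subl.
- apply: continuous_compact unit_box_compact; apply: continuous_subspaceT => y.
  exact: continuous_subl.
- by move=> y /kQ Qx; exists (x - y) => //; rewrite opprB addrC subrK.
Qed.

Lemma measurable_subr k y : measurable_fun setT k -> measurable_fun setT (fun x => k (x - y)).
Proof.
move=> mk; apply: (measurableT_comp mk); apply: measurable_fun_rV => i.
rewrite (_ : (fun _ => _) = (fun x : E => x ord0 i - y ord0 i)).
  by apply: measurable_funB => //; exact: measurable_coord_rV.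
by apply/funext => x; rewrite !mxE.
Qed.

Lemma box_indic_sqint y : sqint mu (fun x => box_indic (x - y)).
Proof.
have mb := measurable_subr y measurable_box_indic.
split; first exact: mb.
rewrite (_ : _ \o _ = EFin \o (fun x => box_indic (x - y))); last first.
  by apply/funext => x /=; rewrite expr2 box_indic_sqr.
apply/integrableP; split; first exact/measurable_EFinP.
under eq_integral do rewrite /= ger0_norm ?box_indic_ge0//.
by rewrite integral_box_indic ltry.
Qed.

Lemma nrm_box_indic y : nrm mu (fun x => box_indic (x - y)) = 1.
Proof.
rewrite /nrm /ip /Rintegral; under eq_integral do rewrite box_indic_sqr.
by rewrite integral_box_indic sqrtr1.
Qed.

Lemma kernel_sqint k M y : measurable_fun setT k -> (forall x, `|k x| <= M * box_indic x) ->
  sqint mu (fun x => k (x - y)) /\ nrm mu (fun x => k (x - y)) <= `|M|.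
Proof.
move=> mk kM; have mky := measurable_subr y mk.
have Mb := sqintZ M (box_indic_sqint y).
have kb x : `|k (x - y)| <= `|M * box_indic (x - y)| by rewrite (le_trans (kM _))// ler_norm.
split; first exact: le_sqint Mb.
by rewrite (le_trans (le_nrm Mb _ _))// nrmZ ?nrm_box_indic ?mulr1//; exact: box_indic_sqint.
Qed.

Lemma box_kernel_measurable k : box_kernel k -> measurable_fun setT k.
Proof. by move=> [/smooth_continuous ck _]; exact: continuous_rV_measurable. Qed.

Definition mollifier (K : R) x : R := \prod_(i < n) kbump K (x ord0 i).

Lemma mollifier_ge0 K x : 0 < K -> 0 <= mollifier K x.
Proof. by move=> K0; apply: prodr_ge0 => i _; exact: kbump_ge0. Qed.

Lemma mollifier_neq0 K x : 0 < K -> mollifier K x != 0 -> forall i, 0 < x ord0 i < K^-1.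
Proof.
move=> K0; rewrite prodf_seq_neq0 => /allP h i.
by have := h i; rewrite mem_index_enum => /(_ isT) /kbump_neq0; exact.
Qed.

Lemma continuous_coord i : continuous (fun x : E => x ord0 i).
Proof. exact: coord_continuous. Qed.

Lemma smooth_mollifier K : smooth (mollifier K).
Proof.
move=> k; apply: Ck_prod => i.
apply: (@Ck_affine _ _ _ (fun x : E => x ord0 i) (fun x : E => x ord0 i)).
- exact: continuous_coord.
- by move=> x v h; rewrite !mxE.
- exact: smooth_kbump.
Qed.

Lemma box_kernel_mollifier K : 1 <= K -> box_kernel (mollifier K).
Proof.
move=> K1; have K0 : 0 < K by rewrite (lt_le_trans ltr01).
split; first exact: smooth_mollifier.
move=> x /(mollifier_neq0 K0) h i; have /andP[h1 h2] := h i.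
by rewrite in_itv/= (ltW h1) (le_trans (ltW h2))// invf_le1.
Qed.

Lemma integral_mollifier K y : 0 < K -> (\int[mu]_x (mollifier K (x - y))%:E = 1%:E)%E.
Proof.
move=> K0.
have mk (i : 'I_n) : measurable_fun setT (fun t : R => kbump K (t - y ord0 i) : R).
  apply: continuous_measurable_fun.
  by apply: (@Ck_continuous _ _ 0); apply: Ck_shift; exact: smooth_kbump.
have k0 (i : 'I_n) t : 0 <= kbump K (t - y ord0 i) by exact: kbump_ge0.
have := integral_prod_rV mk k0 (fun i => integral_kbump K0 (y ord0 i)).
rewrite big1_eq => <-; apply: eq_integral => x _; congr EFin; apply: eq_bigr => i _.
by rewrite !mxE.
Qed.

Lemma integral_mollifierN K x : 0 < K -> (\int[mu]_y (mollifier K (x - y))%:E = 1%:E)%E.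
Proof.
move=> K0.
have mk (i : 'I_n) : measurable_fun setT (fun t : R => kbump K (x ord0 i - t) : R).
  apply: continuous_measurable_fun => t.
  apply: (@continuous_comp _ _ _ (fun t => x ord0 i - t) (kbump K)).
    by apply: cvgB; [exact: cvg_cst|exact: cvg_id].
  exact: (smooth_continuous (smooth_kbump K)).
have k0 (i : 'I_n) t : 0 <= kbump K (x ord0 i - t) by exact: kbump_ge0.
have := integral_prod_rV mk k0 (fun i => integral_kbumpN K0 (x ord0 i)).
rewrite big1_eq => <-; apply: eq_integral => y _; congr EFin; apply: eq_bigr => i _.
by rewrite !mxE.
Qed.

End box_kernels.

(** * Mollified scalar products *)

Section convolution_form.
Context (R : realType) (n : nat).
Local Notation E := 'rV[R]_n.
Local Notation mu := (@lebesgue_rV R n).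
Implicit Types (f g w k d : E -> R).

Lemma measurable_diff k : measurable_fun setT k ->
  measurable_fun setT (fun p : E * E => k (p.1 - p.2)).
Proof.
move=> mk; apply: (measurableT_comp mk); apply: measurable_fun_rV => i.
rewrite (_ : (fun _ => _) = (fun p : E * E => p.1 ord0 i - p.2 ord0 i)).
  apply: measurable_funB.
    by apply: (measurableT_comp (@measurable_coord_rV _ _ _ i)).
  by apply: (measurableT_comp (@measurable_coord_rV _ _ _ i)).
by apply/funext => x; rewrite !mxE.
Qed.

Lemma measurable_subl k (x : E) : measurable_fun setT k -> measurable_fun setT (fun y : E => k (x - y)).
Proof.
move=> mk; apply: (measurableT_comp mk); apply: measurable_fun_rV => i.
rewrite (_ : (fun _ => _) = (fun y : E => x ord0 i - y ord0 i)).
  by apply: measurable_funB => //; exact: measurable_coord_rV.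
by apply/funext => y; rewrite !mxE.
Qed.

(* The pairing of [f] with the convolution of [k] and [w], as a double integral. *)
Definition conv_form k f w :=
  \int[(mu \x mu)%E]_p (f p.1 * k (p.1 - p.2) * w p.2).

(* The hypothesis of Schur's test for the kernel [d (x - y)]. *)
Definition kernel_mass_le d (C : R) := [/\ measurable_fun setT d, forall z, 0 <= d z,
  forall x, (\int[mu]_y (d (x - y))%:E <= C%:E)%E &
  forall y, (\int[mu]_x (d (x - y))%:E <= C%:E)%E].

Section schur.
Variables (d : E -> R) (C : R).
Hypothesis dC : kernel_mass_le d C.

Let mfst f : measurable_fun setT f -> measurable_fun setT (fun p : E * E => f p.1).
Proof. by move=> mf; exact: measurableT_comp. Qed.

Let msnd f : measurable_fun setT f -> measurable_fun setT (fun p : E * E => f p.2).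
Proof. by move=> mf; exact: measurableT_comp. Qed.

Let sqE f : sqint mu f -> (\int[mu]_x (f x ^+ 2)%:E = (nrm mu f ^+ 2)%:E)%E.
Proof.
move=> f2; rewrite nrm_sqr /ip /Rintegral fineK//.
exact: (integrable_fin_num _ (sqint_mul f2 f2)).
Qed.

Lemma weighted_sq1 f : sqint mu f ->
  (\int[(mu \x mu)]_p (f p.1 ^+ 2 * d (p.1 - p.2))%:E <= (C * nrm mu f ^+ 2)%:E)%E.
Proof.
case: dC => md d0 dC1 _ f2.
have mf := f2.1.
have mp : measurable_fun setT (fun p : E * E => f p.1 ^+ 2 * d (p.1 - p.2)).
  apply: measurable_funM; last exact: measurable_diff.
  exact: (measurable_funX 2 (mfst mf)).
rewrite fubini_tonelli1; first last.
- by move=> p; rewrite lee_fin mulr_ge0// sqr_ge0.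
- exact/measurable_EFinP.
rewrite EFinM -sqE// -ge0_integralZl//; last 3 first.
- exact: (measurable_int _ f2.2).
- by move=> x _; rewrite lee_fin sqr_ge0.
- by rewrite (le_trans _ (dC1 0))// integral_ge0// => y _; rewrite lee_fin.
apply: ge0_le_integral => //.
- by move=> x _; apply: integral_ge0 => y _; rewrite lee_fin mulr_ge0// sqr_ge0.
- apply: measurable_fun_fubini_tonelli_F; first exact/measurable_EFinP.
  by move=> p; rewrite lee_fin mulr_ge0// sqr_ge0.
- apply/measurable_EFinP; apply: measurable_funM => //.
  exact: measurable_funX.
- move=> x _; rewrite /fubini_F/=.
  under eq_integral do rewrite EFinM.
  rewrite ge0_integralZl//; last 3 first.
  + by apply/measurable_EFinP; exact: measurable_subl.
  + by move=> y _; rewrite lee_fin.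
  + by rewrite lee_fin sqr_ge0.
  by rewrite muleC lee_wpmul2r// lee_fin sqr_ge0.
Qed.

Lemma weighted_sq2 f : sqint mu f ->
  (\int[(mu \x mu)]_p (f p.2 ^+ 2 * d (p.1 - p.2))%:E <= (C * nrm mu f ^+ 2)%:E)%E.
Proof.
case: dC => md d0 _ dC2 f2.
have mf := f2.1.
have mp : measurable_fun setT (fun p : E * E => f p.2 ^+ 2 * d (p.1 - p.2)).
  apply: measurable_funM; last exact: measurable_diff.
  exact: (measurable_funX 2 (msnd mf)).
rewrite fubini_tonelli2; first last.
- by move=> p; rewrite lee_fin mulr_ge0// sqr_ge0.
- exact/measurable_EFinP.
rewrite EFinM -sqE// -ge0_integralZl//; last 3 first.
- exact: (measurable_int _ f2.2).
- by move=> x _; rewrite lee_fin sqr_ge0.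
- by rewrite (le_trans _ (dC2 0))// integral_ge0// => y _; rewrite lee_fin.
apply: ge0_le_integral => //.
- by move=> x _; apply: integral_ge0 => y _; rewrite lee_fin mulr_ge0// sqr_ge0.
- apply: measurable_fun_fubini_tonelli_G; first exact/measurable_EFinP.
  by move=> p; rewrite lee_fin mulr_ge0// sqr_ge0.
- apply/measurable_EFinP; apply: measurable_funM => //.
  exact: measurable_funX.
- move=> y _; rewrite /fubini_G/=.
  under eq_integral do rewrite EFinM.
  rewrite ge0_integralZl//; last 3 first.
  + by apply/measurable_EFinP; exact: measurable_subr.
  + by move=> x _; rewrite lee_fin.
  + by rewrite lee_fin sqr_ge0.
  by rewrite muleC lee_wpmul2r// lee_fin sqr_ge0.
Qed.

Variable k : E -> R.
Hypotheses (mk : measurable_fun setT k) (kd : forall z, `|k z| <= d z).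

Let C0 : 0 <= C.
Proof.
case: dC => md d0 dC1 _; rewrite -lee_fin (le_trans _ (dC1 0))// integral_ge0// => y _.
by rewrite lee_fin.
Qed.

Let measurable_form f w : measurable_fun setT f -> measurable_fun setT w ->
  measurable_fun setT (fun p : E * E => f p.1 * k (p.1 - p.2) * w p.2).
Proof.
move=> mf mw; apply: measurable_funM; last exact: msnd.
by apply: measurable_funM; [exact: mfst|exact: measurable_diff].
Qed.

(** Pointwise, $|f(x) k(x-y) w(y)| \le \frac12 (t f(x)^2 + t^{-1} w(y)^2)\, d(x-y)$, and Tonelli
    integrates each square against the mass of [d]. The free parameter [t] later turns the sum into
    a product of norms. *)
Let schur_int f w (t : R) : sqint mu f -> sqint mu w -> 0 < t ->
  (\int[(mu \x mu)]_p `|f p.1 * k (p.1 - p.2) * w p.2|%:E <=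
   (C * ((t * nrm mu f ^+ 2 + t^-1 * nrm mu w ^+ 2) / 2))%:E)%E.
Proof.
case: dC => md d0 _ _ f2 w2 t0; have mf := f2.1; have mw := w2.1.
have mF : measurable_fun setT (fun p : E * E => f p.1 ^+ 2 * d (p.1 - p.2)).
  apply: measurable_funM; last exact: measurable_diff.
  exact: (measurable_funX 2 (mfst mf)).
have mW : measurable_fun setT (fun p : E * E => w p.2 ^+ 2 * d (p.1 - p.2)).
  apply: measurable_funM; last exact: measurable_diff.
  exact: (measurable_funX 2 (msnd mw)).
have F0 (p : E * E) : 0 <= f p.1 ^+ 2 * d (p.1 - p.2) by rewrite mulr_ge0// sqr_ge0.
have W0 (p : E * E) : 0 <= w p.2 ^+ 2 * d (p.1 - p.2) by rewrite mulr_ge0// sqr_ge0.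
have t2 : 0 <= t / 2 by rewrite divr_ge0// ltW.
have ti2 : 0 <= t^-1 / 2 by rewrite divr_ge0// invr_ge0 ltW.
apply: (@le_trans _ _ (\int[(mu \x mu)]_p ((t / 2)%:E * (f p.1 ^+ 2 * d (p.1 - p.2))%:E +
    (t^-1 / 2)%:E * (w p.2 ^+ 2 * d (p.1 - p.2))%:E)))%E.
  apply: ge0_le_integral => //.
  - apply/measurable_EFinP; apply: measurableT_comp => //; exact: (measurable_form mf mw).
  - apply: emeasurable_funD; apply: measurable_funeM; exact/measurable_EFinP.
  move=> p _; rewrite -!EFinM -EFinD lee_fin !normrM.
  have -> : `|f p.1| * `|k (p.1 - p.2)| * `|w p.2| = (`|f p.1| * `|w p.2|) * `|k (p.1 - p.2)|.
    by rewrite mulrAC.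
  rewrite !mulrA -mulrDl ler_pM// ?mulr_ge0//.
  rewrite -[leRHS]/(t / 2 * f p.1 * f p.1 + t^-1 / 2 * w p.2 * w p.2).
  rewrite -!mulrA -!expr2 -[f p.1 ^+ 2](real_normK (num_real _)) -[w p.2 ^+ 2](real_normK (num_real _)).
  have s0 : 0 < Num.sqrt t by rewrite sqrtr_gt0.
  have := sqr_ge0 (Num.sqrt t * `|f p.1| - (Num.sqrt t)^-1 * `|w p.2|).
  rewrite sqrrB !exprMn exprVn sqr_sqrtr ?(ltW t0)//.
  have -> : Num.sqrt t * `|f p.1| * ((Num.sqrt t)^-1 * `|w p.2|) = `|f p.1| * `|w p.2|.
    by field; rewrite gt_eqF.
  lra.
rewrite ge0_integralD//; last 4 first.
- by move=> p _; rewrite -EFinM lee_fin mulr_ge0.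
- by apply: measurable_funeM; exact/measurable_EFinP.
- by move=> p _; rewrite -EFinM lee_fin mulr_ge0.
- by apply: measurable_funeM; exact/measurable_EFinP.
rewrite !ge0_integralZl//; try exact/measurable_EFinP; try by move=> p _; rewrite lee_fin.
apply: (@le_trans _ _ ((t / 2)%:E * (C * nrm mu f ^+ 2)%:E + (t^-1 / 2)%:E * (C * nrm mu w ^+ 2)%:E)%E).
  by apply: leeD; rewrite lee_wpmul2l ?lee_fin//; [exact: weighted_sq1|exact: weighted_sq2].
rewrite -!EFinM -EFinD lee_fin le_eqVlt; apply/orP; left; apply/eqP.
by field; rewrite gt_eqF.
Qed.

Lemma conv_form_integrable f w : sqint mu f -> sqint mu w ->
  (mu \x mu)%E.-integrable setT (EFin \o (fun p => f p.1 * k (p.1 - p.2) * w p.2)).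
Proof.
move=> f2 w2; apply/integrableP; split.
  by apply/measurable_EFinP; exact: (measurable_form f2.1 w2.1).
by apply: le_lt_trans (schur_int f2 w2 ltr01) _; rewrite ltry.
Qed.

Lemma conv_form_bound f w : sqint mu f -> sqint mu w ->
  `|conv_form k f w| <= C * (nrm mu f * nrm mu w).
Proof.
move=> f2 w2; have ifw := conv_form_integrable f2 w2.
(* The factor [C] is shared between the two norms as $\sqrt C \cdot \sqrt C$, which brings the bound
   into the form required by [homogeneous_bound]. *)
have H (t : R) : 0 < t -> `|conv_form k f w| <=
    (t * (Num.sqrt C * nrm mu f) ^+ 2 + t^-1 * (Num.sqrt C * nrm mu w) ^+ 2) / 2.
  move=> t0; rewrite !exprMn sqr_sqrtr// -lee_fin EFin_normr_Rintegral//.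
  apply: le_trans (le_abse_integral _ measurableT _) _; first exact: measurable_int ifw.
  apply: le_trans (schur_int f2 w2 t0) _; rewrite lee_fin le_eqVlt; apply/orP; left; apply/eqP.
  by field; rewrite gt_eqF.
have := homogeneous_bound _ _ H; rewrite !mulr_ge0 ?sqrtr_ge0 ?nrm_ge0// => /(_ isT isT).
by rewrite mulrACA -expr2 sqr_sqrtr.
Qed.

End schur.

End convolution_form.

Section conv_form_theory.
Context (R : realType) (n : nat).
Local Notation E := 'rV[R]_n.
Local Notation mu := (@lebesgue_rV R n).
Implicit Types (f g w k d : E -> R).

Lemma box_indic_mass (M : R) : 0 <= M -> kernel_mass_le (fun z : E => M * box_indic z) M.
Proof.
move=> M0; have mb : measurable_fun setT (fun z : E => M * box_indic z).
  by apply: measurable_funM => //; exact: measurable_box_indic.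
split => // [z|x|y]; first by rewrite mulr_ge0 ?box_indic_ge0.
- under eq_integral do rewrite EFinM.
  rewrite ge0_integralZl//; first by rewrite integral_box_indicN mule1.
  + by apply/measurable_EFinP; apply: measurable_subl; exact: measurable_box_indic.
  + by move=> y _; rewrite lee_fin box_indic_ge0.
- under eq_integral do rewrite EFinM.
  rewrite ge0_integralZl//; first by rewrite integral_box_indic mule1.
  + by apply/measurable_EFinP; apply: measurable_subr; exact: measurable_box_indic.
  + by move=> x _; rewrite lee_fin box_indic_ge0.
Qed.

Lemma box_indic_sqintN (x : E) : sqint mu (fun y => box_indic (x - y)).
Proof.
have mb := measurable_subl x (@measurable_box_indic R n).
split; first exact: mb.
rewrite (_ : _ \o _ = EFin \o (fun y => box_indic (x - y))); last first.
  by apply/funext => y /=; rewrite expr2 box_indic_sqr.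
apply/integrableP; split; first exact/measurable_EFinP.
under eq_integral do rewrite /= ger0_norm ?box_indic_ge0//.
by rewrite integral_box_indicN ltry.
Qed.

Lemma kernel_sqintN k M (x : E) : measurable_fun setT k ->
  (forall z, `|k z| <= M * box_indic z) -> sqint mu (fun y => k (x - y)).
Proof.
move=> mk kM; apply: le_sqint (sqintZ M (box_indic_sqintN x)); first exact: measurable_subl.
by move=> y; rewrite (le_trans (kM _))// ler_norm.
Qed.

Section fixed_kernel.
Variables (k : E -> R) (M : R).
Hypotheses (mk : measurable_fun setT k) (kM : forall z, `|k z| <= M * box_indic z).
Hypothesis M0 : 0 <= M.

Let kslice y := (kernel_sqint y mk kM).1.
Let kint f w := conv_form_integrable (box_indic_mass M0) mk kM (f := f) (w := w).

Lemma conv_formEr f w : sqint mu f -> sqint mu w ->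
  conv_form k f w = \int[mu]_y (w y * ip mu f (fun x => k (x - y))).
Proof.
move=> f2 w2; rewrite /conv_form /Rintegral -integral21_prod_meas1; last exact: kint.
congr fine; apply: eq_integral => y _; rewrite /fubini_G/=.
have fk := sqint_mul f2 (kslice y).
have -> : (fun x => (f x * k (x - y) * w y)%:E) =
    (fun x => (w y)%:E * ((EFin \o (f \* (fun x => k (x - y)))%R) x))%E.
  by apply/funext => x /=; rewrite -EFinM mulrC.
rewrite integralZl// EFinM; congr (_ * _)%E.
by rewrite /ip /Rintegral fineK//; exact: integrable_fin_num fk.
Qed.

(** This allows the equation, tested with the translates of [k], to be averaged term by term against
    [w y]. *)
Lemma conv_form_slice_integrable f w : sqint mu f -> sqint mu w ->
  mu.-integrable setT (EFin \o (fun y => w y * ip mu f (fun x => k (x - y)))).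
Proof.
move=> f2 w2; have ik := kint f2 w2.
have E y : (w y * ip mu f (fun x => k (x - y)))%:E =
    fubini_G mu (EFin \o (fun p => f p.1 * k (p.1 - p.2) * w p.2)) y.
  rewrite /fubini_G/=; have fk := sqint_mul f2 (kslice y).
  have -> : (fun x => (f x * k (x - y) * w y)%:E) =
      (fun x => (w y)%:E * ((EFin \o (f \* (fun x => k (x - y)))%R) x))%E.
    by apply/funext => x /=; rewrite -EFinM mulrC.
  rewrite integralZl// EFinM; congr (_ * _)%E.
  by rewrite /ip /Rintegral fineK//; exact: integrable_fin_num fk.
rewrite (_ : EFin \o _ = fubini_G mu (EFin \o (fun p => f p.1 * k (p.1 - p.2) * w p.2))); last first.
  by apply/funext => y; exact: E.
have mG := measurable_fubini_G ik.
apply/integrableP; split; first exact: mG.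
have /integrableP[mF] := ik; rewrite fubini_tonelli2//; last exact: measurableT_comp.
apply: le_lt_trans; apply: ge0_le_integral => //.
- by apply: measurableT_comp => //; exact: mG.
- by apply: measurable_fun_fubini_tonelli_G => //; exact: measurableT_comp.
- move=> y _; rewrite /fubini_G; apply: le_abse_integral => //.
  apply/measurable_EFinP; have [[mf _] [mw _]] := (f2, w2).
  apply: (measurable_funM (measurable_funM mf (kslice y).1)).
  exact: (measurable_cst (w y)).
Qed.

Lemma conv_formEl f w : sqint mu f -> sqint mu w ->
  conv_form k f w = \int[mu]_x (f x * ip mu w (fun y => k (x - y))).
Proof.
move=> f2 w2; rewrite /conv_form /Rintegral -integral12_prod_meas1; last exact: kint.
congr fine; apply: eq_integral => x _; rewrite /fubini_F/=.
have wk := sqint_mul w2 (kernel_sqintN x mk kM).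
have -> : (fun y => (f x * k (x - y) * w y)%:E) =
    (fun y => (f x)%:E * ((EFin \o (w \* (fun y => k (x - y)))%R) y))%E.
  by apply/funext => y /=; rewrite -EFinM; congr EFin; ring.
rewrite integralZl// EFinM; congr (_ * _)%E.
by rewrite /ip /Rintegral fineK//; exact: integrable_fin_num wk.
Qed.

Lemma conv_formBl f g w : sqint mu f -> sqint mu g -> sqint mu w ->
  conv_form k (fun x => f x - g x) w = conv_form k f w - conv_form k g w.
Proof.
move=> f2 g2 w2; rewrite /conv_form -RintegralB//; try exact: kint.
by apply: eq_Rintegral => p _; rewrite !mulrBl.
Qed.

Lemma conv_formZl (a : R) f w : sqint mu f -> sqint mu w ->
  conv_form k (fun x => a * f x) w = a * conv_form k f w.
Proof.
move=> f2 w2; rewrite /conv_form -RintegralZl//; try exact: kint.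
by apply: eq_Rintegral => p _; rewrite !mulrA.
Qed.

Lemma conv_formBr f w g : sqint mu f -> sqint mu g -> sqint mu w ->
  conv_form k f (fun x => w x - g x) = conv_form k f w - conv_form k f g.
Proof.
move=> f2 g2 w2; rewrite /conv_form -RintegralB//; try exact: kint.
by apply: eq_Rintegral => p _; rewrite !mulrBr.
Qed.

End fixed_kernel.

(** For fixed [x], $y \mapsto k(x - y)$ is a test function, and its derivative in [y] is minus that
    of [k]. This sign cancels the one in the definition of a weak derivative. *)
Lemma conv_form_by_parts k i f w g : box_kernel k -> sqint mu f -> sqint mu w -> sqint mu g ->
  is_weak_partial i w g ->
  conv_form (fun z => 'D_(basis_vec R i) k z) f w = conv_form k f g.
Proof.
move=> bk f2 w2 g2 wg.
have bDk := box_kernel_derive (basis_vec R i) bk.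
have [M M0 kM] := box_kernel_bound bk; have [N N0 kN] := box_kernel_bound bDk.
rewrite (conv_formEl (box_kernel_measurable bDk) kN N0 f2 w2).
rewrite (conv_formEl (box_kernel_measurable bk) kM M0 f2 g2).
apply: eq_Rintegral => x _; congr (_ * _); rewrite /ip.
have := wg _ (test_subl x bk).
under eq_Rintegral => y _ do rewrite (derive_subl _ _ _ bk.1) mulrN.
have wk := sqint_mul w2 (kernel_sqintN x (box_kernel_measurable bDk) kN).
move=> h; apply: oppr_inj; rewrite -h.
rewrite -mulN1r -RintegralZl//; by apply: eq_Rintegral => y _; rewrite mulN1r.
Qed.

Lemma mollifier_mass (K : R) : 0 < K -> kernel_mass_le (mollifier K : E -> R) 1.
Proof.
move=> K0; split.
- by apply: continuous_rV_measurable; apply: smooth_continuous; exact: smooth_mollifier.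
- by move=> z; exact: mollifier_ge0.
- by move=> x; rewrite integral_mollifierN.
- by move=> y; rewrite integral_mollifier.
Qed.

(** Schur's test with mass one. The bound is therefore independent of [K], whereas for a general
    kernel it involves the supremum. *)
Lemma conv_form_mollifier_le (K : R) f w : 0 < K -> sqint mu f -> sqint mu w ->
  `|conv_form (mollifier K) f w| <= nrm mu f * nrm mu w.
Proof.
move=> K0 f2 w2; rewrite -[leRHS]mul1r.
apply: (conv_form_bound (mollifier_mass K0)) => //.
  by case: (mollifier_mass K0).
by move=> z; rewrite ger0_norm// mollifier_ge0.
Qed.

End conv_form_theory.

Import HBSimple HBNNSimple.

(** * Mollified scalar products converge to the scalar product *)

Section mollification.
Context (R : realType) (n : nat).
Local Notation E := 'rV[R]_n.
Local Notation mu := (@lebesgue_rV R n).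
Local Notation sqint := (sqint mu).
Local Notation ip := (ip mu).
Local Notation nrm := (nrm mu).
Implicit Types (f g w k d : E -> R).

Definition moll j : E -> R := mollifier j.+1%:R.

Lemma moll_scale_gt0 j : 0 < j.+1%:R :> R. Proof. by rewrite ltr0n. Qed.

Lemma moll_kernel j : box_kernel (moll j).
Proof. by apply: box_kernel_mollifier; rewrite ler1n. Qed.

Lemma measurable_moll j : measurable_fun setT (moll j).
Proof. exact: (box_kernel_measurable (moll_kernel j)). Qed.

Lemma conv_moll_le j f w : sqint f -> sqint w -> `|conv_form (moll j) f w| <= nrm f * nrm w.
Proof. by apply: conv_form_mollifier_le; exact: moll_scale_gt0. Qed.

Lemma conv_mollBl j f g w : sqint f -> sqint g -> sqint w ->
  conv_form (moll j) (fun x => f x - g x) w = conv_form (moll j) f w - conv_form (moll j) g w.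
Proof.
have [M M0 kM] := box_kernel_bound (moll_kernel j).
exact: (conv_formBl (measurable_moll j) kM M0).
Qed.

(** Weak convergence in $L^2$ of the mollifications, which is enough for the later limits. The class
    is linear and closed in norm, so it is reached from indicators of open sets through measurable
    sets and simple functions. *)
Definition approximable f := sqint f /\
  forall w, sqint w -> conv_form (moll j) f w @[j --> \oo] --> ip f w.

Lemma approximableB f g : approximable f -> approximable g ->
  approximable (fun x => f x - g x).
Proof.
move=> [f2 Hf] [g2 Hg]; split; first exact: sqintB.
move=> w w2; rewrite ipBl//; under eq_fun do rewrite conv_mollBl//.
by apply: cvgB; [exact: Hf|exact: Hg].
Qed.

Lemma approximableZ a f : approximable f -> approximable (fun x => a * f x).
Proof.
move=> [f2 Hf]; split; first exact: sqintZ.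
move=> w w2; rewrite ipZl//.
have H j : conv_form (moll j) (fun x => a * f x) w = a * conv_form (moll j) f w.
  have [M M0 kM] := box_kernel_bound (moll_kernel j).
  exact: (conv_formZl (measurable_moll j) kM M0).
under eq_fun do rewrite H.
by apply: cvgM; [exact: cvg_cst|exact: Hf].
Qed.

Lemma approximableD f g : approximable f -> approximable g ->
  approximable (fun x => f x + g x).
Proof.
move=> Hf /(approximableZ (-1)) /(approximableB Hf) h.
by rewrite (_ : (fun x => _) = (fun x => f x - -1 * g x))//; apply/funext => x; rewrite mulN1r opprK.
Qed.

(** By [conv_moll_le] the mollified pairings are continuous in [f] uniformly in [j]. Replacing [f]
    by [fm m] costs [e / 4] in the pairing and [e / 4] in its limit, and [e / 2] remains for the
    convergence. *)
Lemma approximable_lim (fm : nat -> E -> R) f : (forall m, approximable (fm m)) -> sqint f ->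
  nrm (fun x => fm m x - f x) @[m --> \oo] --> (0 : R) -> approximable f.
Proof.
move=> Hm f2 fmf; split => // w w2; apply/cvgrPdist_le => e e0.
have w1 : 0 < nrm w + 1 by rewrite ltr_wpDl ?nrm_ge0.
have [m hm] : exists m, nrm (fun x => fm m x - f x) < e / 4 / (nrm w + 1).
  move/cvgrPdist_lt: fmf => /(_ (e / 4 / (nrm w + 1))).
  rewrite !divr_gt0// => /(_ isT)[m _ /(_ m (leqnn m))] h.
  by exists m; move: h; rewrite sub0r normrN ger0_norm ?nrm_ge0.
have [fm2 Hfm] := Hm m.
have fmf2 := sqintB fm2 f2.
have hw : nrm (fun x => fm m x - f x) * nrm w <= e / 4.
  rewrite (le_trans (ler_wpM2r (nrm_ge0 _ _) (ltW hm)))// mulrAC ler_pdivrMr//.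
  by rewrite ler_pM2l ?divr_gt0//; lra.
have /cvgrPdist_le/(_ (e / 2)) := Hfm w w2.
rewrite divr_gt0// => /(_ isT); apply: filterS => j hj.
have h1 := conv_moll_le j fmf2 w2; rewrite conv_mollBl// in h1.
have h2 := cauchy_schwarz fmf2 w2; rewrite ipBl// in h2.
have -> : ip f w - conv_form (moll j) f w = (ip (fm m) w - conv_form (moll j) (fm m) w)
  - (ip (fm m) w - ip f w) + (conv_form (moll j) (fm m) w - conv_form (moll j) f w) by ring.
apply: le_trans (ler_normD _ _) _.
apply: le_trans (lerD (ler_normB _ _) (lexx _)) _.
lra.
Qed.

Lemma indic_sqint (A : set E) : measurable A -> (mu A < +oo)%E -> sqint (\1_A).
Proof.
move=> mA fA; have m1 : measurable_fun setT (\1_A : E -> R) by exact: measurable_indic.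
split => //.
rewrite (_ : _ \o _ = EFin \o \1_A); last first.
  by apply/funext => x /=; rewrite indicE; case: (_ \in _); rewrite ?expr1n ?expr0n.
apply/integrableP; split; first exact/measurable_EFinP.
under eq_integral => x _ do rewrite /= ger0_norm ?indicE ?ler0n// -indicE.
by rewrite integral_indic// setIT.
Qed.

Section open_set.
Variable A : set E.
Hypotheses (oA : open A) (fA : (mu A < +oo)%E).
Let mA : measurable A. Proof. exact: open_rV_measurable. Qed.
Let A2 := indic_sqint mA fA.

(** The indicator convolved with the reflected mollifier; by [convJ] it represents the form $w
    \mapsto$ [conv_form (moll j) (\1_A) w]. *)
Let J j y := ip (\1_A) (fun x => moll j (x - y)).

Let slice j y : sqint (fun x => moll j (x - y)).
Proof.
have [M M0 kM] := box_kernel_bound (moll_kernel j).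
exact: (kernel_sqint y (measurable_moll j) kM).1.
Qed.

Let slice_int j y : mu.-integrable setT (EFin \o (fun x => moll j (x - y))).
Proof.
apply/integrableP; split; first by apply/measurable_EFinP; exact: (slice j y).1.
under eq_integral do rewrite /= ger0_norm ?mollifier_ge0 ?moll_scale_gt0//.
by rewrite integral_mollifier ?moll_scale_gt0// ltry.
Qed.

Let J_ge0 j y : 0 <= J j y.
Proof.
by apply: Rintegral_ge0 => x _; rewrite mulr_ge0 ?indicE ?ler0n// mollifier_ge0// moll_scale_gt0.
Qed.

Let J_le1 j y : J j y <= 1.
Proof.
rewrite (_ : 1 = \int[mu]_x (moll j (x - y))); last first.
  by rewrite /Rintegral integral_mollifier// moll_scale_gt0.
apply: le_Rintegral => //; first exact: (sqint_mul A2 (slice j y)).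
move=> x _; rewrite indicE; case: (_ \in _); rewrite ?mul1r// mul0r.
by rewrite mollifier_ge0// moll_scale_gt0.
Qed.

Let J_int j : mu.-integrable setT (EFin \o J j).
Proof.
have mF : measurable_fun setT (fun p : E * E => (\1_A p.1 * moll j (p.1 - p.2))%:E).
  apply/measurable_EFinP; apply: measurable_funM; last by apply: measurable_diff; exact: measurable_moll.
  exact: measurableT_comp.
have F0 p : (0 <= (\1_A p.1 * moll j (p.1 - p.2))%:E :> \bar R)%E.
  by rewrite lee_fin mulr_ge0 ?indicE ?ler0n// mollifier_ge0// moll_scale_gt0.
have E1 : EFin \o J j = fubini_G mu (fun p : E * E => (\1_A p.1 * moll j (p.1 - p.2))%:E).
  apply/funext => y; rewrite /fubini_G /J /ip /Rintegral /= fineK//.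
  exact: integrable_fin_num (sqint_mul A2 (slice j y)).
have mJ : measurable_fun setT (EFin \o J j).
  by rewrite E1; exact: measurable_fun_fubini_tonelli_G.
apply/integrableP; split => //.
under eq_integral do rewrite /= ger0_norm//.
rewrite -[X in (integral _ _ X < _)%E]/(EFin \o J j) E1 -fubini_tonelli2// fubini_tonelli1//.
rewrite (eq_integral (EFin \o \1_A)).
  by rewrite integral_indic// setIT.
move=> x _; rewrite /fubini_F/=.
under eq_integral do rewrite EFinM.
rewrite ge0_integralZl//; last 2 first.
- by apply/measurable_EFinP; apply: measurable_subl; exact: measurable_moll.
- by move=> y _; rewrite lee_fin mollifier_ge0// moll_scale_gt0.
by rewrite integral_mollifierN ?moll_scale_gt0// mule1.
Qed.

Let J2 j : sqint (J j).
Proof.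
have mJ : measurable_fun setT (J j) by apply/measurable_EFinP; exact: (measurable_int _ (J_int j)).
split => //; apply: le_integrable (J_int j) => //.
  by apply/measurable_EFinP; exact: (measurable_funX 2 mJ).
move=> y _ /=; rewrite lee_fin !ger0_norm ?sqr_ge0// expr2 ler_piMr//.
Qed.

Let convJ j w : sqint w -> conv_form (moll j) (\1_A) w = ip w (J j).
Proof.
move=> w2; have [M M0 kM] := box_kernel_bound (moll_kernel j).
by rewrite (conv_formEr (measurable_moll j) kM M0 A2 w2).
Qed.

(** Take [w] equal to [J j] itself in the bound with constant one, and divide by its norm. *)
Let nrmJ j : nrm (J j) <= nrm (\1_A).
Proof.
have := conv_moll_le j A2 (J2 j); rewrite convJ// ger0_norm ?ip_ge0// -nrm_sqr expr2.
have [->|J0] := eqVneq (nrm (J j)) 0; first by rewrite nrm_ge0.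
by rewrite ler_pM2r// lt_neqAle eq_sym J0 nrm_ge0.
Qed.

(** Once the support of the mollifier moved to [y] fits into a ball inside [A], the indicator is one
    on all of it. *)
Let J_lim y : A y -> \forall j \near \oo, J j y = 1.
Proof.
move=> Ay; have /nbhs_ballP[e /= e0 eA] := open_nbhs_nbhs (conj oA Ay).
near=> j.
have je : j.+1%:R^-1 < e by near: j; exact: near_infty_natSinv_lt (PosNum e0).
rewrite (_ : 1 = \int[mu]_x (moll j (x - y))); last first.
  by rewrite /Rintegral integral_mollifier// moll_scale_gt0.
apply: eq_Rintegral => x _; have [->|] := eqVneq (moll j (x - y)) 0; first by rewrite mulr0.
move=> /(mollifier_neq0 (moll_scale_gt0 j)) h; rewrite indicE mem_set ?mul1r//.
apply: eA; apply/ball_rVE => // i; have := h i; rewrite !mxE => /andP[h1 h2].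
by rewrite distrC ger0_norm ?(ltW h1)// (lt_trans h2).
Unshelve. all: by end_near. Qed.

Let ipJ_lim : ip (J j) (\1_A) @[j --> \oo] --> ip (\1_A) (\1_A).
Proof.
have JA2 j : sqint (fun x => J j x * \1_A x).
  apply: (le_sqint _ _ (J2 j)) => [|x]; first exact: (measurable_funM (J2 j).1 A2.1).
  by rewrite normrM ler_piMr// indicE; case: (_ \in _); rewrite ?normr1 ?normr0.
(* Multiplied by the indicator, [J j] converges everywhere: on [A] by [J_lim], and outside as the
   constant zero. *)
have h : nrm (fun x => J j x * \1_A x - \1_A x) @[j --> \oo] --> (0 : R).
  apply: (nrm_cvg0 JA2 A2 A2) => [j x|x].
    rewrite -[X in _ - X]mul1r -mulrBl normrM ler_piMl//.
    by rewrite ler_norml; have := J_ge0 j x; have := J_le1 j x; lra.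
  rewrite indicE; case: (boolP (x \in A)) => xA.
    rewrite in_setE in xA; apply: cvg_near_cst.
    by have := J_lim xA; apply: filterS => j ->; rewrite mulr1.
  by under eq_fun do rewrite mulr0; exact: cvg_cst.
apply/cvgrPdist_le => e e0.
have w1 : 0 < nrm (\1_A) + 1 by rewrite ltr_wpDl ?nrm_ge0.
have /cvgrPdist_le/(_ (e / (nrm (\1_A) + 1))) := h.
rewrite divr_gt0// => /(_ isT); apply: filterS => j.
rewrite sub0r normrN ger0_norm ?nrm_ge0// ler_pdivlMr// => hj.
have -> : ip (J j) (\1_A) = ip (fun x => J j x * \1_A x) (\1_A).
  by apply: eq_Rintegral => x _; rewrite -mulrA indicE; case: (_ \in _); rewrite ?mulr1 ?mulr0.
rewrite distrC -ipBl//.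
apply: le_trans (cauchy_schwarz (sqintB (JA2 j) A2) A2) _.
apply: le_trans hj; rewrite ler_wpM2l ?nrm_ge0//; lra.
Qed.

(** Outside [A], and on its boundary in particular, [J j] is not controlled pointwise. The bound on
    its norm makes up for this: $\|1_A - J\|^2 \le 2(\|1_A\|^2 - (J, 1_A))$, and the last scalar
    product only sees values on [A]. *)
Lemma approximable_open : approximable (\1_A).
Proof.
split => // w w2; apply/cvgrPdist_le => e e0.
have w1 : 0 < 2 * nrm w ^+ 2 + 1 by rewrite ltr_wpDl// mulr_ge0// sqr_ge0.
have /cvgrPdist_le/(_ (e ^+ 2 / (2 * nrm w ^+ 2 + 1))) := ipJ_lim.
rewrite divr_gt0 ?exprn_gt0// => /(_ isT); apply: filterS => j hj.
rewrite convJ// (ipC mu (\1_A)) -ipBr//.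
rewrite -ler_sqr ?nnegrE ?(ltW e0)//.
apply: (@le_trans _ _ ((nrm w * nrm (fun x => \1_A x - J j x)) ^+ 2)).
  by rewrite ler_sqr ?nnegrE ?mulr_ge0 ?nrm_ge0// cauchy_schwarz//; exact: sqintB.
rewrite exprMn [X in _ * X]nrm_sqr ipBl ?ipBr//; last exact: sqintB.
have hJ : ip (J j) (J j) <= ip (\1_A) (\1_A).
  by rewrite -!nrm_sqr lerXn2r ?nnegrE ?nrm_ge0//; exact: nrmJ.
rewrite ler_pdivlMr// in hj.
rewrite (ipC mu _ (J j)); set a := ip _ _ in hj hJ *; set b := ip (J j) (\1_A) in hj hJ *.
set c := ip (J j) (J j) in hJ *.
have hab : `|a - b| = a - b.
  rewrite ger0_norm//; rewrite subr_ge0 /b /a.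
  apply: le_trans (ip_le (J2 j) A2) _; rewrite -nrm_sqr expr2 ler_wpM2r ?nrm_ge0//.
rewrite hab in hj; have hb0 : 0 <= a - b by rewrite -hab.
have w0 := sqr_ge0 (nrm w); nra.
Qed.

End open_set.

Lemma ball_finite (m : nat) : (mu (ball (0 : E) m.+1%:R)%R < +oo)%E.
Proof.
have mB : measurable (ball (0 : E) m.+1%:R) by apply: open_rV_measurable; exact: ball_open.
pose I : set R := `[- m.+1%:R, m.+1%:R]%classic.
have m1 : measurable_fun setT (\1_I : R -> R) by apply: measurable_indic; exact: measurable_itv.
have := @integral_prod_rV R n (fun=> \1_I) (fun=> m.+1%:R - - m.+1%:R) (fun=> m1).
have I0 (i : 'I_n) (t : R) : 0 <= \1_I t :> R by rewrite indicE.
have Iint (i : 'I_n) : (\int[lebesgue_measure]_t (\1_I t)%:E = (m.+1%:R - - m.+1%:R)%:E)%E.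
  rewrite -(@integral_indic_shift R _ _ 0) ?lerN10//; last by rewrite ge0_cp// ler0n.
  by under [RHS]eq_integral do rewrite subr0.
move=> /(_ I0 Iint) h.
rewrite -(setIT (ball _ _)) -integral_indic//.
apply: (@le_lt_trans _ _ (\int[mu]_x (\prod_(i < n) \1_I (x ord0 i))%:E)%E); last by rewrite h ltry.
apply: ge0_le_integral => //.
- by apply/measurable_EFinP; exact: measurable_indic.
- apply/measurable_EFinP; apply: measurable_prod => i _.
  by apply: (measurableT_comp m1); exact: measurable_coord_rV.
- move=> x _; rewrite lee_fin indicE; case: (boolP (x \in _)); last first.
    by move=> _; apply: prodr_ge0 => i _; rewrite indicE.
  rewrite in_setE => /ball_rVE; rewrite ltr0n => /(_ isT) xB.
  rewrite big1// => i _; rewrite indicE mem_set// /I/= in_itv/=.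
  by have := xB i; rewrite mxE sub0r normrN ltr_norml => /andP[/ltW -> /ltW ->].
Qed.

(** Preimages of open intervals under coordinates are open. Hence a class argument that starts from
    open sets reaches all measurable sets. *)
Lemma sigma_open (A : set E) : measurable A -> <<s @open E >> A.
Proof.
apply: smallest_sub => /=; first exact: smallest_sigma_algebra.
rewrite -bigcup_seq => B [i _] [C mC <-].
have := @measurability _ _ (g_sigma_algebraType (@open E)) _ setT (fun x : E => x ord0 i) _ (RGenOpens.measurableE R).
apply=> //= _ [_ [a [b ->]] <-]; rewrite setTI; apply: sub_sigma_algebra.
apply: open_comp; last exact: interval_open.
by move=> x _; exact: coord_continuous.
Qed.

(** Dynkin's theorem, with the open sets as the class stable under intersection. Cutting by [U]
    keeps all indicators square integrable. *)
Lemma approximable_setI (U A : set E) : open U -> (mu U < +oo)%E -> measurable A ->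
  approximable (\1_(A `&` U)).
Proof.
move=> oU fU; have mU : measurable U by exact: open_rV_measurable.
have fin B : measurable B -> (mu (B `&` U) < +oo)%E.
  by move=> mB; apply: le_lt_trans fU; apply: le_measure; rewrite ?inE//; exact: measurableI.
have sq B : measurable B -> sqint (\1_(B `&` U)).
  by move=> mB; apply: indic_sqint; [exact: measurableI|exact: fin].
have U2 : sqint (\1_U) by exact: indic_sqint.
move=> mA; have := sigma_open mA.
suff /(_ A) H : <<s @open E >> `<=` [set B | measurable B /\ approximable (\1_(B `&` U))].
  by move=> /H[].
have open_app B : open B -> approximable (\1_(B `&` U)).
  move=> oB; apply: approximable_open; last by apply: fin; exact: open_rV_measurable.
  exact: openI.
apply: lambda_system_subset => //.
- by move=> B C oB oC; exact: openI.
- split => //; first by split => //; apply: open_app; exact: openT.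
  + move=> B C CB [mB HB] [mC HC]; split; first exact: measurableD.
    have -> : (\1_((B `\` C) `&` U) : E -> R) = (fun x => \1_(B `&` U) x - \1_(C `&` U) x).
      apply/funext => x; rewrite !indicE !in_setI in_setC.
      case: (boolP (x \in C)) => xC; last by rewrite subr0 andbT.
      have -> : x \in B by rewrite in_setE; apply: CB; rewrite -in_setE.
      by rewrite /= subrr.
    exact: approximableB.
  + move=> F ndF HF.
    have mF (k : nat) : measurable (F k : set E) by case: (HF k).
    pose F' : nat -> set E := F.
    have mUF : measurable (\bigcup_k F k) by exact: bigcup_measurable.
    split => //; rewrite -[\bigcup_k F k]/(\bigcup_k F' k).
    (* An increasing union is a limit in norm, by dominated convergence with majorant [\1_U]. *)
    apply: (@approximable_lim (fun k : nat => \1_(F' k `&` U))) => //.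
    * by move=> k; case: (HF k).
    * exact: sq.
    * apply: (@nrm_cvg0 _ _ _ _ _ _ (\1_U)) => //.
      - by move=> k; exact: sq.
      - exact: sq.
      - move=> k x; rewrite !indicE !in_setI.
        case: (x \in U); rewrite ?andbT ?andbF ?subrr ?normr0//.
        by case: (_ \in _); case: (_ \in _); rewrite /= ?subrr ?subr0 ?sub0r ?normrN ?normr0 ?normr1.
      - move=> x; apply: cvg_near_cst.
        have [[k _ Fkx]|nF] := pselect ((\bigcup_k F k) x).
          have Fb : (\bigcup_k F' k) x by exists k.
          exists k => // j kj; have /subsetPset/(_ x Fkx) Fj := ndF _ _ kj.
          by rewrite !indicE !in_setI (mem_set Fb) (mem_set (Fj : F' j x)).
        have nF' : x \notin \bigcup_k F' k by apply/negP; rewrite in_setE.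
        apply: nearW => k; rewrite !indicE !in_setI (negbTE nF') memNset// => Fkx.
        by apply: nF; exists k.
- by move=> B oB; split; [exact: open_rV_measurable|exact: open_app].
Qed.

Lemma approximable_sum (I : Type) (r : seq I) (h : I -> E -> R) :
  (forall i, approximable (h i)) -> approximable (fun x => \sum_(i <- r) h i x).
Proof.
move=> Hh; elim: r => [|i r IH].
  rewrite (_ : (fun x => _) = cst 0); last by apply/funext => x; rewrite big_nil.
  split; first exact: sqint0.
  move=> w w2; have z : forall f, ip (cst 0) f = 0.
    by move=> f; rewrite ipE; under eq_Rintegral do rewrite mul0r; rewrite /Rintegral integral0.
  rewrite z (_ : (fun j => _) = cst 0); first exact: cvg_cst.
  apply/funext => j; rewrite /conv_form; under eq_Rintegral do rewrite !mul0r.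
  by rewrite /Rintegral integral0.
rewrite (_ : (fun x => _) = (fun x => h i x + \sum_(i <- r) h i x)).
  exact: approximableD.
by apply/funext => x; rewrite big_cons.
Qed.

Lemma approximable_nonneg f : sqint f -> (forall x, 0 <= f x) -> approximable f.
Proof.
move=> f2 f0; have mf : measurable_fun setT (EFin \o f) by apply/measurable_EFinP; exact: f2.1.
pose g := nnsfun_approx measurableT mf.
pose U m := ball (0 : E) m.+1%:R.
have mU m : measurable (U m) by apply: open_rV_measurable; exact: ball_open.
have gf (k : nat) (x : E) : g k x <= f x.
  rewrite -lee_fin /g nnsfun_approxE; apply: le_approx => //.
  by move=> y _; rewrite lee_fin.
have g0 (k : nat) (x : E) : 0 <= g k x by exact: fun_ge0.
(* Level sets of a simple function, that of the value zero in particular, can have infinite measure.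
   Cutting by a growing ball makes their indicators square integrable. *)
have app (k : nat) : approximable (fun x => g k x * \1_(U k) x).
  rewrite (_ : (fun x => _) = (fun x => \sum_(y <- finmap.enum_fset (fset_set (range (g k)))) y * \1_(g k @^-1` [set y] `&` U k) x)).
    apply: approximable_sum => y; apply: approximableZ.
    apply: approximable_setI; [exact: ball_open|exact: ball_finite|].
    by rewrite -[X in measurable X]setTI; exact: measurable_funP.
  apply/funext => x; rewrite fimfunE fsbig_finite//= mulr_suml; apply: eq_bigr => y _.
  by rewrite -mulrA indicI.
have fU (k : nat) (x : E) : `|g k x * \1_(U k) x| <= f x.
  rewrite normrM ger0_norm//; apply: le_trans (gf k x).
  by rewrite ler_piMr// indicE; case: (_ \in _); rewrite ?normr1 ?normr0.
apply: (approximable_lim app f2); apply: (nrm_cvg0 _ f2 f2).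
- by move=> k; case: (app k).
- move=> k x; rewrite distrC !ger0_norm//.
    by rewrite gerBl mulr_ge0// indicE.
  by rewrite subr_ge0 (le_trans (ler_norm _)).
- move=> x; have : (fun k : nat => g k x) @ \oo --> f x.
    have := @cvg_nnsfun_approx _ _ _ setT measurableT (EFin \o f) mf _ x I.
    move=> /(_ (fun y _ => f0 y)) h; exact: fine_cvg h.
  apply: cvg_trans; apply: near_eq_cvg; near=> k.
  rewrite indicE mem_set ?mulr1//; apply/ball_rVE => // i.
  rewrite mxE sub0r normrN.
  apply: (@le_lt_trans _ _ `|x|); last first.
    near: k; exists (Num.truncn `|x|) => // k /= xk.
    by rewrite (lt_le_trans (truncnS_gt _))// ler_nat.
  by rewrite [leRHS]mx_normrE; apply/bigmax_geP; right => /=; exists (ord0, i).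
Unshelve. all: by end_near. Qed.

Lemma approximable_sqint f : sqint f -> approximable f.
Proof.
move=> f2; have a2 := sqint_abs f2.
rewrite (_ : f = (fun x => (2^-1 * (`|f x| + f x)) - 2^-1 * (`|f x| - f x))); last first.
  by apply/funext => x; field.
apply: approximableB; apply: approximableZ; apply: approximable_nonneg.
- exact: sqintD.
- by move=> x; have := ler_norm (- f x); rewrite normrN; lra.
- exact: sqintB.
- by move=> x; rewrite subr_ge0 ler_norm.
Qed.

End mollification.

(** * Weak derivatives in time *)

Section weak_second_derivative.
Context (R : realType).
Local Notation leb := (@lebesgue_measure R).

Lemma segment_integrable (a c : R) (F : R -> R) : {within `[a, c], continuous F} ->
  leb.-integrable `[a, c] (EFin \o F).
Proof. by move=> cF; apply: continuous_compact_integrable => //; exact: segment_compact. Qed.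

Lemma continuous_kbump_shift (K b : R) : continuous (fun t : R => kbump K (t - b)).
Proof. by apply: (@Ck_continuous _ _ 0); apply: Ck_shift; exact: smooth_kbump. Qed.

Lemma within_continuousM (A : set R) (f g : R -> R) : {within A, continuous f} ->
  {within A, continuous g} -> {within A, continuous (fun t => f t * g t)}.
Proof. by move=> cf cg t; apply: cvgM; [exact: cf|exact: cg]. Qed.

Lemma within_continuousB (A : set R) (f g : R -> R) : {within A, continuous f} ->
  {within A, continuous g} -> {within A, continuous (fun t => f t - g t)}.
Proof. by move=> cf cg t; apply: cvgB; [exact: cf|exact: cg]. Qed.

Lemma integral_kbump_segment (K a b c : R) : 0 < K -> a <= b -> b + K^-1 <= c ->
  \int[leb]_(t in `[a, c]) kbump K (t - b) = 1.
Proof.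
move=> K0 ab bc; rewrite /Rintegral (_ : (\int[leb]_(t in _) _)%E = 1%:E)//.
rewrite -(integral_kbump K0 b) [LHS]integral_mkcond.
apply: eq_integral => t _; rewrite patchE; case: ifPn => // /negP.
rewrite in_setE/= in_itv/= => h; congr EFin; apply/esym/eqP/negPn/negP => /(kbump_neq0 K0).
rewrite subr_gt0 ltrBlDl => /andP[h1 h2]; apply: h.
by rewrite (le_trans ab (ltW h1)) (le_trans (ltW h2)).
Qed.

(** The bumps lie to the right of [b] and shrink to it, so the left end [b = a] is allowed, while
    [b < c] leaves them room. *)
Lemma kbump_average (F : R -> R) (a b c : R) : a <= b -> b < c ->
  {within `[a, c], continuous F} ->
  \int[leb]_(t in `[a, c]) (kbump j.+1%:R (t - b) * F t) @[j --> \oo] --> F b.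
Proof.
move=> ab bc cF; apply/cvgrPdist_le => e e0.
have bS : `[a, c]%classic b by rewrite /= in_itv/= ab ltW.
have [d d0 Fd] : exists2 d, 0 < d & forall t, `[a, c]%classic t -> `|t - b| < d -> `|F b - F t| <= e.
  have /subspace_continuousP/(_ b bS)/cvgrPdist_le/(_ e e0) := cF.
  move=> /nbhs_ballP[d /= d0 h].
  by exists d => // t St tb; apply: h => //; rewrite /ball/= distrC.
have cd0 : 0 < c - b by rewrite subr_gt0.
near=> j.
have jd : j.+1%:R^-1 < d by near: j; exact: near_infty_natSinv_lt (PosNum d0).
have jc : j.+1%:R^-1 < c - b by near: j; exact: near_infty_natSinv_lt (PosNum cd0).
have K0 : 0 < j.+1%:R :> R by rewrite ltr0n.
have one := @integral_kbump_segment j.+1%:R a b c K0 ab.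
rewrite -lerBrDl (ltW jc) in one; have {}one := one isT.
have ck : {within `[a, c], continuous (fun t => kbump j.+1%:R (t - b))}.
  by apply: continuous_subspaceT; exact: continuous_kbump_shift.
have ikF := segment_integrable (within_continuousM ck cF).
have ik := segment_integrable ck.
have ikb : leb.-integrable `[a, c] (EFin \o (fun t => kbump j.+1%:R (t - b) * F b)).
  apply: segment_integrable; apply: within_continuousM => //.
  by apply: continuous_subspaceT; exact: cst_continuous.
have -> : F b = \int[leb]_(t in `[a, c]) (kbump j.+1%:R (t - b) * F b).
  by rewrite RintegralZr// one mul1r.
rewrite -RintegralB//.
have idf : leb.-integrable `[a, c]
    (EFin \o (fun t => kbump j.+1%:R (t - b) * F b - kbump j.+1%:R (t - b) * F t)).
  apply: segment_integrable; apply: within_continuousB; apply: within_continuousM => //.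
  by apply: continuous_subspaceT; exact: cst_continuous.
apply: le_trans (le_normr_Rintegral _ idf) _ => //.
apply: (@le_trans _ _ (\int[leb]_(t in `[a, c]) (kbump j.+1%:R (t - b) * e))); last first.
  by rewrite RintegralZr// one mul1r.
apply: le_Rintegral => //.
- exact: integrable_norm idf.
- apply: segment_integrable; apply: within_continuousM => //.
  by apply: continuous_subspaceT; exact: cst_continuous.
move=> t St; rewrite -mulrBr normrM ger0_norm ?kbump_ge0//.
have [->|/(kbump_neq0 K0)/andP[h1 h2]] := eqVneq (kbump j.+1%:R (t - b)) 0.
  by rewrite !mul0r.
rewrite ler_wpM2l ?kbump_ge0//; apply: Fd => //.
by rewrite ger0_norm ?(ltW h1)// (lt_trans h2).
Unshelve. all: by end_near. Qed.

Lemma FTC_pos (F f : R -> R) (a c : R) : 0 < a -> a < c -> {within `[a, c], continuous f} ->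
  (forall t : R, 0 < t -> is_derive t 1 F (f t)) ->
  \int[leb]_(t in `[a, c]) f t = F c - F a.
Proof.
move=> a0 ac cf dF; rewrite /Rintegral (@continuous_FTC2 _ f F) ?EFinB//.
- have cF (t : R) : 0 < t -> F @ t --> F t.
    by move=> t0; apply/differentiable_continuous/derivable1_diffP; have [] := dF t t0.
  split.
  + move=> t; rewrite in_itv/= => /andP[at_ _].
    by have [] := dF t (lt_trans a0 at_).
  + by apply: cvg_at_right_filter; exact: cF.
  + by apply: cvg_at_left_filter; apply: cF; exact: lt_trans ac.
- move=> t; rewrite in_itv/= => /andP[at_ _]; rewrite derive1E.
  by have [] := dF t (lt_trans a0 at_).
Qed.

Section increment.
Variables (g G h : R -> R).
Hypothesis dg : forall t : R, 0 < t -> is_derive t 1 g (G t).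
Hypothesis cG : forall t, 0 < t -> {for t, continuous G}.
Hypothesis ch : forall t, 0 < t -> {for t, continuous h}.
Hypothesis weak : forall (kappa : R -> R) (a c : R), smooth kappa -> 0 < a -> a < c ->
  (forall t, kappa t != 0 -> a < t < c) ->
  \int[leb]_(t in `[a, c]) ('D_1 (fun s => 'D_1 kappa s) t * g t - kappa t * h t) = 0.

(** The weak equation is tested with a smoothed indicator of the interval from [a] to [b]. The
    smoothing at [b] reaches beyond [b], hence the margin up to [b']. *)
Lemma weak_increment (a b b' k eta : R) : 0 < a -> a < b -> b < b' ->
  (forall s, a <= s <= b' -> `|h s - k| <= eta) ->
  `|G b - G a - (b - a) * k| <= (b - a) * eta.
Proof.
move=> a0 ab bb' hk.
pose c := b'.
have ac : a < c by exact: lt_trans bb'.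
have pos t : `[a, c]%classic t -> 0 < t.
  by rewrite /= in_itv/= => /andP[at_ _]; exact: lt_le_trans at_.
have cGS : {within `[a, c], continuous G}.
  apply/continuous_in_subspaceT => t; rewrite inE => /pos; exact: cG.
have chS : {within `[a, c], continuous h}.
  apply/continuous_in_subspaceT => t; rewrite inE => /pos; exact: ch.
have cidS : {within `[a, c], continuous (fun t : R => t)}.
  by apply: continuous_subspaceT => t; exact: cvg_id.
(* The average of [F] just after [b] minus its average just after [a], a smooth substitute for the
   increment of [F]. *)
pose A F j := \int[leb]_(t in `[a, c]) (kbump j.+1%:R (t - b) * F t)
  - \int[leb]_(t in `[a, c]) (kbump j.+1%:R (t - a) * F t).
have Alim F : {within `[a, c], continuous F} -> A F j @[j --> \oo] --> F b - F a.
  by move=> cF; apply: cvgB; apply: kbump_average => //; exact: ltW.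
have H : \forall j \near \oo, `|A G j - k * A (fun t => t) j| <= eta * A (fun t => t) j.
  have bb0 : 0 < b' - b by rewrite subr_gt0.
  have ab0 : 0 < b - a by rewrite subr_gt0.
  near=> j.
  have j1 : j.+1%:R^-1 < b' - b by near: j; exact: near_infty_natSinv_lt (PosNum bb0).
  (* The step at [a] is complete before that at [b] starts, which makes [kap] nonnegative. The
     condition [j1] keeps its support before [b']. *)
  have j2 : j.+1%:R^-1 < b - a by near: j; exact: near_infty_natSinv_lt (PosNum ab0).
  have K0 : 0 < j.+1%:R :> R by rewrite ltr0n.
  set K := j.+1%:R in j1 j2 K0 *.
  pose kap t := kstep K (t - a) - kstep K (t - b).
  pose bet t := kbump K (t - a) - kbump K (t - b).
  have skap : smooth kap.
    move=> i; apply: CkD; last apply: CkN.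
      by apply: Ck_shift; exact: smooth_kstep.
    by apply: Ck_shift; exact: smooth_kstep.
  have sbet : smooth bet.
    move=> i; apply: CkD; last apply: CkN.
      by apply: Ck_shift; exact: smooth_kbump.
    by apply: Ck_shift; exact: smooth_kbump.
  have dkap (t : R) : is_derive t 1 kap (bet t).
    exact: is_deriveB (is_derive_kstep K t a) (is_derive_kstep K t b).
  have kapE : (fun s => 'D_1 kap s) = bet by apply/funext => t; have [] := dkap t.
  have supp t : kap t != 0 -> a < t < c.
    move=> kt; rewrite !ltNge -negb_or; apply: contra kt => /orP[ta|ct]; rewrite /kap.
      by rewrite !kstep_le0 ?subrr// subr_le0// (le_trans ta)// ltW.
    rewrite !kstep_ge1 ?subrr//; rewrite lerBrDl (le_trans _ ct)//.
      by rewrite -lerBrDl ltW.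
    by rewrite -lerBrDl (le_trans (ltW j2))// lerD2r ltW.
  have kap0 t : 0 <= kap t.
    rewrite /kap; have [tb|bt] := leP t b.
      by rewrite (@kstep_le0 _ K K0 (t - b)) ?subr_le0// subr0 step_ge0.
    rewrite (@kstep_ge1 _ K K0 (t - a)) ?subr_ge0 ?step_le1//.
    by rewrite (le_trans (ltW j2))// lerD2r ltW.
  have bet0 t : t <= a \/ c <= t -> bet t = 0.
    move=> ht; rewrite /bet; apply/eqP; rewrite subr_eq0; apply/eqP.
    have z u : ~ 0 < u < K^-1 -> kbump K u = 0.
      by move=> hu; apply/eqP/negPn/negP => /(kbump_neq0 K0).
    have z2 x : ~ 0 < t - x < K^-1 -> kbump K (t - x) = 0 by exact: z.
    rewrite /c in ht.
    by rewrite !z2// => /andP[h1 h2]; move: (K^-1) j1 j2 h2 => d j1 j2 h2; case: ht => ht; lra.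
  have w := weak skap a0 ac supp; rewrite kapE in w.
  have cw (f : R -> R) : smooth f -> {within `[a, c], continuous f}.
    by move=> sf; apply: continuous_subspaceT; exact: smooth_continuous.
  have sgam : smooth (fun t => 'D_1 bet t) by exact: smooth_derive.
  have cg : {within `[a, c], continuous g}.
    apply/continuous_in_subspaceT => t; rewrite inE => /pos t0.
    by apply/differentiable_continuous/derivable1_diffP; have [] := dg t0.
  have igam := segment_integrable (within_continuousM (cw _ sgam) cg).
  have ikh := segment_integrable (within_continuousM (cw _ skap) chS).
  have ik := segment_integrable (cw _ skap).
  have ibG := segment_integrable (within_continuousM (cw _ sbet) cGS).
  have ibt := segment_integrable (within_continuousM (cw _ sbet) cidS).
  rewrite RintegralB// in w.
  have AE F : {within `[a, c], continuous F} ->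
      A F j = - \int[leb]_(t in `[a, c]) (bet t * F t).
    move=> cF.
    have ck x : {within `[a, c], continuous (fun t => kbump K (t - x))}.
      by apply: continuous_subspaceT; exact: continuous_kbump_shift.
    have i1 := segment_integrable (within_continuousM (ck a) cF).
    have i2 := segment_integrable (within_continuousM (ck b) cF).
    rewrite /A -/K; under [in RHS]eq_Rintegral do rewrite mulrBl.
    by rewrite RintegralB// opprB.
  (* The derivative of [bet * g] integrates to zero, since [bet] vanishes at both ends. Together
     with the weak equation this replaces the second derivative of [kap]. *)
  have E1 : A G j = \int[leb]_(t in `[a, c]) (kap t * h t).
    rewrite AE//.
    have := @FTC_pos (fun t => bet t * g t) (fun t => 'D_1 bet t * g t + bet t * G t) a c a0 ac.
    have -> : bet c = 0 by apply: bet0; right.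
    have -> : bet a = 0 by apply: bet0; left.
    rewrite !mul0r subrr RintegralD// => F0.
    have {}F0 : \int[leb]_(t in `[a, c]) ('D_1 bet t * g t) + \int[leb]_(t in `[a, c]) (bet t * G t) = 0.
      apply: F0.
        by move=> t; apply: cvgD; [exact: (within_continuousM (cw _ sgam) cg)|exact: (within_continuousM (cw _ sbet) cGS)].
      move=> t t0; have db : is_derive t 1 bet ('D_1 bet t).
        by apply: derivableP; exact: smooth_derivable.
      apply: is_derive_eq (is_deriveM db (dg t0)) _.
      by rewrite /GRing.scale/= addrC mulrC.
    lra.
  (* The same with [kap * t]: the mass of [kap] is the smoothed increment of the identity, which
     tends to [b - a]. *)
  have E2 : A (fun t => t) j = \int[leb]_(t in `[a, c]) kap t.
    rewrite AE//.
    have := @FTC_pos (fun t => kap t * t) (fun t => bet t * t + kap t) a c a0 ac.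
    have -> : kap c = 0 by apply/eqP/negPn/negP => /supp; rewrite ltxx andbF.
    have -> : kap a = 0 by apply/eqP/negPn/negP => /supp; rewrite ltxx.
    rewrite !mul0r subrr RintegralD// => F0.
    have {}F0 : \int[leb]_(t in `[a, c]) (bet t * t) + \int[leb]_(t in `[a, c]) (kap t) = 0.
      apply: F0.
        by move=> t; apply: cvgD; [exact: (within_continuousM (cw _ sbet) cidS)|exact: (cw _ skap)].
      move=> t t0; apply: is_derive_eq (is_deriveM (dkap t) (is_derive_id t 1)) _.
      by rewrite /GRing.scale/= mulr1 addrC mulrC.
    lra.
  rewrite E1 E2 -!RintegralZl//.
  have ikk : leb.-integrable `[a, c] (EFin \o (fun t => k * kap t)).
    by apply: segment_integrable; apply: within_continuousM (cw _ skap);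
      apply: continuous_subspaceT; exact: cst_continuous.
  have ike : leb.-integrable `[a, c] (EFin \o (fun t => eta * kap t)).
    by apply: segment_integrable; apply: within_continuousM (cw _ skap);
      apply: continuous_subspaceT; exact: cst_continuous.
  rewrite -RintegralB//.
  have idf : leb.-integrable `[a, c] (EFin \o (fun t => kap t * h t - k * kap t)).
    apply: segment_integrable; apply: within_continuousB; apply: within_continuousM => //; try exact: cw.
    by apply: continuous_subspaceT; exact: cst_continuous.
  apply: le_trans (le_normr_Rintegral _ idf) _ => //.
  apply: le_Rintegral => //; first exact: integrable_norm idf.
  move=> t; rewrite /= in_itv/= => Sct.
  rewrite (mulrC k) -mulrBr normrM (ger0_norm (kap0 t)) mulrC ler_wpM2r//.
  exact: hk.
have L : (fun j => `|A G j - k * A (fun t => t) j|) @ \oo --> `|(G b - G a) - k * (b - a)|.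
  apply: cvg_norm; apply: cvgB; first exact: Alim.
  by apply: cvgM; [exact: cvg_cst|exact: Alim].
have M : (fun j => eta * A (fun t => t) j) @ \oo --> eta * (b - a).
  by apply: cvgM; [exact: cvg_cst|exact: Alim].
rewrite mulrC (mulrC _ eta).
exact: (ler_cvg_to L M H).
Unshelve. all: by end_near. Qed.

End increment.

End weak_second_derivative.

(* The crude bound [C * w] on the increments shows that [g] is differentiable with
   derivative [k]; the mean value theorem then replaces it by the oscillation of [k]. *)
Section increment_refinement.
Context (R : realType) (d : R -> R -> R) (g k : R -> R) (C C' : R).
Hypotheses (C0 : 0 <= C) (C'0 : 0 <= C').
Hypothesis dtri : forall r s t, 0 <= r -> 0 <= s -> 0 <= t -> d r s <= d r t + d s t.
Hypothesis dcont : forall t e, 0 <= t -> 0 < e -> exists2 del, 0 < del &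
  forall s, 0 <= s -> `|s - t| < del -> d s t <= e.
Hypothesis kLip : forall s t, 0 <= s -> 0 <= t -> `|k s - k t| <= C' * d s t.
Hypothesis gcont : forall t e, 0 <= t -> 0 < e -> exists2 del, 0 < del &
  forall s, 0 <= s -> `|s - t| < del -> `|g s - g t| <= e.
Hypothesis incr : forall a b b' w, 0 < a -> a < b -> b < b' ->
  (forall s, a <= s <= b' -> d s a <= w) ->
  `|g b - g a - (b - a) * k a| <= (b - a) * (C * w).

Lemma increment_is_derive (t : R) : 0 < t -> is_derive t 1 g (k t).
Proof.
move=> t0.
suff cv : h^-1 *: ((g \o shift t) (h *: 1) - g t) @[h --> 0^'] --> k t.
  by apply: DeriveDef; [apply/cvg_ex; exists (k t)|exact: (cvg_lim _ cv)].
apply/cvgrPdist_le => e e0.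
(* For negative [h] the increment starts at [h + t]. There the triangle inequality doubles the
   oscillation, which gives [2 * C], and replacing [k (h + t)] by [k t] costs [C']. *)
have D0 : 0 < 2 * C + C' + 1 by rewrite ltr_wpDl// addr_ge0// mulr_ge0.
pose e1 := e / (2 * C + C' + 1).
have e10 : 0 < e1 by rewrite divr_gt0.
have [del del0 hd] := dcont (ltW t0) e10.
have ee : e1 * (2 * C + C' + 1) = e by rewrite divfK// gt_eqF.
near=> h.
have h0 : h != 0 by near: h; exact: nbhs_dnbhs_neq.
have hdel : `|h| < del / 2 by near: h; apply: dnbhs0_lt; rewrite divr_gt0.
have ht : `|h| < t / 2 by near: h; apply: dnbhs0_lt; rewrite divr_gt0.
rewrite /= /GRing.scale/= mulr1.
rewrite -(ler_pM2l (_ : 0 < `|h|)) ?normr_gt0// -normrM mulrBr mulVKf//.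
have [hp|hn|hz] := ltgtP h 0; last by rewrite hz eqxx in h0.
- have hN : `|h| = - h by rewrite ltr0_norm.
  rewrite hN in hdel ht *.
  have near_t s : h + t <= s <= t - h -> d s t <= e1.
    by move=> /andP[s1 s2]; apply: hd; [lra|rewrite ltr_norml; apply/andP; split; lra].
  have H1 : `|g t - g (h + t) - (t - (h + t)) * k (h + t)| <= (t - (h + t)) * (C * (2 * e1)).
    apply: (incr (b' := t - h)); [lra|lra|lra|].
    move=> s sh; have h1 := near_t s sh; have h2 : d (h + t) t <= e1 by apply: near_t; lra.
    have /andP[s1 s2] := sh.
    have : d s (h + t) <= d s t + d (h + t) t by apply: dtri; lra.
    lra.
  have H2 : `|k (h + t) - k t| <= C' * e1.
    apply: (le_trans (kLip _ _)); [lra|lra|].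
    by rewrite ler_wpM2l// near_t//; lra.
  have E1 : h * k t - (g (h + t) - g t) =
      (g t - g (h + t) - (t - (h + t)) * k (h + t)) - h * (k (h + t) - k t) by ring.
  rewrite E1; apply: le_trans (ler_normB _ _) _.
  rewrite normrM hN.
  have H3 : - h * `|k (h + t) - k t| <= - h * (C' * e1) by rewrite ler_wpM2l// oppr_ge0 ltW.
  have -> : - h * e = - h * (e1 * (2 * C + C' + 1)) by rewrite ee.
  have : 0 <= - h * e1 by rewrite mulr_ge0 ?oppr_ge0// ltW.
  move: H1 H3; rewrite (_ : t - (h + t) = - h); last ring.
  nra.
- have hN : `|h| = h by rewrite gtr0_norm.
  rewrite hN in hdel ht *.
  have H1 : `|g (h + t) - g t - (h + t - t) * k t| <= (h + t - t) * (C * e1).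
    apply: (incr (b' := t + 2 * h)); [lra|lra|lra|].
    by move=> s /andP[s1 s2]; apply: hd; [lra|rewrite ltr_norml; apply/andP; split; lra].
  have E1 : h * k t - (g (h + t) - g t) = - (g (h + t) - g t - (h + t - t) * k t) by ring.
  rewrite E1 normrN; apply: le_trans H1 _; rewrite addrK ler_wpM2l ?(ltW hn)// -ee.
  have := mulr_ge0 C0 (ltW e10); have := mulr_ge0 C'0 (ltW e10); lra.
Unshelve. all: by end_near. Qed.

Lemma increment_refine a b eta : 0 <= a -> a < b ->
  (forall s, a <= s <= b -> `|k s - k a| <= eta) ->
  `|g b - g a - (b - a) * k a| <= (b - a) * eta.
Proof.
move=> a0 ab hk.
have cg : {within `[a, b], continuous g}.
  apply/subspace_continuousP => t; rewrite /= in_itv/= => /andP[at_ tb].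
  apply/cvgrPdist_le => e e0; have [del del0 hd] := gcont (le_trans a0 at_) e0.
  apply/nbhs_ballP; exists del => //= s ts; rewrite in_itv/= => /andP[as_ sb].
  rewrite distrC; apply: hd; first exact: le_trans as_.
  by rewrite distrC.
(* At [a = 0] only the continuity of [g] is available. The mean value theorem asks for derivatives
   in the open interval alone, so this end is covered. *)
have [c /[!in_itv]/= /andP[ac cb] ->] := @MVT R g k a b ab
  (fun x xab => increment_is_derive (le_lt_trans a0 (proj1 (andP xab)))) cg.
rewrite mulrC -mulrBr normrM gtr0_norm ?subr_gt0// ler_pM2l ?subr_gt0//.
by apply: hk; rewrite !ltW.
Qed.

End increment_refinement.

(** * Weak partial derivatives *)

Section weak_partials.
Context (R : realType) (n : nat).
Local Notation E := 'rV[R]_n.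
Local Notation mu := (@lebesgue_rV R n).
Local Notation sqint := (sqint mu).
Local Notation ip := (ip mu).
Local Notation nrm := (nrm mu).
Implicit Types (f g w : E -> R).

(** Translates of mollifiers are test functions, so the mollified form of [f] with itself is zero at
    every scale; its limit is the squared norm. *)
Lemma fundamental_lemma f : sqint f ->
  (forall phi : E -> R, test_function setT phi -> \int[mu]_x (f x * phi x) = 0) -> nrm f = 0.
Proof.
move=> f2 f0; apply/eqP; rewrite sqrtr_eq0 le_eqVlt; apply/orP; left; apply/eqP.
have h := (approximable_sqint f2).2 f f2.
have z j : conv_form (moll j) f f = 0.
  have [M M0 kM] := box_kernel_bound (@moll_kernel R n j).
  rewrite (conv_formEr (@measurable_moll R n j) kM M0 f2 f2).
  rewrite (_ : (fun y => _) = cst 0); first by rewrite /Rintegral integral0.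
  by apply/funext => y; rewrite ipE f0 ?mulr0//; apply: test_subr; exact: moll_kernel.
have : (fun j => conv_form (moll j) f f) @ \oo --> (0 : R).
  by under eq_fun do rewrite z; exact: cvg_cst.
exact: cvg_unique h.
Qed.

Lemma L2P f : L2 f <-> sqint f.
Proof. exact: sqintP. Qed.

Lemma L2normE f : sqint f -> L2norm f = nrm f.
Proof. exact: Lnorm2E. Qed.

Lemma test_sqint (phi : E -> R) : test_function setT phi -> sqint phi.
Proof.
move=> [sphi cphi _].
have [M M0 bM] := bounded_support (smooth_continuous sphi) cphi
  (fun x h => @subset_closure _ _ x h).
have [N [_ NB]] := compact_bounded cphi.
pose m := Num.truncn `|N + 1|.
have mB : measurable (ball (0 : E) m.+1%:R) by apply: open_rV_measurable; exact: ball_open.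
have i2 : sqint (\1_(ball (0 : E) m.+1%:R)) by apply: indic_sqint => //; exact: ball_finite.
apply: (le_sqint _ _ (sqintZ M i2)).
  by apply: continuous_rV_measurable; exact: smooth_continuous.
move=> x; rewrite normrM (ger0_norm M0).
have [->|px] := eqVneq (phi x) 0; first by rewrite normr0 mulr_ge0.
rewrite indicE mem_set ?normr1 ?mulr1//.
apply/ball_rVE => // i; rewrite mxE sub0r normrN.
have xN : `|x| <= N + 1 by apply: (NB (N + 1)); [rewrite ltrDl|exact: subset_closure].
apply: (@le_lt_trans _ _ `|x|).
  by rewrite [leRHS]mx_normrE; apply/bigmax_geP; right => /=; exists (ord0, i).
rewrite (le_lt_trans xN)// (le_lt_trans (ler_norm _))// truncnS_gt//.
Qed.

Lemma weak_partial_unique i f g g' : sqint g -> sqint g' ->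
  is_weak_partial i f g -> is_weak_partial i f g' -> nrm (fun x => g x - g' x) = 0.
Proof.
move=> g2 g2' fg fg'; apply: fundamental_lemma; first exact: sqintB.
move=> phi tphi; have p2 := test_sqint tphi.
rewrite -[LHS]/(ip (fun x => g x - g' x) phi) ipBl//; apply/eqP; rewrite subr_eq0; apply/eqP.
apply: oppr_inj; rewrite -[LHS](fg _ tphi) -[RHS](fg' _ tphi).
by [].
Qed.

Definition pd i f := weak_partial i f.

Lemma pdP i f : H1 f -> sqint (pd i f) /\ is_weak_partial i f (pd i f).
Proof.
move=> [_ /(_ i)[g Lg fg]]; rewrite /pd /weak_partial.
by have [/L2P] := xgetPex (cst 0) (ex_intro (fun g => L2 g /\ is_weak_partial i f g) g (conj Lg fg)).
Qed.

Lemma H1_sqint f : H1 f -> sqint f. Proof. by move=> [/L2P]. Qed.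

Lemma test_derive (phi : E -> R) v : test_function setT phi ->
  test_function setT (fun x => 'D_v phi x).
Proof.
move=> [sphi cphi _]; apply: (test_functionP (smooth_derive v sphi) cphi) => //.
apply: derive_support cphi _ => x px; exact: subset_closure.
Qed.

Lemma is_weak_partial_lin i (a : R) f g f' g' : sqint f -> sqint f' -> sqint g -> sqint g' ->
  is_weak_partial i f f' -> is_weak_partial i g g' ->
  is_weak_partial i (fun x => f x + a * g x) (fun x => f' x + a * g' x).
Proof.
move=> f2 f2' g2 g2' ff gg phi tphi.
have dp2 := test_sqint (test_derive (basis_vec R i) tphi); have p2 := test_sqint tphi.
rewrite -[LHS]/(ip (fun x => f x + a * g x) (fun x => 'D_(basis_vec R i) phi x)).
rewrite -[X in - X]/(ip (fun x => f' x + a * g' x) phi).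
have ag2 := sqintZ a g2; have ag2' := sqintZ a g2'.
rewrite !ipDl// !ipZl// opprD -mulrN; congr (_ + _ * _); [exact: ff|exact: gg].
Qed.

Lemma H1_lin (a : R) f g : H1 f -> H1 g -> H1 (fun x => f x + a * g x).
Proof.
move=> Hf Hg; have [f2 g2] := (H1_sqint Hf, H1_sqint Hg); split.
  by apply/L2P/sqintD => //; exact: sqintZ.
move=> i; have [f2' ff] := pdP i Hf; have [g2' gg] := pdP i Hg.
exists (fun x => pd i f x + a * pd i g x).
  by apply/L2P/sqintD => //; exact: sqintZ.
exact: is_weak_partial_lin.
Qed.

(** [pd] is a chosen representative, so it is linear only up to a null set. Both sides are weak
    derivatives of one function, hence at distance zero. *)
Lemma pd_lin i (a : R) f g : H1 f -> H1 g ->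
  nrm (fun x => pd i (fun x => f x + a * g x) x - (pd i f x + a * pd i g x)) = 0.
Proof.
move=> Hf Hg; have [f2 g2] := (H1_sqint Hf, H1_sqint Hg).
have [f2' ff] := pdP i Hf; have [g2' gg] := pdP i Hg.
have [h2 hh] := pdP i (H1_lin a Hf Hg).
apply: (weak_partial_unique h2 _ hh); first by apply: sqintD => //; exact: sqintZ.
exact: is_weak_partial_lin.
Qed.

Lemma ip_pd_lin i (a : R) f g w : H1 f -> H1 g -> sqint w ->
  ip (pd i (fun x => f x + a * g x)) w = ip (pd i f) w + a * ip (pd i g) w.
Proof.
move=> Hf Hg w2; have [f2' _] := pdP i Hf; have [g2' _] := pdP i Hg.
have ag2 := sqintZ a g2'.
rewrite (eq_ip (pdP i (H1_lin a Hf Hg)).1 (sqintD f2' ag2) w2 (pd_lin i a Hf Hg)).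
by rewrite ipDl// ipZl.
Qed.

Lemma nrm_le_H1norm f : H1 f -> nrm f <= H1norm f.
Proof.
move=> Hf; rewrite -L2normE; last exact: H1_sqint.
rewrite -ler_sqr ?nnegrE ?sqrtr_ge0//; last by rewrite L2normE ?nrm_ge0//; exact: H1_sqint.
have s0 : 0 <= \sum_(i < n) L2norm (weak_partial i f) ^+ 2 by apply: sumr_ge0 => i _; rewrite sqr_ge0.
by rewrite sqr_sqrtr ?lerDl// addr_ge0// sqr_ge0.
Qed.

Lemma pd_le_H1norm i f : H1 f -> nrm (pd i f) <= H1norm f.
Proof.
move=> Hf; have [p2 _] := pdP i Hf; rewrite -L2normE//.
rewrite -ler_sqr ?nnegrE ?sqrtr_ge0//; last by rewrite L2normE ?nrm_ge0.
rewrite sqr_sqrtr; last by rewrite addr_ge0 ?sqr_ge0//; apply: sumr_ge0 => j _; rewrite sqr_ge0.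
rewrite (bigD1 i)//= addrCA lerDl addr_ge0 ?sqr_ge0//.
by apply: sumr_ge0 => j _; rewrite sqr_ge0.
Qed.

Lemma nrm_triangle0 f g : sqint f -> sqint g -> nrm (fun x => f x - g x) = 0 -> nrm g <= nrm f.
Proof.
move=> f2 g2 h; rewrite (_ : g = (fun x => f x - (f x - g x))); last first.
  by apply/funext => x; ring.
by apply: le_trans (nrmB f2 (sqintB f2 g2)) _; rewrite h addr0.
Qed.

Lemma pdB_le_H1norm i f g : H1 f -> H1 g ->
  nrm (fun x => pd i f x - pd i g x) <= H1norm (fun x => f x - g x).
Proof.
move=> Hf Hg.
have E : (fun x => f x - g x) = (fun x => f x + (-1) * g x) by apply/funext => x; rewrite mulN1r.
have E' : (fun x => pd i f x - pd i g x) = (fun x => pd i f x + (-1) * pd i g x).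
  by apply/funext => x; rewrite mulN1r.
rewrite E E'; have Hfg := H1_lin (-1) Hf Hg.
apply: le_trans (pd_le_H1norm i Hfg).
have [f2' _] := pdP i Hf; have [g2' _] := pdP i Hg.
apply: nrm_triangle0 (pd_lin i (-1) Hf Hg); first exact: (pdP i Hfg).1.
by apply: sqintD => //; exact: sqintZ.
Qed.

Lemma H1B f g : H1 f -> H1 g -> H1 (fun x => f x - g x).
Proof.
move=> Hf Hg; rewrite (_ : (fun x => _) = (fun x => f x + (-1) * g x)); first exact: H1_lin.
by apply/funext => x; rewrite mulN1r.
Qed.

End weak_partials.

(** * The wave equation *)

Section integrable_sum.
Context d (T : measurableType d) (R : realType) (mu : {measure set T -> \bar R}).
Implicit Types f g : T -> R.

Lemma integrable_addr f g : mu.-integrable setT (EFin \o f) -> mu.-integrable setT (EFin \o g) ->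
  mu.-integrable setT (EFin \o (fun x => f x + g x)).
Proof. by move=> f1 g1; exact: (integrableD measurableT f1 g1). Qed.

Lemma integrable_scaler a f : mu.-integrable setT (EFin \o f) ->
  mu.-integrable setT (EFin \o (fun x => a * f x)).
Proof. by move=> f1; exact: (integrableZl measurableT a f1). Qed.

Lemma integrable_sumr I (r : seq I) (F : I -> T -> R) :
  (forall i, mu.-integrable setT (EFin \o F i)) ->
  mu.-integrable setT (EFin \o (fun x => \sum_(i <- r) F i x)) /\
  \int[mu]_x \sum_(i <- r) F i x = \sum_(i <- r) \int[mu]_x F i x.
Proof.
move=> F1; elim: r => [|i r [IHi IHE]].
  under [X in EFin \o X]eq_fun do rewrite big_nil.
  under eq_Rintegral do rewrite big_nil.
  by rewrite big_nil /Rintegral integral0; split => //; exact: integrable0.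
under [X in EFin \o X]eq_fun do rewrite big_cons.
under eq_Rintegral do rewrite big_cons.
by rewrite big_cons -IHE RintegralD//; split => //; exact: integrable_addr.
Qed.

End integrable_sum.

Section square_integrable_sum.
Context d (T : measurableType d) (R : realType) (mu : {measure set T -> \bar R}) (I : Type).
Implicit Types (r : seq I) (F : I -> T -> R).

Lemma sqint_sum r F : (forall i, sqint mu (F i)) -> sqint mu (fun x => \sum_(i <- r) F i x).
Proof.
move=> F2; elim: r => [|i r IH].
  by under eq_fun do rewrite big_nil; exact: sqint0.
by under eq_fun do rewrite big_cons; exact: sqintD.
Qed.

Lemma ip_sumr r F f : (forall i, sqint mu (F i)) -> sqint mu f ->
  ip mu f (fun x => \sum_(i <- r) F i x) = \sum_(i <- r) ip mu f (F i).
Proof.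
move=> F2 f2; elim: r => [|i r IH].
  rewrite big_nil /ip; under eq_Rintegral do rewrite big_nil mulr0.
  by rewrite /Rintegral integral0.
rewrite big_cons -IH -(ipDr (F2 i) (sqint_sum r F2) f2).
by apply: eq_Rintegral => x _; rewrite big_cons.
Qed.

End square_integrable_sum.

Section tensor_test.
Context (R : realType) (n : nat).
Local Notation E := 'rV[R]_n.
Local Notation ST := (spacetime R n).
Implicit Types (kappa : R -> R) (phi : E -> R) (z : ST).

Let fstC : continuous (fst : ST -> R). Proof. by move=> z; exact: cvg_fst. Qed.
Let sndC : continuous (snd : ST -> E). Proof. by move=> z; exact: cvg_snd. Qed.

Definition tensor kappa phi : ST -> R := fun z => kappa z.1 * phi z.2.

Lemma smooth_tensor kappa phi : smooth kappa -> smooth phi -> smooth (tensor kappa phi).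
Proof.
move=> sk sp k; apply: CkM.
  exact: (@Ck_affine _ ST _ fst fst fstC _ k kappa (sk k)).
exact: (@Ck_affine _ ST _ snd snd sndC _ k phi (sp k)).
Qed.

Lemma derive_tensor kappa phi (v z : ST) : smooth kappa -> smooth phi ->
  'D_v (tensor kappa phi) z = kappa z.1 * 'D_(v.2) phi z.2 + 'D_(v.1) kappa z.1 * phi z.2.
Proof.
move=> sk sp.
have [d1 e1] := @derive_affine _ ST _ fst fst (fun _ _ _ => erefl) kappa z v.
have [d2 e2] := @derive_affine _ ST _ snd snd (fun _ _ _ => erefl) phi z v.
have := deriveM (d1 (smooth_derivable sk)) (d2 (smooth_derivable sp)).
by rewrite e1 e2 => ->; rewrite /GRing.scale/= [X in _ + X]mulrC.
Qed.

Lemma dt_tensor kappa phi : smooth kappa -> smooth phi ->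
  dt (tensor kappa phi) = tensor (fun t => 'D_1 kappa t) phi.
Proof.
by move=> sk sp; apply/funext => z; rewrite /dt derive_tensor//= derive0 mulr0 add0r.
Qed.

Lemma dx_tensor i kappa phi : smooth kappa -> smooth phi ->
  dx i (tensor kappa phi) = tensor kappa (fun x => 'D_(basis_vec R i) phi x).
Proof.
by move=> sk sp; apply/funext => z; rewrite /dx derive_tensor//= derive0 mul0r addr0.
Qed.

Lemma test_tensor kappa phi (a c : R) : smooth kappa -> 0 < a ->
  (forall t, kappa t != 0 -> a < t < c) -> test_function setT phi ->
  test_function [set z : ST | 0 < z.1] (tensor kappa phi).
Proof.
move=> sk a0 kac [sp cp _].
apply: (@test_functionP _ ST _ (`[a, c]%classic `*` support_of phi)).
- exact: smooth_tensor.
- by apply: compact_setX => //; exact: segment_compact.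
- move=> z; rewrite /tensor mulf_eq0 negb_or => /andP[/kac/andP[h1 h2] pz].
  by split; [rewrite /= in_itv/= !ltW|exact: subset_closure].
- by move=> z [/= + _]; rewrite in_itv/= => /andP[az _]; exact: lt_le_trans az.
Qed.

End tensor_test.

Section segment_induction.
Context (R : realType).

(** The supremum of the times where [P] holds is attained and cannot lie before [T]. Only intervals
    that contain [t] are tested, so the radius [del] may depend on [t]. *)
Lemma segment_induction (P : R -> Prop) (T : R) : P 0 ->
  (forall t, 0 <= t <= T -> exists2 del, 0 < del &
    forall a b, 0 <= a <= t -> t <= b <= T -> a < b -> b - a < del -> P a -> P b) ->
  0 <= T -> P T.
Proof.
move=> P0 step T0; pose S := [set t | 0 <= t <= T /\ P t].
have S0 : S 0 by split; rewrite ?lexx.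
have supS : has_sup S by split; [exists 0|exists T => t [/andP[]]].
have ubS := ub_le_sup supS.2.
have s0 : 0 <= sup S by exact: ubS.
have sT : sup S <= T by apply: ge_sup; [exists 0|move=> t [/andP[]]].
have [del del0 hd] := step (sup S) ltac:(by rewrite s0 sT).
have [a [/andP[a0 aT] Pa] ha] := sup_adherent del0 supS.
have aS : a <= sup S by apply: ubS; split => //; rewrite a0.
have Ps : P (sup S).
  have [as_|] := ltP a (sup S); last by move=> sa; rewrite (le_anti (introT andP (conj sa aS))).
  by apply: (hd a) => //; rewrite ?a0 ?lexx ?sT//; lra.
have [sT'|] := ltP (sup S) T; last by move=> Ts; rewrite (le_anti (introT andP (conj Ts sT))).
pose b := Num.min T (sup S + del / 2).
have sb : sup S < b by rewrite lt_min sT' ltrDl divr_gt0.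
have bT : b <= T by rewrite ge_min lexx.
have bs : b <= sup S + del / 2 by rewrite ge_min lexx orbT.
have Pb : P b by apply: (hd (sup S)); rewrite ?s0 ?lexx ?bT ?(ltW sb)//; lra.
have : b <= sup S by apply: ubS; split; rewrite ?bT ?(le_trans s0 (ltW sb)).
by rewrite leNgt sb.
Qed.

End segment_induction.

Section evolution.
Context (R : realType) (n : nat) (V : 'rV[R]_n -> R) (B : R) (u ut : R -> 'rV[R]_n -> R).
Local Notation E := 'rV[R]_n.
Local Notation mu := (@lebesgue_rV R n).
Local Notation sqint := (sqint mu).
Local Notation ip := (ip mu).
Local Notation nrm := (nrm mu).
Local Notation leb := (@lebesgue_measure R).

Implicit Types (r s t e del : R).

Hypotheses (B0 : 0 <= B) (Vc : continuous V) (VB : forall x, `|V x| <= B).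
Hypothesis uH : forall t, 0 <= t -> H1 (u t).
Hypothesis ucont : forall t e, 0 <= t -> 0 < e -> exists2 del, 0 < del &
  forall s, 0 <= s -> `|s - t| < del -> H1norm (fun x => u s x - u t x) <= e.
Hypothesis ut2 : forall t, 0 <= t -> sqint (ut t).
Hypothesis utcont : forall t e, 0 <= t -> 0 < e -> exists2 del, 0 < del &
  forall s, 0 <= s -> `|s - t| < del -> nrm (fun x => ut s x - ut t x) <= e.
Hypothesis uder : forall t e, 0 <= t -> 0 < e -> exists2 del, 0 < del &
  forall s, 0 <= s -> s != t -> `|s - t| < del ->
    nrm (fun x => (s - t)^-1 * (u s x - u t x) - ut t x) <= e.
Hypothesis weq : wave_eq_distr V u.

Let Vm : measurable_fun setT V. Proof. exact: continuous_rV_measurable. Qed.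

Let u2 t : 0 <= t -> sqint (u t). Proof. by move=> /uH/H1_sqint. Qed.

Let p2 i t : 0 <= t -> sqint (pd i (u t)). Proof. by move=> /uH/(pdP i)[]. Qed.

Lemma sqintV f : sqint f -> sqint (fun x => V x * f x).
Proof. exact: sqintMr. Qed.

Lemma nrmV_le f : sqint f -> nrm (fun x => V x * f x) <= B * nrm f.
Proof.
move=> f2; rewrite -(ger0_norm B0) -nrmZ//; apply: le_nrm; first exact: sqintZ.
  exact: (sqintV f2).1.
by move=> x; rewrite !normrM ler_wpM2r// (le_trans (VB x))// ler_norm.
Qed.

(* [pd i] is not linear on representatives, so this is not [H1norm] of the difference. *)
Definition dist s t := nrm (fun x => u s x - u t x) +
  \sum_(i < n) nrm (fun x => pd i (u s) x - pd i (u t) x).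

Lemma dist_triangle r s t : 0 <= r -> 0 <= s -> 0 <= t -> dist r s <= dist r t + dist s t.
Proof.
move=> r0 s0 t0; rewrite /dist addrACA -big_split/=.
have tri f g h : sqint f -> sqint g -> sqint h ->
    nrm (fun x => f x - g x) <= nrm (fun x => f x - h x) + nrm (fun x => g x - h x).
  move=> f2 g2 h2; rewrite (_ : (fun x => f x - g x) = (fun x => (f x - h x) - (g x - h x))).
    by apply: nrmB; exact: sqintB.
  by apply/funext => x; ring.
apply: lerD; first by apply: tri; exact: u2.
by apply: ler_sum => i _; apply: tri; exact: p2.
Qed.

Lemma dist_le_H1norm s t : 0 <= s -> 0 <= t ->
  dist s t <= n.+1%:R * H1norm (fun x => u s x - u t x).
Proof.
move=> s0 t0; have [Hs Ht] := (uH s0, uH t0).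
rewrite -[n.+1%:R]natr1 mulrDl mul1r [leRHS]addrC.
apply: lerD; first by apply: nrm_le_H1norm; exact: H1B.
rewrite mulr_natl (_ : _ *+ n = \sum_(i < n) H1norm (fun x => u s x - u t x)).
  by apply: ler_sum => i _; exact: pdB_le_H1norm.
by rewrite sumr_const card_ord.
Qed.

Lemma dist_continuous t e : 0 <= t -> 0 < e -> exists2 del, 0 < del &
  forall s, 0 <= s -> `|s - t| < del -> dist s t <= e.
Proof.
move=> t0 e0; have e1 : 0 < e / n.+1%:R by rewrite divr_gt0.
have [del del0 h] := ucont t0 e1; exists del => // s s0 st.
rewrite (le_trans (dist_le_H1norm s0 t0))// mulrC -ler_pdivlMr//; exact: h.
Qed.

Lemma dist_ge0 s t : 0 <= dist s t.
Proof. by rewrite addr_ge0 ?nrm_ge0//; apply: sumr_ge0 => i _; exact: nrm_ge0. Qed.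

Lemma nrmB_le_dist s t : nrm (fun x => u s x - u t x) <= dist s t.
Proof. by rewrite lerDl; apply: sumr_ge0 => i _; exact: nrm_ge0. Qed.

Lemma nrm_pdB_le_dist i s t : nrm (fun x => pd i (u s) x - pd i (u t) x) <= dist s t.
Proof.
rewrite /dist (bigD1 i)//= addrCA lerDl addr_ge0 ?nrm_ge0//.
by apply: sumr_ge0 => j _; exact: nrm_ge0.
Qed.

(** * The equation tested in space with a fixed function *)

Section tested.
Variable phi : E -> R.
Hypothesis tphi : test_function setT phi.

Let phi2 := test_sqint tphi.
Let sphi : smooth phi. Proof. by case: tphi. Qed.
Let dphi2 i := test_sqint (test_derive (basis_vec R i) tphi).

(** The value that the equation assigns to the second time derivative of [ip (u t) phi], with one
    space derivative left on each factor. *)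
Definition force t := - \sum_(i < n) ip (pd i (u t)) (fun x => 'D_(basis_vec R i) phi x)
  - ip (fun x => V x * u t x) phi.

Lemma force_lip s t : 0 <= s -> 0 <= t -> `|force s - force t| <=
  (\sum_(i < n) nrm (fun x => 'D_(basis_vec R i) phi x) + B * nrm phi) * dist s t.
Proof.
move=> s0 t0; rewrite /force.
have -> : - \sum_(i < n) ip (pd i (u s)) (fun x => 'D_(basis_vec R i) phi x)
    - ip (fun x => V x * u s x) phi
    - (- \sum_(i < n) ip (pd i (u t)) (fun x => 'D_(basis_vec R i) phi x)
    - ip (fun x => V x * u t x) phi) =
  - (\sum_(i < n) ip (fun x => pd i (u s) x - pd i (u t) x) (fun x => 'D_(basis_vec R i) phi x)
    + ip (fun x => V x * (u s x - u t x)) phi).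
  have -> : \sum_(i < n) ip (fun x => pd i (u s) x - pd i (u t) x)
      (fun x => 'D_(basis_vec R i) phi x) =
      \sum_(i < n) ip (pd i (u s)) (fun x => 'D_(basis_vec R i) phi x) -
      \sum_(i < n) ip (pd i (u t)) (fun x => 'D_(basis_vec R i) phi x).
    rewrite -sumrB; apply: eq_bigr => i _.
    by rewrite (ipBl (p2 i s0) (p2 i t0) (dphi2 i)).
  rewrite (_ : (fun x => V x * (u s x - u t x)) = (fun x => V x * u s x - V x * u t x)).
    rewrite (ipBl (sqintV (u2 s0)) (sqintV (u2 t0)) phi2).
    by rewrite !opprD !opprK addrACA.
  by apply/funext => x; rewrite mulrBr.
rewrite normrN (le_trans (ler_normD _ _))// mulrDl lerD//.
  rewrite mulr_suml (le_trans (ler_norm_sum _ _ _))//; apply: ler_sum => i _.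
  apply: le_trans (cauchy_schwarz (sqintB (p2 i s0) (p2 i t0)) (dphi2 i)) _.
  by rewrite mulrC ler_wpM2l ?nrm_ge0// nrm_pdB_le_dist.
have us2 := sqintB (u2 s0) (u2 t0).
apply: le_trans (cauchy_schwarz (sqintV us2) phi2) _.
rewrite mulrAC ler_wpM2r ?nrm_ge0//; apply: le_trans (nrmV_le us2) _.
by rewrite ler_wpM2l// nrmB_le_dist.
Qed.

Lemma tested_is_derive t : 0 < t -> is_derive t (1 : R) (fun s : R => ip (u s) phi) (ip (ut t) phi).
Proof.
move=> t0.
suff cv : h^-1 *: (((fun s : R => ip (u s) phi) \o shift t) (h *: 1) - ip (u t) phi)
    @[h --> 0^'] --> ip (ut t) phi.
  by apply: DeriveDef; [apply/cvg_ex; eexists; exact: cv|exact: (cvg_lim _ cv)].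
apply/cvgrPdist_le => e e0.
have P0 : 0 < nrm phi + 1 by rewrite ltr_wpDl ?nrm_ge0.
have e1 : 0 < e / (nrm phi + 1) by rewrite divr_gt0.
have [del del0 hd] := uder (ltW t0) e1.
near=> h.
have h0 : h != 0 by near: h; exact: nbhs_dnbhs_neq.
have hdel : `|h| < del by near: h; exact: dnbhs0_lt.
have ht : `|h| < t by near: h; exact: dnbhs0_lt.
have th : 0 <= h + t by move: ht; rewrite ltr_norml; lra.
have us2 := u2 th; have ut2' := u2 (ltW t0); have ut2'' := ut2 (ltW t0).
rewrite /= /GRing.scale/= mulr1 distrC -ipBl// -ipZl//; last exact: sqintB.
rewrite -ipBl//; last exact/sqintZ/sqintB.
have ds : sqint (fun x => h^-1 * (u (h + t) x - u t x) - ut t x).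
  by apply: sqintB => //; apply: sqintZ; exact: sqintB.
apply: le_trans (cauchy_schwarz ds phi2) _.
have := hd (h + t) th; rewrite addrK => /(_ _ hdel) hh.
have {}hh := hh _.
have ht' : h + t != t by rewrite -subr_eq0 addrK.
apply: le_trans (ler_wpM2r (nrm_ge0 _ _) (hh ht')) _.
by rewrite mulrAC ler_pdivrMr// ler_wpM2l ?(ltW e0)//; lra.
Unshelve. all: by end_near. Qed.

Lemma tested_velocity_continuous t : 0 < t -> {for t, continuous (fun s : R => ip (ut s) phi)}.
Proof.
move=> t0; apply/cvgrPdist_le => e e0.
have P0 : 0 < nrm phi + 1 by rewrite ltr_wpDl ?nrm_ge0.
have e1 : 0 < e / (nrm phi + 1) by rewrite divr_gt0.
have [del del0 hd] := utcont (ltW t0) e1.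
near=> s.
have st : `|s - t| < del by rewrite distrC; near: s; exact: (@cvgr_dist_lt _ _ _ _ _ id t).
have s0 : 0 < s by near: s; exact: lt_nbhsr.
rewrite distrC -(ipBl (ut2 (ltW s0)) (ut2 (ltW t0)) phi2).
apply: le_trans (cauchy_schwarz (sqintB (ut2 (ltW s0)) (ut2 (ltW t0))) phi2) _.
apply: le_trans (ler_wpM2r (nrm_ge0 _ _) (hd s (ltW s0) st)) _.
by rewrite mulrAC ler_pdivrMr// ler_wpM2l ?(ltW e0)//; lra.
Unshelve. all: by end_near. Qed.

Lemma force_continuous t : 0 < t -> {for t, continuous force}.
Proof.
move=> t0; apply/cvgrPdist_le => e e0.
set C := \sum_(i < n) nrm (fun x => 'D_(basis_vec R i) phi x) + B * nrm phi.
have C0 : 0 <= C.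
  by rewrite addr_ge0 ?mulr_ge0 ?nrm_ge0//; apply: sumr_ge0 => i _; exact: nrm_ge0.
have e1 : 0 < e / (C + 1) by rewrite divr_gt0// ltr_wpDl.
have [del del0 hd] := dist_continuous (ltW t0) e1.
near=> s.
have st : `|s - t| < del by rewrite distrC; near: s; exact: (@cvgr_dist_lt _ _ _ _ _ id t).
have s0 : 0 < s by near: s; exact: lt_nbhsr.
rewrite distrC; apply: le_trans (force_lip (ltW s0) (ltW t0)) _.
apply: le_trans (ler_wpM2l C0 (hd s (ltW s0) st)) _.
rewrite mulrCA -[leRHS]mulr1 ler_wpM2l ?(ltW e0)// ler_pdivrMr ?ltr_wpDl// mul1r.
by rewrite lerDl.
Unshelve. all: by end_near. Qed.

(** Each $\partial_i \phi$ is itself a test function, so one of the two derivatives in the Laplacian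
    moves to [u t] by the definition of the weak derivative. *)
Lemma wave_tensor kappa t : smooth kappa -> 0 <= t ->
  \int[mu]_x (u t x * (dt (dt (tensor kappa phi)) (t, x) - laplacian (tensor kappa phi) (t, x)
    + V x * tensor kappa phi (t, x))) =
  'D_1 (fun s => 'D_1 kappa s) t * ip (u t) phi - kappa t * force t.
Proof.
move=> sk t0; have ut2' := u2 t0; have Vu2 := sqintV ut2'.
pose L x := \sum_(i < n) 'D_(basis_vec R i) (fun y => 'D_(basis_vec R i) phi y) x.
have d2phi2 i := test_sqint (test_derive (basis_vec R i) (test_derive (basis_vec R i) tphi)).
have L2 : sqint L by exact: sqint_sum.
have Lip : ip (u t) L = - \sum_(i < n) ip (pd i (u t)) (fun x => 'D_(basis_vec R i) phi x).
  rewrite ip_sumr// -sumrN; apply: eq_bigr => i _.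
  exact: ((pdP i (uH t0)).2 _ (test_derive (basis_vec R i) tphi)).
rewrite /force -Lip.
set D2 := 'D_1 _ t.
have -> : D2 * ip (u t) phi + - (kappa t * (ip (u t) L - ip (fun x => V x * u t x) phi)) =
  ip (u t) (fun x => D2 * phi x - kappa t * L x) + kappa t * ip (fun x => V x * u t x) phi.
  rewrite (ipBr (sqintZ D2 phi2) (sqintZ (kappa t) L2) ut2') !ipZr//.
  by rewrite mulrBr opprB addrA addrAC.
have h2 := sqintB (sqintZ D2 phi2) (sqintZ (kappa t) L2).
rewrite -(ipZl _ Vu2 phi2).
rewrite !ipE -RintegralD//; last 2 first.
- exact: sqint_mul ut2' h2.
- exact: sqint_mul (sqintZ _ Vu2) phi2.
apply: eq_Rintegral => x _.
rewrite (dt_tensor sk sphi) (dt_tensor (smooth_derive _ sk) sphi).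
rewrite /laplacian (eq_bigr (fun i => kappa t * 'D_(basis_vec R i) (fun y => 'D_(basis_vec R i) phi y) x)).
  by rewrite -mulr_sumr /tensor/= -/(L x) -/D2; clear h2; move: (L x) D2 (V x) (u t x) (phi x) (kappa t) => *; ring.
move=> i _; rewrite (dx_tensor _ sk sphi) (dx_tensor _ sk (smooth_derive _ sphi)).
by [].
Qed.

Lemma tested_weak (kappa : R -> R) (a c : R) : smooth kappa -> 0 < a -> a < c ->
  (forall t, kappa t != 0 -> a < t < c) ->
  \int[leb]_(t in `[a, c]) ('D_1 (fun s => 'D_1 kappa s) t * ip (u t) phi - kappa t * force t) = 0.
Proof.
move=> sk a0 ac supp; rewrite -[RHS](weq (test_tensor sk a0 supp tphi)).
rewrite Rintegral_mkcond [RHS]Rintegral_mkcond; apply: eq_Rintegral => t _.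
rewrite !patchE.
have ks s : kappa s != 0 -> `[a, c]%classic s.
  by move=> /supp/andP[h1 h2]; rewrite /= in_itv/= !ltW.
have dks := derive_support (@segment_compact R a c)
  (derive_support (@segment_compact R a c) ks (v := (1 : R))) (v := (1 : R)).
case: (boolP (t \in `[a, c]%classic)) => tac.
  have t0 : 0 < t.
    by move: tac; rewrite inE /= in_itv/= => /andP[at_ _]; exact: lt_le_trans at_.
  by rewrite mem_set// wave_tensor// ltW.
case: ifPn => // /set_mem/= t0; rewrite wave_tensor ?ltW//.
have z1 : kappa t = 0.
  by apply/eqP; apply: contraNT tac => /ks; exact: mem_set.
have z2 : 'D_1 (fun s => 'D_1 kappa s) t = 0.
  by apply/eqP; apply: contraNT tac => /dks; exact: mem_set.
by rewrite z1 z2 !mul0r subrr.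
Qed.

Lemma tested_increment a b b' w : 0 < a -> a < b -> b < b' ->
  (forall s, a <= s <= b' -> dist s a <= w) ->
  `|ip (ut b) phi - ip (ut a) phi - (b - a) * force a| <= (b - a) *
    ((\sum_(i < n) nrm (fun x => 'D_(basis_vec R i) phi x) + B * nrm phi) * w).
Proof.
move=> a0 ab bb' dw.
apply: (@weak_increment R (fun s => ip (u s) phi) (fun s => ip (ut s) phi) force) bb' _ => //.
- exact: tested_is_derive.
- exact: tested_velocity_continuous.
- exact: force_continuous.
- exact: tested_weak.
move=> s sab; have /andP[as_ _] := sab; have s0 := lt_le_trans a0 as_.
apply: le_trans (force_lip (ltW s0) (ltW a0)) _; apply: ler_wpM2l (dw s sab).
by rewrite addr_ge0 ?mulr_ge0 ?nrm_ge0//; apply: sumr_ge0 => i _; exact: nrm_ge0.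
Qed.

End tested.

(** The bilinear form $a(v, w)$ of the overview. *)
Definition energy_form v w := \sum_(i < n) ip (pd i v) (pd i w) + ip (fun x => V x * v x) w.

(** * The equation averaged over the translates of one kernel *)

Section fixed_kernel.
Variable k : E -> R.
Hypothesis bk : box_kernel k.
Local Notation Dk i := (fun z : E => 'D_(basis_vec R i) k z).

Let bDk i : box_kernel (Dk i). Proof. exact: box_kernel_derive. Qed.
Let mk : measurable_fun setT k. Proof. exact: box_kernel_measurable. Qed.
Let mDk i : measurable_fun setT (Dk i). Proof. exact: box_kernel_measurable. Qed.

Let dslice i (y : E) : (fun x : E => 'D_(basis_vec R i) (fun z => k (z - y)) x) =
  (fun x => Dk i (x - y)).
Proof. by apply/funext => x; exact: derive_subr. Qed.

Definition conv_velocity w t := conv_form k (ut t) w.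

(** The derivatives are left on the kernel, so the expression makes sense for every square
    integrable [w]. *)
Definition conv_force w t := - \sum_(i < n) conv_form (Dk i) (pd i (u t)) w
  - conv_form k (fun x => V x * u t x) w.

(** Uniform in [y], so the constant of [tested_increment] for the translate of [k] by [y] can be
    taken out of the integral over [y]. *)
Let slice_bound : exists2 C, 0 <= C & forall y : E,
  \sum_(i < n) nrm (fun x => 'D_(basis_vec R i) (fun z => k (z - y)) x)
    + B * nrm (fun x => k (x - y)) <= C.
Proof.
have bound q : box_kernel q -> exists C, forall y : E, nrm (fun x => q (x - y)) <= C.
  move=> bq; have [M M0 qM] := box_kernel_bound bq.
  by exists `|M| => y; have [] := kernel_sqint y (box_kernel_measurable bq) qM.
have [C kC] := bound k bk.
have /choice[D DC] i := bound (Dk i) (bDk i).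
exists (\sum_(i < n) D i + B * C).
  rewrite addr_ge0 ?mulr_ge0//; last by rewrite (le_trans _ (kC 0))// nrm_ge0.
  by apply: sumr_ge0 => i _; rewrite (le_trans _ (DC i 0))// nrm_ge0.
move=> y; apply: lerD; last by rewrite ler_wpM2l.
apply: ler_sum => i _; apply: le_trans (DC i y).
by rewrite dslice.
Qed.

Lemma conv_forceE w t : sqint w -> 0 <= t ->
  mu.-integrable setT (EFin \o (fun y => w y * force (fun x => k (x - y)) t)) /\
  conv_force w t = \int[mu]_y (w y * force (fun x => k (x - y)) t).
Proof.
move=> w2 t0; have [M M0 kM] := box_kernel_bound bk.
pose G i y := w y * ip (pd i (u t)) (fun x => Dk i (x - y)).
pose H y := w y * ip (fun x => V x * u t x) (fun x => k (x - y)).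
have GE i : mu.-integrable setT (EFin \o G i) /\ conv_form (Dk i) (pd i (u t)) w = \int[mu]_y G i y.
  have [N N0 kN] := box_kernel_bound (bDk i).
  have := conv_formEr (mDk i) kN N0 (p2 i t0) w2.
  by have := conv_form_slice_integrable (mDk i) kN N0 (p2 i t0) w2.
have iH : mu.-integrable setT (EFin \o H) := conv_form_slice_integrable mk kM M0 (sqintV (u2 t0)) w2.
have HE : _ = \int[mu]_y H y := conv_formEr mk kM M0 (sqintV (u2 t0)) w2.
have [iS SE] := integrable_sumr (index_enum 'I_n) (fun i => (GE i).1).
have {}SE : \sum_(i < n) conv_form (Dk i) (pd i (u t)) w = \int[mu]_y \sum_(i < n) G i y.
  by rewrite SE; apply: eq_bigr => i _; exact: (GE i).2.
have E y : w y * force (fun x => k (x - y)) t = - (\sum_(i < n) G i y + H y).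
  rewrite /force mulrBr mulrN mulr_sumr opprD.
  apply: (f_equal2 (fun a b : R => - a - b)); last by [].
  by apply: eq_bigr => i _; rewrite dslice.
have iSH := integrable_addr iS iH.
split.
  under [X in EFin \o X]eq_fun do rewrite E -mulN1r.
  exact: integrable_scaler.
under eq_Rintegral do rewrite E -mulN1r.
by rewrite RintegralZl// mulN1r RintegralD// -SE -HE opprD.
Qed.

Lemma conv_velocityE w t : sqint w -> 0 <= t ->
  mu.-integrable setT (EFin \o (fun y => w y * ip (ut t) (fun x => k (x - y)))) /\
  conv_velocity w t = \int[mu]_y (w y * ip (ut t) (fun x => k (x - y))).
Proof.
move=> w2 t0; have [M M0 kM] := box_kernel_bound bk.
have := conv_formEr mk kM M0 (ut2 t0) w2.
by have := conv_form_slice_integrable mk kM M0 (ut2 t0) w2.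
Qed.

(* The increments tested with [k (x - y)] are integrated against [`|w y|] in [y]; the
   constant depends on the integral of [`|w|], which [conv_increment] removes. *)
Lemma conv_increment_integrable w : sqint w -> mu.-integrable setT (EFin \o w) ->
  exists2 C, 0 <= C & forall a b b' r, 0 < a -> a < b -> b < b' ->
  (forall s, a <= s <= b' -> dist s a <= r) ->
  `|conv_velocity w b - conv_velocity w a - (b - a) * conv_force w a| <= (b - a) * (C * r).
Proof.
move=> w2 w1; have [C C0 sC] := slice_bound.
have aw1 : mu.-integrable setT (EFin \o (fun y => `|w y|)) := integrable_norm w1.
exists (C * \int[mu]_y `|w y|).
  by rewrite mulr_ge0//; apply: Rintegral_ge0 => y _; exact: normr_ge0.
move=> a b b' r a0 ab bb' dr.
have b0 := lt_trans a0 ab.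
have r0 : 0 <= r by rewrite (le_trans (dist_ge0 a a))// dr// lexx ltW// (lt_trans ab).
have [ia ->] := conv_velocityE w2 (ltW a0).
have [ib ->] := conv_velocityE w2 (ltW b0).
have [ik ->] := conv_forceE w2 (ltW a0).
pose F y := ip (ut b) (fun x => k (x - y)) - ip (ut a) (fun x => k (x - y))
  - (b - a) * force (fun x => k (x - y)) a.
have FE y : w y * F y = w y * ip (ut b) (fun x => k (x - y))
    + -1 * (w y * ip (ut a) (fun x => k (x - y)))
    + - (b - a) * (w y * force (fun x => k (x - y)) a).
  by rewrite /F; move: (ip _ _) (ip _ _) (force _ _) => *; ring.
have i1 := integrable_scaler (-1) ia.
have i2 := integrable_scaler (- (b - a)) ik.
have i3 := integrable_addr ib i1.
have iF : mu.-integrable setT (EFin \o (fun y => w y * F y)).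
  by under [X in EFin \o X]eq_fun do rewrite FE; exact: integrable_addr.
rewrite (_ : _ - _ = \int[mu]_y (w y * F y)); last first.
  under [RHS]eq_Rintegral do rewrite FE.
  by rewrite !RintegralD// !RintegralZl// mulN1r mulNr.
apply: le_trans (le_normr_Rintegral measurableT iF) _.
have -> : (b - a) * (C * \int[mu]_y `|w y| * r) = \int[mu]_y ((b - a) * (C * r) * `|w y|).
  by rewrite RintegralZl//; move: (Rintegral _ _ _) => *; ring.
apply: le_Rintegral => //; [exact: integrable_norm|exact: integrable_scaler|].
move=> y _; rewrite normrM mulrC ler_wpM2r//.
apply: le_trans (tested_increment (test_subr y bk) a0 ab bb' dr) _.
by rewrite ler_wpM2l ?subr_ge0 ?(ltW ab)// ler_wpM2r.
Qed.

Let kform_bound q : box_kernel q -> exists2 C, 0 <= C &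
  forall f w, sqint f -> sqint w -> `|conv_form q f w| <= C * (nrm f * nrm w).
Proof.
move=> bq; have [M M0 qM] := box_kernel_bound bq; exists M => // f w f2 w2.
exact: (conv_form_bound (box_indic_mass n M0) (box_kernel_measurable bq) qM f2 w2).
Qed.

Lemma conv_forceB w s t : sqint w -> 0 <= s -> 0 <= t ->
  conv_force w s - conv_force w t =
  - (\sum_(i < n) conv_form (Dk i) (fun x => pd i (u s) x - pd i (u t) x) w
    + conv_form k (fun x => V x * (u s x - u t x)) w).
Proof.
move=> w2 s0 t0; have [M M0 kM] := box_kernel_bound bk.
have -> : (fun x => V x * (u s x - u t x)) = (fun x => V x * u s x - V x * u t x).
  by apply/funext => x; rewrite mulrBr.
rewrite (conv_formBl mk kM M0 (sqintV (u2 s0)) (sqintV (u2 t0)) w2).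
have -> : \sum_(i < n) conv_form (Dk i) (fun x => pd i (u s) x - pd i (u t) x) w =
    \sum_(i < n) conv_form (Dk i) (pd i (u s)) w - \sum_(i < n) conv_form (Dk i) (pd i (u t)) w.
  rewrite -sumrB; apply: eq_bigr => i _; have [N N0 kN] := box_kernel_bound (bDk i).
  exact: (conv_formBl (mDk i) kN N0 (p2 i s0) (p2 i t0) w2).
by rewrite /conv_force !opprD !opprK addrACA.
Qed.

(** The constant depends on the kernel, but on [w] only through its $L^2$ norm. It is the one that
    replaces the integral of [|w|]. *)
Lemma conv_force_lip : exists2 C, 0 <= C & forall w s t, sqint w -> 0 <= s -> 0 <= t ->
  `|conv_force w s - conv_force w t| <= C * nrm w * dist s t.
Proof.
have [C C0 kC] := kform_bound bk.
have /choice[D DC] i : exists D, 0 <= D /\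
    forall f w, sqint f -> sqint w -> `|conv_form (Dk i) f w| <= D * (nrm f * nrm w).
  by have [D D0 DC] := kform_bound (bDk i); exists D.
exists (\sum_(i < n) D i + C * B).
  by rewrite addr_ge0 ?mulr_ge0//; apply: sumr_ge0 => i _; exact: (DC i).1.
move=> w s t w2 s0 t0; rewrite conv_forceB// normrN (le_trans (ler_normD _ _))//.
rewrite -mulrA mulrDl; apply: lerD.
  rewrite mulr_suml (le_trans (ler_norm_sum _ _ _))//; apply: ler_sum => i _.
  apply: le_trans ((DC i).2 _ _ (sqintB (p2 i s0) (p2 i t0)) w2) _.
  rewrite ler_wpM2l ?(DC i).1// mulrC ler_wpM2l ?nrm_ge0//; exact: nrm_pdB_le_dist.
have us2 := sqintB (u2 s0) (u2 t0).
apply: le_trans (kC _ _ (sqintV us2) w2) _.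
rewrite -mulrA ler_wpM2l// mulrC mulrCA ler_wpM2l ?nrm_ge0//.
by apply: le_trans (nrmV_le us2) _; rewrite ler_wpM2l// nrmB_le_dist.
Qed.

Lemma conv_velocity_cont w t e : sqint w -> 0 <= t -> 0 < e -> exists2 del, 0 < del &
  forall s, 0 <= s -> `|s - t| < del -> `|conv_velocity w s - conv_velocity w t| <= e.
Proof.
move=> w2 t0 e0; have [C C0 kC] := kform_bound bk; have [M M0 kM] := box_kernel_bound bk.
have D0 : 0 < C * nrm w + 1 by rewrite ltr_wpDl// mulr_ge0// nrm_ge0.
have e1 : 0 < e / (C * nrm w + 1) by rewrite divr_gt0.
have [del del0 hd] := utcont t0 e1; exists del => // s s0 st.
rewrite /conv_velocity -(conv_formBl mk kM M0 (ut2 s0) (ut2 t0) w2).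
apply: le_trans (kC _ _ (sqintB (ut2 s0) (ut2 t0)) w2) _.
rewrite mulrCA; apply: le_trans (ler_wpM2r _ (hd s s0 st)) _.
  by rewrite mulr_ge0// nrm_ge0.
by rewrite mulrAC ler_pdivrMr// ler_wpM2l ?(ltW e0)// lerDl.
Qed.

Let trunc m w : E -> R := fun x => (\1_(ball (0 : E) m.+1%:R) : E -> R) x * w x.

Let mball m : measurable (ball (0 : E) m.+1%:R).
Proof. by apply: open_rV_measurable; exact: ball_open. Qed.

Let indic_le1 (A : set E) x : `|(\1_A : E -> R) x| <= 1.
Proof. by rewrite indicE; case: (_ \in _); rewrite ?normr1 ?normr0. Qed.

Let trunc_sqint m w : sqint w -> sqint (trunc m w).
Proof. by move=> w2; apply: (sqintMr _ (@indic_le1 _) w2); exact: measurable_indic. Qed.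

Let trunc_integrable m w : sqint w -> mu.-integrable setT (EFin \o trunc m w).
Proof.
move=> w2; apply: sqint_mul w2; apply: indic_sqint; [exact: mball|exact: ball_finite].
Qed.

Let trunc_le m w x : `|trunc m w x| <= `|w x|.
Proof. by rewrite normrM ler_piMl. Qed.

Let trunc_nrm m w : sqint w -> nrm (trunc m w) <= nrm w.
Proof. by move=> w2; apply: (le_nrm w2 (trunc_sqint m w2).1); exact: trunc_le. Qed.

Let trunc_cvg w : sqint w -> nrm (fun x => trunc m w x - w x) @[m --> \oo] --> (0 : R).
Proof.
move=> w2; apply: (nrm_cvg0 (fun m => trunc_sqint m w2) w2 w2) => [m x|x].
  rewrite /trunc -[X in _ - X]mul1r -mulrBl normrM ler_piMl// indicE.
  by case: (_ \in _); rewrite ?subrr ?normr0// sub0r normrN normr1.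
rewrite -[X in _ --> X]mul1r; apply: cvgM; last exact: cvg_cst.
apply: (@cvg_trans _ ((cst (1 : R) : nat -> R) @ \oo)); last exact: cvg_cst.
apply: near_eq_cvg; near=> m; rewrite indicE mem_set//.
rewrite -ball_normE /= sub0r normrN.
near: m; exists (Num.truncn `|x|) => // m /= xm.
by rewrite (lt_le_trans (truncnS_gt _))// ler_nat.
Unshelve. all: by end_near. Qed.

Let conv_form_trunc_cvg q f w : box_kernel q -> sqint f -> sqint w ->
  conv_form q f (trunc m w) @[m --> \oo] --> conv_form q f w.
Proof.
move=> bq f2 w2; have [C C0 qC] := kform_bound bq; have [M M0 qM] := box_kernel_bound bq.
apply/cvgrPdist_le => e e0.
have D0 : 0 < C * nrm f + 1 by rewrite ltr_wpDl// mulr_ge0// nrm_ge0.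
have e1 : 0 < e / (C * nrm f + 1) by rewrite divr_gt0.
have /cvgrPdist_le/(_ _ e1) := trunc_cvg w2.
apply: filterS => m; rewrite sub0r normrN ger0_norm ?nrm_ge0// => hm.
rewrite distrC -(conv_formBr (box_kernel_measurable bq) qM M0 f2 w2 (trunc_sqint m w2)).
apply: le_trans (qC _ _ f2 (sqintB (trunc_sqint m w2) w2)) _.
rewrite mulrA; apply: le_trans (ler_wpM2l _ hm) _; first by rewrite mulr_ge0// nrm_ge0.
by rewrite mulrCA -[leRHS]mulr1 ler_wpM2l ?(ltW e0)// ler_pdivrMr// mul1r lerDl.
Qed.

(** For a truncation of [w] the estimate with the integral of its absolute value serves only as the
    differentiability input of [increment_refine]. The resulting bound is uniform in the truncation,
    which is then removed. *)
Lemma conv_increment : exists2 C, 0 <= C & forall w a b r, sqint w -> 0 <= a -> a < b ->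
  (forall s, a <= s <= b -> dist s a <= r) ->
  `|conv_velocity w b - conv_velocity w a - (b - a) * conv_force w a|
    <= (b - a) * (C * nrm w * r).
Proof.
have [C C0 lip] := conv_force_lip; exists C => // w a b r w2 a0 ab dr.
have r0 : 0 <= r by rewrite (le_trans (dist_ge0 a a))// dr// lexx ltW.
have b0 := le_trans a0 (ltW ab).
have Cw0 v : 0 <= C * nrm v by rewrite mulr_ge0// nrm_ge0.
have H m : `|conv_velocity (trunc m w) b - conv_velocity (trunc m w) a
    - (b - a) * conv_force (trunc m w) a| <= (b - a) * (C * nrm w * r).
  have wm2 := trunc_sqint m w2.
  have [C1 C10 inc] := conv_increment_integrable wm2 (trunc_integrable m w2).
  have lipm s t : 0 <= s -> 0 <= t -> `|conv_force (trunc m w) s - conv_force (trunc m w) t|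
    <= C * nrm (trunc m w) * dist s t by exact: lip.
  apply: (increment_refine C10 (Cw0 (trunc m w)) dist_triangle dist_continuous lipm
    (fun t e => @conv_velocity_cont _ t e wm2) inc a0 ab) => s /[dup] sab /andP[as_ _]; apply: le_trans (lip _ s a wm2 (le_trans a0 as_) a0) _.
  apply: (le_trans (ler_wpM2l (Cw0 _) (dr s sab))); rewrite ler_wpM2r//.
  by rewrite ler_wpM2l// trunc_nrm.
have cV t : 0 <= t -> (fun m => conv_velocity (trunc m w) t) @ \oo --> conv_velocity w t.
  by move=> t0; apply: conv_form_trunc_cvg => //; exact: ut2.
have cF : (fun m => conv_force (trunc m w) a) @ \oo --> conv_force w a.
  apply: cvgB; last by apply: conv_form_trunc_cvg => //; apply: sqintV; exact: u2.
  apply: cvgN; apply: cvg_big => [|i _]; first exact: add_continuous.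
  by apply: conv_form_trunc_cvg => //; exact: p2.
have L : (fun m => `|conv_velocity (trunc m w) b - conv_velocity (trunc m w) a
    - (b - a) * conv_force (trunc m w) a|) @ \oo -->
    `|conv_velocity w b - conv_velocity w a - (b - a) * conv_force w a|.
  apply: cvg_norm; apply: cvgB; last by apply: cvgM => //; exact: cvg_cst.
  by apply: cvgB; exact: cV.
by apply: (ler_cvg_to L (cvg_cst _)); near=> m; exact: H.
Unshelve. all: by end_near. Qed.

End fixed_kernel.

(** * Removal of the mollifier *)

Definition h1sum w := nrm w + \sum_(i < n) nrm (pd i w).

Lemma h1sum_ge0 w : 0 <= h1sum w.
Proof. by rewrite addr_ge0 ?nrm_ge0//; apply: sumr_ge0 => i _; exact: nrm_ge0. Qed.

Lemma nrm_le_h1sum w : nrm w <= h1sum w.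
Proof. by rewrite lerDl; apply: sumr_ge0 => i _; exact: nrm_ge0. Qed.

Lemma pd_le_h1sum i w : nrm (pd i w) <= h1sum w.
Proof.
rewrite /h1sum (bigD1 i)//= addrCA lerDl addr_ge0 ?nrm_ge0//.
by apply: sumr_ge0 => j _; exact: nrm_ge0.
Qed.

Lemma moll_force j w t : H1 w -> 0 <= t -> conv_force (moll j) w t =
  - \sum_(i < n) conv_form (moll j) (pd i (u t)) (pd i w)
  - conv_form (moll j) (fun x => V x * u t x) w.
Proof.
move=> Hw t0; congr (- _ - _); apply: eq_bigr => i _; have [w2 ww] := pdP i Hw.
exact: (conv_form_by_parts (@moll_kernel R n j) (p2 i t0) (H1_sqint Hw) w2 ww).
Qed.

(** The derivatives are on [w] and the mollifier has mass one, so the constant does not depend on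
    [j]. *)
Lemma moll_force_lip j w s t : H1 w -> 0 <= s -> 0 <= t ->
  `|conv_force (moll j) w s - conv_force (moll j) w t| <= (1 + B) * h1sum w * dist s t.
Proof.
move=> Hw s0 t0; have w2 := H1_sqint Hw.
rewrite (conv_forceB (@moll_kernel R n j) w2 s0 t0) normrN mulrDl mulrDl mul1r.
rewrite (le_trans (ler_normD _ _))//; apply: lerD.
  rewrite /dist mulrDr ler_wpDl ?mulr_ge0 ?nrm_ge0 ?h1sum_ge0//.
  rewrite mulr_sumr (le_trans (ler_norm_sum _ _ _))//; apply: ler_sum => i _.
  have [pw2 ww] := pdP i Hw; have d2 := sqintB (p2 i s0) (p2 i t0).
  rewrite (conv_form_by_parts (@moll_kernel R n j) d2 w2 pw2 ww).
  apply: le_trans (conv_moll_le j d2 pw2) _.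
  by rewrite mulrC ler_wpM2r ?nrm_ge0// pd_le_h1sum.
have us2 := sqintB (u2 s0) (u2 t0).
apply: le_trans (conv_moll_le j (sqintV us2) w2) _.
rewrite mulrAC; apply: ler_pM; rewrite ?nrm_ge0//; last exact: nrm_le_h1sum.
by apply: le_trans (nrmV_le us2) _; rewrite ler_wpM2l// nrmB_le_dist.
Qed.

(** Second use of [increment_refine]: the constant of [conv_increment], which depends on [j], enters
    as a hypothesis and disappears from the conclusion. *)
Lemma moll_increment j w a b r : H1 w -> 0 <= a -> a < b ->
  (forall s, a <= s <= b -> dist s a <= r) ->
  `|conv_velocity (moll j) w b - conv_velocity (moll j) w a - (b - a) * conv_force (moll j) w a|
    <= (b - a) * ((1 + B) * h1sum w * r).
Proof.
move=> Hw a0 ab dr; have w2 := H1_sqint Hw.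
have bk := @moll_kernel R n j.
have [C C0 inc] := conv_increment bk.
have Cw0 : 0 <= C * nrm w by rewrite mulr_ge0// nrm_ge0.
have Bw0 : 0 <= (1 + B) * h1sum w by rewrite mulr_ge0 ?h1sum_ge0// addr_ge0.
have lipw s t : 0 <= s -> 0 <= t -> `|conv_force (moll j) w s - conv_force (moll j) w t|
  <= (1 + B) * h1sum w * dist s t by exact: moll_force_lip.
have incw (a1 b1 b' r1 : R) : 0 < a1 -> a1 < b1 -> b1 < b' ->
    (forall s, a1 <= s <= b' -> dist s a1 <= r1) ->
    `|conv_velocity (moll j) w b1 - conv_velocity (moll j) w a1
      - (b1 - a1) * conv_force (moll j) w a1| <= (b1 - a1) * (C * nrm w * r1).
  move=> a10 ab1 bb' dr1; apply: inc => //; first exact: ltW.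
  by move=> s /andP[as_ sb]; apply: dr1; rewrite as_ (le_trans sb)// ltW.
apply: (increment_refine Cw0 Bw0 dist_triangle dist_continuous lipw
  (fun t e => @conv_velocity_cont _ bk _ t e w2) incw a0 ab) => s /[dup] sab /andP[as_ _].
apply: le_trans (lipw s a (le_trans a0 as_) a0) _.
by rewrite ler_wpM2l// dr.
Qed.

(** All terms on the left converge as [j] grows, because mollified scalar products do, and the
    right-hand side does not involve [j]. *)
Lemma energy_increment w a b r : H1 w -> 0 <= a -> a < b ->
  (forall s, a <= s <= b -> dist s a <= r) ->
  `|ip (ut b) w - ip (ut a) w + (b - a) * energy_form (u a) w|
    <= (b - a) * ((1 + B) * h1sum w * r).
Proof.
move=> Hw a0 ab dr; have w2 := H1_sqint Hw; have b0 := le_trans a0 (ltW ab).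
have cvg f g : sqint f -> sqint g -> (fun j => conv_form (@moll R n j) f g) @ \oo --> ip f g.
  by move=> f2; exact: (approximable_sqint f2).2.
have L : (fun j => `|conv_velocity (moll j) w b - conv_velocity (moll j) w a
    - (b - a) * conv_force (moll j) w a|) @ \oo -->
    `|ip (ut b) w - ip (ut a) w - (b - a) * - energy_form (u a) w|.
  apply: cvg_norm; apply: cvgB.
    by apply: cvgB; apply: cvg => //; exact: ut2.
  apply: cvgM; first exact: cvg_cst.
  under eq_fun do rewrite moll_force//.
  rewrite /energy_form opprD; apply: cvgB; last by apply: cvg => //; apply: sqintV; exact: u2.
  apply: cvgN; apply: cvg_big => [|i _]; first exact: add_continuous.
  by apply: cvg; [exact: p2|exact: (pdP i Hw).1].
rewrite mulrN opprK in L.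
by apply: (ler_cvg_to L (cvg_cst _)); near=> j; exact: moll_increment.
Unshelve. all: by end_near. Qed.

(** * The energy form and the Riemann sums for the primitive of [u] *)

Lemma energy_form_lin (a : R) f g w : H1 f -> H1 g -> H1 w ->
  energy_form (fun x => f x + a * g x) w = energy_form f w + a * energy_form g w.
Proof.
move=> Hf Hg Hw; have [f2 g2 w2] := And3 (H1_sqint Hf) (H1_sqint Hg) (H1_sqint Hw).
have -> : energy_form (fun x => f x + a * g x) w =
    \sum_(i < n) (ip (pd i f) (pd i w) + a * ip (pd i g) (pd i w)) +
    ip (fun x => V x * f x + a * (V x * g x)) w.
  congr (_ + ip _ _); last by apply/funext => x; ring.
  by apply: eq_bigr => i _; rewrite ip_pd_lin//; exact: (pdP i Hw).1.
rewrite (ipDl (sqintV f2) (sqintZ a (sqintV g2)) w2) (ipZl _ (sqintV g2) w2).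
by rewrite big_split/= -mulr_sumr /energy_form mulrDr addrACA.
Qed.

Lemma energy_formC f g : energy_form f g = energy_form g f.
Proof.
have -> : energy_form f g = \sum_(i < n) ip (pd i g) (pd i f) + ip (fun x => V x * f x) g.
  by apply: (f_equal (fun z => z + _)); apply: eq_bigr => i _; exact: ipC.
apply: (f_equal (fun z => _ + z)).
by apply: eq_Rintegral => x _; rewrite mulrAC.
Qed.

Lemma energy_form_le f g : H1 f -> H1 g ->
  `|energy_form f g| <= (1 + B) * (h1sum f * h1sum g).
Proof.
move=> Hf Hg; have [f2 g2] := (H1_sqint Hf, H1_sqint Hg).
rewrite mulrDl mul1r (le_trans (ler_normD _ _))//; apply: lerD.
  apply: (@le_trans _ _ (\sum_(i < n) nrm (pd i f) * h1sum g)).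
    rewrite (le_trans (ler_norm_sum _ _ _))//; apply: ler_sum => i _.
    apply: le_trans (cauchy_schwarz (pdP i Hf).1 (pdP i Hg).1) _.
    by rewrite ler_wpM2l ?nrm_ge0// pd_le_h1sum.
  by rewrite -mulr_suml ler_wpM2r ?h1sum_ge0// lerDr nrm_ge0.
apply: le_trans (cauchy_schwarz (sqintV f2) g2) _.
rewrite mulrA; apply: ler_pM; rewrite ?nrm_ge0 ?nrm_le_h1sum//.
by apply: le_trans (nrmV_le f2) _; rewrite ler_wpM2l// nrm_le_h1sum.
Qed.

Lemma h1sum_dist s t : 0 <= s -> 0 <= t -> h1sum (u s) <= h1sum (u t) + dist s t.
Proof.
move=> s0 t0; rewrite /h1sum /dist addrACA -big_split/=.
have tri f g : sqint f -> sqint g -> nrm f <= nrm g + nrm (fun x => f x - g x).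
  move=> f2 g2; rewrite [X in nrm X <= _](_ : f = (fun x => g x + (f x - g x))).
    by apply: nrmD => //; exact: sqintB.
  by apply/funext => x; ring.
apply: lerD; first by apply: tri; exact: u2.
by apply: ler_sum => i _; apply: tri; exact: p2.
Qed.

Lemma h1sum_bounded T : 0 <= T -> exists2 K, 0 <= K & forall s, 0 <= s <= T -> h1sum (u s) <= K.
Proof.
move=> T0; suff : exists K, forall s, 0 <= s <= T -> h1sum (u s) <= K.
  move=> [K hK]; exists K => //; apply: le_trans (hK 0 _); rewrite ?lexx//.
  exact: h1sum_ge0.
apply: (segment_induction (P := fun t => exists K, forall s, 0 <= s <= t -> h1sum (u s) <= K)) T0.
  by exists (h1sum (u 0)) => s; rewrite -eq_le => /eqP <-.
move=> t /andP[t0 _].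
have [del del0 hd] := dist_continuous t0 ltr01; exists del => // a b /andP[a0 at_] /andP[tb _] ab abd.
move=> [K hK]; exists (Num.max K (h1sum (u t) + 1)) => s /andP[s0 sb].
rewrite le_max; have [sa|as_] := leP s a; first by rewrite hK// s0.
apply/orP; right; apply: le_trans (h1sum_dist s0 t0) _; rewrite lerD2l hd//.
by rewrite ltr_norml; apply/andP; split; lra.
Qed.

(** A straddle estimate: for [a <= t <= b] the errors of the linear approximation at [t] add up to
    at most $(b-t) + (t-a) = b-a$ times [e / 2]. Continuity of [ut] then replaces [ut t] by
    [ut a]. *)
Lemma displacement_le t e : 0 <= t -> 0 < e -> exists2 del, 0 < del &
  forall a b, 0 <= a <= t -> t <= b -> a < b -> b - a < del ->
    nrm (fun x => u b x - u a x - (b - a) * ut a x) <= (b - a) * e /\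
    nrm (ut a) <= nrm (ut t) + e.
Proof.
move=> t0 e0; have e1 : 0 < e / 2 by rewrite divr_gt0.
have [d1 d10 h1] := uder t0 e1; have [d2 d20 h2] := utcont t0 e1.
exists (Num.min d1 d2); first by rewrite lt_min d10.
move=> a b /andP[a0 at_] tb ab; rewrite lt_min => /andP[abd1 abd2].
have b0 := le_trans t0 tb.
have [ua2 ub2 us2] := And3 (u2 a0) (u2 b0) (u2 t0).
have [va2 vt2] := (ut2 a0, ut2 t0).
have near1 s : 0 <= s -> `|s - t| < d1 ->
    nrm (fun x => u s x - u t x - (s - t) * ut t x) <= `|s - t| * (e / 2).
  move=> s0 st; have [->|nst] := eqVneq s t.
    rewrite subrr normr0 mul0r (_ : (fun x => _) = cst 0).
      by rewrite /nrm /ip; under eq_Rintegral do rewrite mulr0;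
        rewrite /Rintegral integral0 sqrtr0.
    by apply/funext => x; rewrite mul0r subrr subr0.
  have s2 := u2 s0.
  have := h1 s s0 nst st; rewrite -(ler_pM2l (_ : 0 < `|s - t|)) ?normr_gt0 ?subr_eq0//.
  rewrite -nrmZ; last by apply: sqintB => //; apply: sqintZ; exact: sqintB.
  rewrite (_ : (fun x => _ * _) = (fun x => u s x - u t x - (s - t) * ut t x))//.
  by apply/funext => x; rewrite mulrBr mulVKf ?subr_eq0.
have at_d : `|a - t| = t - a by rewrite distrC ger0_norm ?subr_ge0.
have bt_d : `|b - t| = b - t by rewrite ger0_norm ?subr_ge0.
have Ha := near1 a a0 ltac:(rewrite at_d; lra); rewrite at_d in Ha.
have Hb := near1 b b0 ltac:(rewrite bt_d; lra); rewrite bt_d in Hb.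
have Hv := h2 a a0 ltac:(rewrite at_d; lra).
have vat2 := sqintB va2 vt2.
split; last first.
  rewrite [X in nrm X <= _](_ : ut a = (fun x => ut t x + (ut a x - ut t x))).
    by apply: le_trans (nrmD vt2 vat2) _; rewrite lerD2l; lra.
  by apply/funext => x; ring.
pose fb x := u b x - u t x - (b - t) * ut t x; pose fa x := u a x - u t x - (a - t) * ut t x.
have fb2 : sqint fb by apply: sqintB (sqintZ _ vt2); exact: sqintB.
have fa2 : sqint fa by apply: sqintB (sqintZ _ vt2); exact: sqintB.
rewrite (_ : (fun x => _) = (fun x => (fb x - fa x) - (b - a) * (ut a x - ut t x))); last first.
  by apply/funext => x; rewrite /fb /fa; ring.
apply: le_trans (nrmB (sqintB fb2 fa2) (sqintZ (b - a) vat2)) _.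
have := nrmB fb2 fa2; rewrite nrmZ// (gtr0_norm (_ : 0 < b - a)) ?subr_gt0//.
have : (b - a) * nrm (fun x => ut a x - ut t x) <= (b - a) * (e / 2) by rewrite ler_wpM2l//; lra.
rewrite -/fa in Ha; rewrite -/fb in Hb; lra.
Qed.

(** One step of the Riemann sum. The term with $(b-a)^2$ is itself negligible; it is kept because it
    is the last term in the expansion of $\frac12 a(v + (b-a) u_a, v + (b-a) u_a)$. *)
Lemma energy_step t K eta : 0 <= t -> 0 <= K -> 0 < eta -> exists2 del, 0 < del &
  forall a b, 0 <= a <= t -> t <= b -> a < b -> b - a < del -> h1sum (u a) <= K ->
    (forall w, H1 w -> `|ip (ut b) w - ip (ut a) w + (b - a) * energy_form (u a) w|
      <= (b - a) * eta * h1sum w) /\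
    `|2^-1 * nrm (u b) ^+ 2 - 2^-1 * nrm (u a) ^+ 2 - (b - a) * ip (ut a) (u a)
      + 2^-1 * (b - a) ^+ 2 * energy_form (u a) (u a)| <= 2 * (b - a) * eta.
Proof.
move=> t0 K0 eta0.
(* [e <= 1] serves the bound [h * L] on the displacement, and [e * K <= eta] the pairing of the
   remainder [D] with [u a]. *)
pose e := Num.min 1 (eta / (K + 1)).
have e0 : 0 < e by rewrite lt_min ltr01 divr_gt0// ltr_wpDl.
have e1 : e <= 1 by rewrite ge_min lexx.
have eK : e * K <= eta.
  apply: (@le_trans _ _ (e * (K + 1))); first by rewrite ler_wpM2l ?(ltW e0)// lerDl.
  by rewrite -ler_pdivlMr ?ltr_wpDl// ge_min lexx orbT.
(* The displacement divided by [h] has norm at most [nrm (ut a) + e], hence at most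
   [nrm (ut t) + 2 * e]. *)
pose L := nrm (ut t) + 2.
have L0 : 0 < L by rewrite ltr_wpDl// nrm_ge0.
have B1 : 0 < 1 + B by rewrite ltr_wpDr.
(* Two points of the interval are compared through [t], hence the factor 2. *)
have [r r0 rB] : exists2 r, 0 < r & (1 + B) * (2 * r) = eta.
  exists (eta / (2 * (1 + B))); first by rewrite divr_gt0// mulr_gt0.
  by field; rewrite gt_eqF.
have [d1 d10 h1] := displacement_le t0 e0.
have [d2 d20 h2] := dist_continuous t0 r0.
(* [Q] collects the coefficients of the terms quadratic in [h]; [h * Q <= eta] makes them at most
   [h * eta]. *)
pose Q := L ^+ 2 + (1 + B) * (K * K) + 1.
have Q0 : 0 < Q by rewrite ltr_wpDl// addr_ge0 ?sqr_ge0// mulr_ge0 ?mulr_ge0// ltW.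
exists (Num.min (Num.min d1 d2) (eta / Q)); first by rewrite !lt_min d10 d20 divr_gt0.
move=> a b /[dup] aat /andP[a0 at_] tb ab; rewrite !lt_min => /andP[/andP[abd1 abd2] abQ] uaK.
have b0 := le_trans t0 tb; have h0 : 0 < b - a by rewrite subr_gt0.
have [D1 vL] := h1 a b aat tb ab abd1.
split=> [w Hw|].
  have dr s : a <= s <= b -> dist s a <= 2 * r.
    move=> /andP[as_ sb]; have s0 := le_trans a0 as_.
    have : dist s a <= dist s t + dist a t by exact: dist_triangle.
    have : dist s t <= r by apply: h2 => //; rewrite ltr_norml; apply/andP; split; lra.
    have : dist a t <= r by apply: h2 => //; rewrite ltr_norml; apply/andP; split; lra.
    move=> p1 p3 p4; apply: (le_trans p4).
    rewrite mulr_natl mulr2n; exact: lerD p3 p1.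
  apply: le_trans (energy_increment Hw a0 ab dr) _.
  by rewrite mulrAC rB mulrA.
have [ua2 ub2 va2] := And3 (u2 a0) (u2 b0) (ut2 a0).
pose h := b - a; rewrite -/h in D1 h0 abQ *.
pose D x := u b x - u a x - h * ut a x.
have D2 : sqint D by apply: sqintB (sqintZ _ va2); exact: sqintB.
have hv2 := sqintZ h va2.
pose F x := h * ut a x + D x.
have F2 : sqint F by exact: sqintD.
have ubE : u b = (fun x => u a x + F x) by apply/funext => x; rewrite /F /D; ring.
have nE : nrm (u b) ^+ 2 = nrm (u a) ^+ 2 + 2 * (h * ip (ut a) (u a) + ip D (u a)) + nrm F ^+ 2.
  rewrite !nrm_sqr ubE (ipDl ua2 F2 (sqintD ua2 F2)) (ipDr ua2 F2 ua2) (ipDr ua2 F2 F2).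
  rewrite (ipC mu (u a) F) -(ipZl h va2 ua2) -(ipDl hv2 D2 ua2) -/F.
  by move: (ip F _) (ip F F) (ip _ _) => *; ring.
have Fle : nrm F <= h * L.
  apply: le_trans (nrmD hv2 D2) _; rewrite nrmZ// gtr0_norm//.
  have : nrm D <= h * e by exact: D1.
  have : h * nrm (ut a) <= h * (nrm (ut t) + e) by rewrite ler_wpM2l// ltW.
  have : h * e <= h * 1 by rewrite ler_wpM2l// ltW.
  rewrite /L; lra.
have Dle : `|ip D (u a)| <= h * eta.
  apply: le_trans (cauchy_schwarz D2 ua2) _.
  apply: (@le_trans _ _ (h * e * K)).
    apply: ler_pM; rewrite ?nrm_ge0//.
    by apply: le_trans (nrm_le_h1sum _) uaK.
  by rewrite -mulrA ler_wpM2l// ltW.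
have Ele : `|energy_form (u a) (u a)| <= (1 + B) * (K * K).
  apply: le_trans (energy_form_le (uH a0) (uH a0)) _.
  by rewrite ler_wpM2l ?(ltW B1)// ler_pM ?h1sum_ge0.
have hQ : h * Q <= eta by rewrite -ler_pdivlMr// ltW.
have Fsq : nrm F ^+ 2 <= h * (h * L ^+ 2).
  rewrite (_ : h * _ = (h * L) ^+ 2); last by ring.
  by rewrite lerXn2r ?nnegrE ?nrm_ge0// mulr_ge0// ltW.
have hE : `|h ^+ 2 * energy_form (u a) (u a)| <= h * (h * ((1 + B) * (K * K))).
  rewrite normrM ger0_norm ?sqr_ge0// expr2 -mulrA ler_wpM2l ?(ltW h0)//.
  by rewrite ler_wpM2l ?(ltW h0).
have hQ' : h * (h * L ^+ 2) + h * (h * ((1 + B) * (K * K))) <= h * eta.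
  rewrite -mulrDr ler_wpM2l ?(ltW h0)//; apply: le_trans hQ.
  by rewrite /Q !mulrDr mulr1 lerDl ltW.
rewrite nE; have Fsq0 := sqr_ge0 (nrm F).
move: Dle hE; rewrite !ler_norml => /andP[Dl Dr] /andP[El Er].
rewrite -[2^-1 * h ^+ 2 * _]mulrA.
move: (h * eta) (h * (h * L ^+ 2)) (h * (h * ((1 + B) * (K * K)))) (h ^+ 2 * _) (ip D (u a))
  (nrm F ^+ 2) (nrm (u a) ^+ 2) (h * ip (ut a) (u a)) Fsq Fsq0 hQ' Dl Dr El Er (mulrA 2 h eta).
move=> he x1 x2 x3 x4 x5 x6 x7 *; rewrite -mulrA.
by apply/andP; split; lra.
Qed.

(* [v] is a Riemann sum for the integral of [u] over [0, T]. *)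
Lemma approximate_primitive T K eta : 0 <= T -> 0 <= K -> 0 < eta ->
  (forall s, 0 <= s <= T -> h1sum (u s) <= K) ->
  exists2 v, H1 v &
    (forall w, H1 w -> `|ip (ut T) w - ip (ut 0) w + energy_form v w| <= T * eta * h1sum w) /\
    `|2^-1 * nrm (u T) ^+ 2 - 2^-1 * nrm (u 0) ^+ 2 - ip (ut 0) v + 2^-1 * energy_form v v|
      <= T * (eta * (2 + T * K)).
Proof.
move=> T0 K0 eta0 uK; have T0' := T0.
pose P t := exists2 v, H1 v &
    (forall w, H1 w -> `|ip (ut t) w - ip (ut 0) w + energy_form v w| <= t * eta * h1sum w) /\
    `|2^-1 * nrm (u t) ^+ 2 - 2^-1 * nrm (u 0) ^+ 2 - ip (ut 0) v + 2^-1 * energy_form v v|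
      <= t * (eta * (2 + T * K)).
apply: (segment_induction (P := P)) T0' => [|t /andP[t0 tT]].
  have H0 := uH (lexx 0); have v2 := ut2 (lexx 0); have u02 := u2 (lexx 0).
  (* The zero function, written as a combination of elements of $H^1$ so that the linearity lemmas
     apply to it. *)
  exists (fun x => u 0 x + -1 * u 0 x); first exact: H1_lin.
  split=> [w Hw|].
    by rewrite energy_form_lin// !mul0r subrr mulN1r subrr addr0 normr0.
  rewrite energy_form_lin//; last exact: H1_lin.
  rewrite (ipDr u02 (sqintZ _ u02) v2) (ipZr _ u02 v2).
  by rewrite !mulN1r !subrr mulr0 addr0 normr0 mul0r.
have [del del0 step] := energy_step t0 K0 eta0.
exists del => // a b aat tbT ab abd [v Hv [v1 v2]].
have /andP[a0 at_] := aat; have /andP[tb bT] := tbT.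
have Ha := uH a0; have aK : h1sum (u a) <= K by apply: uK; rewrite a0 (le_trans at_).
have [s1 s2] := step a b aat tb ab abd aK.
have va2 := ut2 a0; have v02 := ut2 (lexx 0); have ua2 := u2 a0; have v_2 := H1_sqint Hv.
have Hv' := H1_lin (b - a) Hv Ha.
(* The next term of the Riemann sum, with the value of [u] at the left end. *)
exists (fun x => v x + (b - a) * u a x); first exact: Hv'.
split=> [w Hw|].
  rewrite energy_form_lin//.
  have := s1 w Hw; have := v1 w Hw.
  move: (ip (ut a) w) (ip (ut b) w) (ip (ut 0) w) (energy_form v w) (energy_form (u a) w) (h1sum w).
  move=> x1 x2 x3 x4 x5 x6.
  rewrite !ler_norml => /andP[l1 r1] /andP[l2 r2]; apply/andP; split; lra.
(* The integrated equation at time [a] with [w = u a] turns [ip (ut a) (u a)] into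
   [ip (ut 0) (u a) - energy_form v (u a)]. Its error is the part [T * K] in the factor [2 + T * K];
   the 2 comes from [energy_step]. *)
have := v1 _ Ha; have hT : a * eta * h1sum (u a) <= T * eta * K.
  apply: ler_pM => //; rewrite ?h1sum_ge0 ?mulr_ge0 ?(ltW eta0)//.
  by rewrite ler_wpM2r ?(ltW eta0)// (le_trans at_).
have h0 : 0 <= b - a by rewrite subr_ge0 ltW.
move=> /le_trans/(_ hT)/(ler_wpM2l h0); rewrite -[X in X * `|_|](ger0_norm h0) -normrM.
rewrite (energy_form_lin _ Hv Ha Hv') !(energy_formC _ (fun x => v x + _ * _)).
rewrite !energy_form_lin// (energy_formC (u a) v).
rewrite (ipDr v_2 (sqintZ _ ua2) v02) (ipZr _ ua2 v02).
move: (energy_form v v) (energy_form v (u a)) (energy_form (u a) (u a)) (ip (ut 0) v)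
  (ip (ut 0) (u a)) (ip (ut a) (u a)) (nrm (u b) ^+ 2) (nrm (u a) ^+ 2) (nrm (u 0) ^+ 2) v2 s2.
move=> vv vu uu i0 i1 i2 nb na n0; rewrite !ler_norml => /andP[l1 r1] /andP[l2 r2] /andP[l3 r3].
apply/andP; split; lra.
Qed.

(** The hypothesis on [J] covers every [v], so the Riemann sums for smaller and smaller [eta] need
    not have a limit; only the numerical error tends to zero. *)
Lemma nrm_energy_bound (J : R) T : 0 <= T ->
  (forall v, H1 v -> 2 * ip (ut 0) v - energy_form v v <= J) ->
  nrm (u T) ^+ 2 <= nrm (u 0) ^+ 2 + J.
Proof.
move=> T0 hJ; have [K K0 uK] := h1sum_bounded T0.
apply/ler_addgt0Pr => e e0.
have D0 : 0 < 2 * T * (2 + T * K) + 1 by rewrite ltr_wpDl// !mulr_ge0// addr_ge0// mulr_ge0.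
have eta0 : 0 < e / (2 * T * (2 + T * K) + 1) by rewrite divr_gt0.
have [v Hv [_ +]] := approximate_primitive T0 K0 eta0 uK.
rewrite ler_norml => /andP[_ hv]; have := hJ v Hv.
have : e / (2 * T * (2 + T * K) + 1) * (2 * T * (2 + T * K)) <= e.
  by rewrite mulrAC ler_pdivrMr// ler_wpM2l ?(ltW e0)// lerDl.
move: (e / _) hv => eta; move: (ip _ _) (energy_form _ _) (nrm _ ^+ 2) (nrm _ ^+ 2) => *.
lra.
Qed.

End evolution.

(** * The bound by the initial data *)

Section conclusion.
Context (R : realType) (n : nat).
Local Notation E := 'rV[R]_n.
Local Notation mu := (@lebesgue_rV R n).
Local Notation sqint := (sqint mu).
Local Notation ip := (ip mu).
Local Notation nrm := (nrm mu).

Lemma I0sq_ge (V u1 v : E -> R) : continuous V -> (forall x, 0 < V x) ->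
  (I0sq V u1 < +oo)%E -> sqint u1 -> sqint v -> sqint (fun x => V x * v x) ->
  2 * ip u1 v - ip (fun x => V x * v x) v <= fine (I0sq V u1).
Proof.
move=> cV V0 I0oo u12 v2 Vv2.
pose q x := `|u1 x| ^+ 2 / V x.
have mVi : measurable_fun setT (fun x => (V x)^-1).
  apply: continuous_rV_measurable => x; apply: (cvgV (F := nbhs x)); last exact: cV.
  by rewrite gt_eqF.
have mq : measurable_fun setT q.
  apply: measurable_funM => //; apply: measurable_funX.
  by apply: measurableT_comp => //; exact: u12.1.
have q0 x : 0 <= q x by rewrite divr_ge0 ?sqr_ge0// ltW.
have iq : mu.-integrable setT (EFin \o q).
  apply/integrableP; split; first exact/measurable_EFinP.
  apply: le_lt_trans I0oo; rewrite le_eqVlt; apply/orP; left; apply/eqP.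
  by apply: eq_integral => x _; rewrite /= ger0_norm.
have i1 := integrable_scaler 2 (sqint_mul u12 v2).
have i2 := sqint_mul Vv2 v2.
have i3 := integrable_addr i1 (integrable_scaler (-1) i2).
rewrite -[leRHS]/(\int[mu]_x q x).
have -> : 2 * ip u1 v - ip (fun x => V x * v x) v =
    \int[mu]_x (2 * (u1 x * v x) + -1 * (V x * v x * v x)).
  rewrite RintegralD//; last exact: integrable_scaler.
  rewrite (RintegralZl _ _ (sqint_mul u12 v2))// (RintegralZl _ _ i2)//.
  by rewrite mulN1r.
(* After multiplication by [V x] the pointwise inequality says that $(u_1 - V v)^2 \ge 0$. *)
apply: le_Rintegral => // x _; rewrite /q real_normK ?num_real// ler_pdivlMr//.
have := sqr_ge0 (u1 x - V x * v x); have := V0 x; nra.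
Qed.

End conclusion.

Theorem theorem1p1 (R : realType) (n : nat) (n_ge1 : (1 <= n)%N)
    (V : 'rV[R]_n -> R)
    (V_bounded : [bounded V x | x in [set: 'rV[R]_n]])
    (V_continuous : continuous V)
    (V_gt0 : forall x, 0 < V x) :
  exists2 C : R, 0 < C &
    forall u0 u1 : 'rV[R]_n -> R, H1 u0 -> L2 u1 -> (I0sq V u1 < +oo)%E ->
    forall u : R -> 'rV[R]_n -> R, weak_solution V u0 u1 u ->
    forall t : R, 0 <= t -> L2norm (u t) <= C * (L2norm u0 + I0 V u1).
Proof.
exists 1 => // u0 u1 Hu0 /L2P u12 I0oo u [ut [uC [utC uder] u0E u1E weq]] T T0.
have [B B0 VB] : exists2 B, 0 <= B & forall x, `|V x| <= B.
  by have [B B0 hB] := ex_strict_bound_gt0 V_bounded; exists B => [|x]; apply/ltW => //; exact: hB.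
have uH t : 0 <= t -> H1 (u t) by move=> /uC[].
have ut2 t : 0 <= t -> sqint (lebesgue_rV n) (ut t) by move=> /utC[/L2P].
have cont X N (f : R -> 'rV[R]_n -> R) : C0_halfline X N f -> forall t e : R, 0 <= t -> 0 < e ->
    exists2 del, 0 < del & forall s, 0 <= s -> `|s - t| < del ->
    N (fun x => f s x - f t x) <= e.
  move=> fC t e t0 e0; have [_ /cvgrPdist_le/(_ e e0)] := fC t t0.
  move=> /nbhs_ballP[del /= del0 hd]; exists del => // s s0 st.
  rewrite distrC in st; have := hd s st s0; rewrite sub0r normrN.
  exact: le_trans (ler_norm _).
have ucont := cont _ _ _ uC.
have utcont (t e : R) : 0 <= t -> 0 < e -> exists2 del, 0 < del & forall s, 0 <= s ->
    `|s - t| < del -> nrm (lebesgue_rV n) (fun x => ut s x - ut t x) <= e.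
  move=> t0 /(cont _ _ _ utC t e t0)[del del0 hd]; exists del => // s s0 st.
  by rewrite -L2normE; [exact: hd|apply: sqintB; exact: ut2].
have uder' (t e : R) : 0 <= t -> 0 < e -> exists2 del, 0 < del & forall s, 0 <= s -> s != t ->
    `|s - t| < del -> nrm (lebesgue_rV n) (fun x => (s - t)^-1 * (u s x - u t x) - ut t x) <= e.
  move=> t0 e0; have /cvgrPdist_le/(_ e e0) := uder t t0.
  move=> /nbhs_ballP[del /= del0 hd]; exists del => // s s0 nst st.
  have [us2 ut2'] := (H1_sqint (uH s s0), H1_sqint (uH t t0)).
  rewrite -L2normE; last by apply: sqintB (ut2 t t0); apply: sqintZ; exact: sqintB.
  rewrite distrC in st; have := hd s st nst s0; rewrite sub0r normrN.
  exact: le_trans (ler_norm _).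
have u02 := H1_sqint Hu0; have uu02 := H1_sqint (uH 0 (lexx 0)).
(* The initial values are attained almost everywhere only, so the norms are compared by exchanging
   one factor of the scalar product at a time. *)
have n0 : nrm (lebesgue_rV n) (u 0) = nrm (lebesgue_rV n) u0.
  have h := ae_nrmB uu02 u02 u0E; rewrite /nrm.
  by rewrite (eq_ip uu02 u02 uu02 h) ipC (eq_ip uu02 u02 u02 h).
have key := nrm_energy_bound B0 V_continuous VB uH ucont ut2 utcont uder' weq T0.
have {}key : nrm (lebesgue_rV n) (u T) ^+ 2 <= nrm (lebesgue_rV n) u0 ^+ 2 + fine (I0sq V u1).
  rewrite -n0; apply: key => v Hv; have v2 := H1_sqint Hv.
  rewrite (eq_ip (ut2 0 (lexx 0)) u12 v2 (ae_nrmB (ut2 0 (lexx 0)) u12 u1E)).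
  have Vv2 := sqintV V_continuous VB v2.
  apply: le_trans (I0sq_ge V_continuous V_gt0 I0oo u12 v2 Vv2).
  (* The gradient part of the energy form is a sum of squares and is discarded here. *)
  rewrite lerD2l lerN2 lerDr; apply: sumr_ge0 => i _; exact: ip_ge0.
rewrite mul1r !L2normE//; last exact: H1_sqint (uH T T0).
have I00 : 0 <= fine (I0sq V u1).
  apply: fine_ge0; apply: integral_ge0 => x _.
  by rewrite lee_fin divr_ge0 ?sqr_ge0// ltW.
rewrite -ler_sqr ?nnegrE ?addr_ge0 ?nrm_ge0 ?sqrtr_ge0//.
(* The square of the sum exceeds the sum of the squares by a nonnegative cross term, which gives the
   constant one. *)
apply: le_trans key _; rewrite /I0 sqrrD (sqr_sqrtr I00) lerD2r lerDl.
by rewrite mulrn_wge0// mulr_ge0 ?nrm_ge0 ?sqrtr_ge0.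
Qed.
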